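(* Let $\Delta t>0$, let $k\ge2$ and $r\ge0$ be integers, and consider the fully discrete discontinuous Galerkin methods described in the context, with either the upwind or the central numerical flux for the Vlasov equation, and either the central or one of the two alternating numerical fluxes for Maxwell's equations. Let $(f_h^n,\mathbf{E}_h^n,\mathbf{B}_h^n)_{n\ge0}$ be a sequence generated by the method. Then $TE_n=TE_{n+1}$ for all $n\ge0$, where: (i) for the time integrators Scheme-2$(\Delta t)$, Scheme-4$(\Delta t)$ and Scheme-4F$(\Delta t)$, $$2\,TE_n=\int_{\Omega_x}\int_{\Omega_v}f_h^n|\mathbf{v}|^2\,d\mathbf{v}\,d\mathbf{x}+\int_{\Omega_x}\big(|\mathbf{E}_h^n|^2+|\mathbf{B}_h^n|^2\big)\,d\mathbf{x};$$ (ii) for the time integrator Scheme-1$(\Delta t)$, $$2\,TE_n=\int_{\Omega_x}\int_{\Omega_v}f_h^n|\mathbf{v}|^2\,d\mathbf{v}\,d\mathbf{x}+\int_{\Omega_x}\big(|\mathbf{E}_h^n|^2+\mathbf{B}_h^{n-1/2}\cdot\mathbf{B}_h^{n+1/2}\big)\,d\mathbf{x};$$ (iii) for the time integrator Scheme-3$(\Delta t)$, $$2\,TE_n=\int_{\Omega_x}\int_{\Omega_v}f_h^n|\mathbf{v}|^2\,d\mathbf{v}\,d\mathbf{x}+\int_{\Omega_x}\big(|\mathbf{B}_h^n|^2+\mathbf{E}_h^{n-1/2}\cdot\mathbf{E}_h^{n+1/2}\big)\,d\mathbf{x}.$$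
   Context: Mesh and spaces. $\Omega_x\subset\mathbb{R}^3$ is a box with periodic boundary conditions, $\Omega_v\subset\mathbb{R}^3$ a bounded velocity domain. $\mathcal{T}_h^x=\{K_x\}$ and $\mathcal{T}_h^v=\{K_v\}$ are partitions of $\Omega_x$ (periodic) and $\Omega_v$ into (rotated) Cartesian elements or simplices; $\mathcal{T}_h=\{K=K_x\times K_v\}$. $\mathcal{G}_h^k=\{g\in L^2(\Omega_x\times\Omega_v): g|_{K}\in P^k(K)\ \forall K\in\mathcal{T}_h\}$ and $\mathcal{U}_h^r=\{\mathbf{U}\in[L^2(\Omega_x)]^3:\mathbf{U}|_{K_x}\in[P^r(K_x)]^3\ \forall K_x\in\mathcal{T}_h^x\}$, where $P^k(D)$ is the set of polynomials of total degree at most $k$ on $D$. On each interior edge (face) $e=K^+\cap K^-$ of $\mathcal{T}_h^x$ (periodically identified) or $\mathcal{T}_h^v$, with a fixed labelling of the two neighbours as $\pm$ and outward unit normals $\mathbf{n}^\pm$ of $K^\pm$: jumps $[g]=g^+\mathbf{n}^++g^-\mathbf{n}^-$, averages $\{g\}=\frac12(g^++g^-)$, $\{\mathbf{U}\}=\frac12(\mathbf{U}^++\mathbf{U}^-)$, with subscript $x$ or $v$ indicating the variable in which the traces are taken. $\mathbf{n}_x$, $\mathbf{n}_v$ are outward unit normals of $\partial K_x$, $\partial K_v$. Velocity boundary: standing assumption that $\Omega_v$ is so large that all numerical $f_h$'s (including intermediate ones) vanish on $\partial\Omega_v$, and the numerical flux in $\mathbf{v}$ on faces contained in $\partial\Omega_v$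 is zero. Forms. For $f,\psi\in\mathcal{G}_h^k$ and fields $\mathbf{E},\mathbf{B}\in\mathcal{U}_h^r$, with $\mathbf{F}=\mathbf{E}+\mathbf{v}\times\mathbf{B}$, $A_K(f;\mathbf{E},\mathbf{B};\psi)=-\int_K f\mathbf{v}\cdot\nabla_{\mathbf{x}}\psi\,d\mathbf{v}d\mathbf{x}-\int_K f\,\mathbf{F}\cdot\nabla_{\mathbf{v}}\psi\,d\mathbf{v}d\mathbf{x}+\int_{K_v}\int_{\partial K_x}\widehat{f\mathbf{v}\cdot\mathbf{n}_x}\,\psi\,ds_xd\mathbf{v}+\int_{K_x}\int_{\partial K_v}\widehat{f\mathbf{F}\cdot\mathbf{n}_v}\,\psi\,ds_vd\mathbf{x}$ (traces of $\psi$ from inside $K$). Vlasov fluxes: central: $\widehat{f\mathbf{v}\cdot\mathbf{n}_x}=\{f\mathbf{v}\}_x\cdot\mathbf{n}_x$, $\widehat{f\mathbf{F}\cdot\mathbf{n}_v}=\{f\mathbf{F}\}_v\cdot\mathbf{n}_v$; upwind: $\widehat{f\mathbf{v}\cdot\mathbf{n}_x}=(\{f\mathbf{v}\}_x+\frac{|\mathbf{v}\cdot\mathbf{n}_x|}{2}[f]_x)\cdot\mathbf{n}_x$, $\widehat{f\mathbf{F}\cdot\mathbf{n}_v}=(\{f\mathbf{F}\}_v+\frac{|\mathbf{F}\cdot\mathbf{n}_v|}{2}[f]_v)\cdot\mathbf{n}_v$. In a (sub)step with negative step size the upwind flux is replaced by the downwind flux, i.e. the sign in front of the jump terms is changed from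 $+$ to $-$. $C^E_{K_x}(\mathbf{E};\mathbf{U})=\int_{K_x}\mathbf{E}\cdot\nabla_{\mathbf{x}}\times\mathbf{U}\,d\mathbf{x}+\int_{\partial K_x}(\mathbf{n}_x\times\widetilde{\mathbf{E}})\cdot\mathbf{U}\,ds_x$, $C^B_{K_x}(\mathbf{B};\mathbf{V})=\int_{K_x}\mathbf{B}\cdot\nabla_{\mathbf{x}}\times\mathbf{V}\,d\mathbf{x}+\int_{\partial K_x}(\mathbf{n}_x\times\widetilde{\mathbf{B}})\cdot\mathbf{V}\,ds_x$, with Maxwell fluxes chosen (once and for all) as central: $\widetilde{\mathbf{E}}=\{\mathbf{E}\}_x,\ \widetilde{\mathbf{B}}=\{\mathbf{B}\}_x$; or alternating: $\widetilde{\mathbf{E}}=\mathbf{E}^+,\ \widetilde{\mathbf{B}}=\mathbf{B}^-$; or alternating: $\widetilde{\mathbf{E}}=\mathbf{E}^-,\ \widetilde{\mathbf{B}}=\mathbf{B}^+$. $\mathbf{J}_h^s(\mathbf{x})=\int_{\Omega_v}f_h^s\,\mathbf{v}\,d\mathbf{v}$. Fully discrete schemes with step $\tau$ (all $f_h$'s in $\mathcal{G}_h^k$, all $\mathbf{E}_h,\mathbf{B}_h$'s in $\mathcal{U}_h^r$; the equations hold for all elements and all test functions $\psi\in\mathcal{G}_h^k$, $\mathbf{U},\mathbf{V}\in\mathcal{U}_h^r$; for implicit schemes the new state is any solution). Write $\bar g=\frac12(g^n+g^{n+1})$. Scheme-1$(\tau)$: $\int_K\frac{f_h^{n+1/2}-f_h^n}{\tau/2}\psi+A_K(f_h^n;\mathbf{E}_h^n,\mathbf{B}_h^n;\psi)=0$;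 $\int_{K_x}\frac{\mathbf{B}_h^{n+1/2}-\mathbf{B}_h^n}{\tau/2}\cdot\mathbf{U}=-C^E_{K_x}(\mathbf{E}_h^n;\mathbf{U})$; $\int_{K_x}\frac{\mathbf{E}_h^{n+1}-\mathbf{E}_h^n}{\tau}\cdot\mathbf{V}=C^B_{K_x}(\mathbf{B}_h^{n+1/2};\mathbf{V})-\int_{K_x}\mathbf{J}_h^{n+1/2}\cdot\mathbf{V}$; $\int_{K_x}\frac{\mathbf{B}_h^{n+1}-\mathbf{B}_h^{n+1/2}}{\tau/2}\cdot\mathbf{U}=-C^E_{K_x}(\mathbf{E}_h^{n+1};\mathbf{U})$; $\int_K\frac{f_h^{n+1}-f_h^n}{\tau}\psi+A_K(f_h^{n+1/2};\bar{\mathbf{E}}_h,\mathbf{B}_h^{n+1/2};\psi)=0$. Scheme-2$(\tau)$: $\int_K\frac{f_h^{n+1/2}-f_h^n}{\tau/2}\psi+A_K(f_h^n;\mathbf{E}_h^n,\mathbf{B}_h^n;\psi)=0$; $\int_{K_x}\frac{\mathbf{B}_h^{n+1}-\mathbf{B}_h^n}{\tau}\cdot\mathbf{U}=-C^E_{K_x}(\bar{\mathbf{E}}_h;\mathbf{U})$; $\int_{K_x}\frac{\mathbf{E}_h^{n+1}-\mathbf{E}_h^n}{\tau}\cdot\mathbf{V}=C^B_{K_x}(\bar{\mathbf{B}}_h;\mathbf{V})-\int_{K_x}\mathbf{J}_h^{n+1/2}\cdot\mathbf{V}$; $\int_K\frac{f_h^{n+1}-f_h^n}{\tau}\psi+A_K(f_h^{n+1/2};\bar{\mathbf{E}}_h,\bar{\mathbf{B}}_h;\psi)=0$.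 Scheme-3$(\tau)$: $\int_{K_x}\frac{\mathbf{E}_h^{n+1/2}-\mathbf{E}_h^n}{\tau/2}\cdot\mathbf{V}=C^B_{K_x}(\mathbf{B}_h^n;\mathbf{V})-\int_{K_x}\mathbf{J}_h^n\cdot\mathbf{V}$; $\int_{K_x}\frac{\mathbf{B}_h^{n+1}-\mathbf{B}_h^n}{\tau}\cdot\mathbf{U}=-C^E_{K_x}(\mathbf{E}_h^{n+1/2};\mathbf{U})$; $\int_K\frac{f_h^{n+1}-f_h^n}{\tau}\psi+A_K(\bar f_h;\mathbf{E}_h^{n+1/2},\bar{\mathbf{B}}_h;\psi)=0$; $\int_{K_x}\frac{\mathbf{E}_h^{n+1}-\mathbf{E}_h^{n+1/2}}{\tau/2}\cdot\mathbf{V}=C^B_{K_x}(\mathbf{B}_h^{n+1};\mathbf{V})-\int_{K_x}\mathbf{J}_h^{n+1}\cdot\mathbf{V}$. Scheme-4$(\tau)$: $\int_{K_x}\frac{\mathbf{B}_h^{n+1}-\mathbf{B}_h^n}{\tau}\cdot\mathbf{U}=-C^E_{K_x}(\bar{\mathbf{E}}_h;\mathbf{U})$; $\int_{K_x}\frac{\mathbf{E}_h^{n+1}-\mathbf{E}_h^n}{\tau}\cdot\mathbf{V}=C^B_{K_x}(\bar{\mathbf{B}}_h;\mathbf{V})-\int_{K_x}\bar{\mathbf{J}}_h\cdot\mathbf{V}$; $\int_K\frac{f_h^{n+1}-f_h^n}{\tau}\psi+A_K(\bar f_h;\bar{\mathbf{E}}_h,\bar{\mathbf{B}}_h;\psi)=0$.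 Scheme-4F$(\tau)$: the composition Scheme-4$(\beta_1\tau)$ Scheme-4$(\beta_2\tau)$ Scheme-4$(\beta_3\tau)$ with $\beta_1=\beta_3=(2+2^{1/3}+2^{-1/3})/3$, $\beta_2=1-2\beta_1<0$ (downwind flux instead of upwind in the $\beta_2$ substep). Half-step values: $\mathbf{B}_h^{n+1/2}$ (Scheme-1) and $\mathbf{E}_h^{n+1/2}$ (Scheme-3) are the intermediate values computed in the step from $n$ to $n+1$; for $n\ge1$ the index $n-1/2$ refers to the previous step, and for $n=0$ one sets $\mathbf{B}_h^{-1/2}:=2\mathbf{B}_h^0-\mathbf{B}_h^{1/2}$, $\mathbf{E}_h^{-1/2}:=2\mathbf{E}_h^0-\mathbf{E}_h^{1/2}$. *)

(* Defs.v *)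
From HB Require Import structures.
From mathcomp Require Import all_boot all_order all_algebra.
(* The notations of mpoly clash with those of MathComp-Analysis. *)
From mathcomp Require mpoly.
Import (canonicals, coercions) mpoly.
From mathcomp Require Import all_classical all_reals all_analysis.

Set Implicit Arguments.
Unset Strict Implicit.
Unset Printing Implicit Defensive.

Import Order.TTheory GRing.Theory Num.Theory.
Import numFieldNormedType.Exports.

Local Open Scope classical_set_scope.
Local Open Scope ring_scope.

(* R^3 is the iterated product, so that its topology, its normed-module
   structure and its sigma-algebra are the library's product structures.  The
   library norm there is the maximum norm; the Euclidean norm is [enorm]. *)
Notation R3 R := (R * R * R)%type.

Lemma sigma_finite_prod d1 d2 (T1 : measurableType d1) (T2 : measurableType d2)
    (R : realType) (m1 : {sigma_finite_measure set T1 -> \bar R})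
    (m2 : {sigma_finite_measure set T2 -> \bar R}) :
  sigma_finite setT (m1 \x m2)%E.
Proof.
have /sigma_finiteP[F [TF ndF Foo]] := sigma_finiteT m1.
have /sigma_finiteP[G [TG ndG Goo]] := sigma_finiteT m2.
exists (fun n => F n `*` G n).
  rewrite -setXTT TF TG predeqE => -[x y]; split.
    move=> [/= [n _ Fnx] [k _ Gky]]; exists (maxn n k) => //; split.
    - by move: x Fnx; exact/subsetPset/ndF/leq_maxl.
    - by move: y Gky; exact/subsetPset/ndG/leq_maxr.
  by move=> [n _ []/= ? ?]; split; exists n.
move=> k; have [? ?] := Foo k; have [? ?] := Goo k.
split; first exact: measurableX.
by rewrite product_measure1E// lte_mul_pinfty// ge0_fin_numE.
Qed.

Notation mR R := (measurableTypeR R).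

Definition leb1 (R : realType) : {sigma_finite_measure set (mR R) -> \bar R} :=
  @lebesgue_measure R.

Section Vectors.
Variable R : realType.

Definition c1 (x : R3 R) : R := x.1.1.
Definition c2 (x : R3 R) : R := x.1.2.
Definition c3 (x : R3 R) : R := x.2.

Definition dot (x y : R3 R) : R := c1 x * c1 y + c2 x * c2 y + c3 x * c3 y.
Definition cross (x y : R3 R) : R3 R :=
  (c2 x * c3 y - c3 x * c2 y, c3 x * c1 y - c1 x * c3 y,
   c1 x * c2 y - c2 x * c1 y).
Definition enorm (x : R3 R) : R := Num.sqrt (dot x x).

Definition basis1 : R3 R := (1, 0, 0).
Definition basis2 : R3 R := (0, 1, 0).
Definition basis3 : R3 R := (0, 0, 1).

Definition grad (g : R3 R -> R) (x : R3 R) : R3 R :=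
  ('D_basis1 g x, 'D_basis2 g x, 'D_basis3 g x).
Definition curl (U : R3 R -> R3 R) (x : R3 R) : R3 R :=
  ('D_basis2 (c3 \o U) x - 'D_basis3 (c2 \o U) x,
   'D_basis3 (c1 \o U) x - 'D_basis1 (c3 \o U) x,
   'D_basis1 (c2 \o U) x - 'D_basis2 (c1 \o U) x).

Definition leb2 : set (mR R * mR R)%type -> \bar R := (leb1 R \x leb1 R)%E.
HB.instance Definition _ := Measure.copy leb2 (leb1 R \x leb1 R)%E.
HB.instance Definition _ :=
  Measure_isSigmaFinite.Build _ _ _ leb2 (sigma_finite_prod (leb1 R) (leb1 R)).

Definition leb3 : set (mR R * mR R * mR R)%type -> \bar R :=
  (leb2 \x leb1 R)%E.
HB.instance Definition _ := Measure.copy leb3 (leb2 \x leb1 R)%E.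
HB.instance Definition _ :=
  Measure_isSigmaFinite.Build _ _ _ leb3 (sigma_finite_prod leb2 (leb1 R)).

Definition leb6 : set (mR R * mR R * mR R * (mR R * mR R * mR R))%type -> \bar R
  := (leb3 \x leb3)%E.
HB.instance Definition _ := Measure.copy leb6 (leb3 \x leb3)%E.
HB.instance Definition _ :=
  Measure_isSigmaFinite.Build _ _ _ leb6 (sigma_finite_prod leb3 leb3).

End Vectors.

Arguments c1 {R} x.
Arguments c2 {R} x.
Arguments c3 {R} x.

Section Cells.
Variable R : realType.

Inductive shape := Cartesian | Simplex.

(* The element spanned at the vertex [org] by the three edge vectors. *)
Record cell := Cell {
  cshape : shape;
  org : R3 R;
  edge1 : R3 R;
  edge2 : R3 R;
  edge3 : R3 R }.

Definition valid_cell (K : cell) : Prop :=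
  match cshape K with
  | Cartesian =>
      [/\ edge1 K != 0, edge2 K != 0 & edge3 K != 0] /\
      [/\ dot (edge1 K) (edge2 K) = 0, dot (edge2 K) (edge3 K) = 0
        & dot (edge3 K) (edge1 K) = 0]
  | Simplex => dot (cross (edge1 K) (edge2 K)) (edge3 K) != 0
  end.

Definition ref_open (sh : shape) : set (R3 R) :=
  match sh with
  | Cartesian =>
      [set t | [/\ 0 < c1 t < 1, 0 < c2 t < 1 & 0 < c3 t < 1]]
  | Simplex =>
      [set t | [/\ 0 < c1 t, 0 < c2 t, 0 < c3 t & c1 t + c2 t + c3 t < 1]]
  end.

Definition ref_closed (sh : shape) : set (R3 R) :=
  match sh with
  | Cartesian =>
      [set t | [/\ 0 <= c1 t <= 1, 0 <= c2 t <= 1 & 0 <= c3 t <= 1]]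
  | Simplex =>
      [set t | [/\ 0 <= c1 t, 0 <= c2 t, 0 <= c3 t & c1 t + c2 t + c3 t <= 1]]
  end.

Definition cell_map (K : cell) (t : R3 R) : R3 R :=
  org K + (c1 t *: edge1 K + c2 t *: edge2 K + c3 t *: edge3 K).

Definition ocell (K : cell) : set (R3 R) := cell_map K @` ref_open (cshape K).
Definition ccell (K : cell) : set (R3 R) := cell_map K @` ref_closed (cshape K).

Definition barycenter (K : cell) : R3 R :=
  match cshape K with
  | Cartesian => org K + 2^-1 *: (edge1 K + edge2 K + edge3 K)
  | Simplex => org K + 4^-1 *: (edge1 K + edge2 K + edge3 K)
  end.

(* A planar piece of the boundary: a vertex and two edge vectors, spanning a
   parallelogram or a triangle. *)
Definition facet := (R3 R * R3 R * R3 R)%type.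
Definition forg (F : facet) : R3 R := F.1.1.
Definition fedge1 (F : facet) : R3 R := F.1.2.
Definition fedge2 (F : facet) : R3 R := F.2.

Definition facets (K : cell) : seq facet :=
  let p := org K in
  let a := edge1 K in let b := edge2 K in let c := edge3 K in
  match cshape K with
  | Cartesian =>
      [:: (p, b, c); (p + a, b, c); (p, c, a); (p + b, c, a);
          (p, a, b); (p + c, a, b)]
  | Simplex =>
      [:: (p, b, c); (p, c, a); (p, a, b); (p + a, b - a, c - a)]
  end.

Definition ref_facet (sh : shape) : set (R * R)%type :=
  match sh with
  | Cartesian => [set t | 0 < t.1 < 1 /\ 0 < t.2 < 1]
  | Simplex => [set t | [/\ 0 < t.1, 0 < t.2 & t.1 + t.2 < 1]]
  end.

Definition facet_map (F : facet) (t : R * R) : R3 R :=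
  forg F + (t.1 *: fedge1 F + t.2 *: fedge2 F).

Definition facet_dir (F : facet) : R3 R := cross (fedge1 F) (fedge2 F).

(* The sign selects the unit normal of F that points away from the barycenter
   of K. *)
Definition outward_normal (K : cell) (F : facet) : R3 R :=
  (Num.sg (dot (facet_dir F) (forg F - barycenter K)) / enorm (facet_dir F))
    *: facet_dir F.

(* The surface integral over the part of the boundary of K lying in S of
   h(n, x), n the outward unit normal of K at x; [enorm (facet_dir F)] is the
   surface element of the parametrization [facet_map F]. *)
Definition bd_int (K : cell) (S : set (R3 R)) (h : R3 R -> R3 R -> R) : R :=
  \sum_(F <- facets K)
    enorm (facet_dir F) *
    \int[@leb2 R]_(t in ref_facet (cshape K) `&` facet_map F @^-1` S)
      h (outward_normal K F) (facet_map F t).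

(* The trace at a boundary point x of the restriction of g to K. *)
Definition trace (K : cell) (g : R3 R -> R) (x : R3 R) : R :=
  lim (g @ within (ocell K) (nbhs x)).
Definition vtrace (K : cell) (U : R3 R -> R3 R) (x : R3 R) : R3 R :=
  (trace K (c1 \o U) x, trace K (c2 \o U) x, trace K (c3 \o U) x).

End Cells.

(* A translation of the periodic box by s - (1, 1, 1) periods, s in
   {0, 1, 2}^3.  As all elements lie in the closed box, only these images of an
   element can meet another element. *)
Definition shift := {ffun 'I_3 -> 'I_3}.
Definition no_shift : shift := [ffun=> inord 1].
Definition opp_shift (s : shift) : shift := [ffun i => rev_ord (s i)].

Record dg_mesh (R : realType) := DGMesh {
  xlo : R3 R;
  xhi : R3 R;
  omv : set (R3 R);
  xidx : finType;
  xcell : xidx -> cell R;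
  vidx : finType;
  vcell : vidx -> cell R;
  (* [xplus K K' s]: K is the element K^+ of the face shared by K and the image
     of K' under the shift s. *)
  xplus : xidx -> xidx -> shift -> bool }.

Inductive vlasov_flux := VCentral | VUpwind.
Inductive trace_rule := TAverage | TPlus | TMinus.
Inductive maxwell_flux := MCentral | MPlusMinus | MMinusPlus.

Definition rule_E (mf : maxwell_flux) : trace_rule :=
  match mf with
  | MCentral => TAverage | MPlusMinus => TPlus | MMinusPlus => TMinus
  end.
Definition rule_B (mf : maxwell_flux) : trace_rule :=
  match mf with
  | MCentral => TAverage | MPlusMinus => TMinus | MMinusPlus => TPlus
  end.

Section Mesh.
Variables (R : realType) (M : dg_mesh R).

Definition omx : set (R3 R) :=
  [set x | [/\ c1 (xlo M) <= c1 x <= c1 (xhi M),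
               c2 (xlo M) <= c2 x <= c2 (xhi M)
             & c3 (xlo M) <= c3 x <= c3 (xhi M)]].

Definition offset (s : shift) : R3 R :=
  let L := xhi M - xlo M in
  let z (i : nat) : R := (s (inord i) : nat)%:R - 1 in
  (z 0%N * c1 L, z 1%N * c2 L, z 2%N * c3 L).

Definition is_partition (I : finType) (K : I -> cell R) (D : set (R3 R)) :=
  [/\ forall i, valid_cell (K i),
      D = \bigcup_i ccell (K i)
    & forall i j, i != j -> ocell (K i) `&` ocell (K j) = set0].

(* [omv M] is bounded, being a finite union of bounded cells. *)
Definition valid_mesh : Prop :=
  [/\ [/\ c1 (xlo M) < c1 (xhi M), c2 (xlo M) < c2 (xhi M)
        & c3 (xlo M) < c3 (xhi M)],
      is_partition (@xcell R M) omx,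
      is_partition (@vcell R M) (omv M)
    & forall (K K' : xidx M) (s : shift), (K', s) != (K, no_shift) ->
        xplus K' K (opp_shift s) = ~~ xplus K K' s].

Definition field := R3 R -> R3 R.
Definition density := R3 R -> R3 R -> R.

Definition coord3 (x : R3 R) (i : 'I_3) : R := [:: c1 x; c2 x; c3 x]`_i.
Definition coord6 (x v : R3 R) (i : 'I_6) : R :=
  [:: c1 x; c2 x; c3 x; c1 v; c2 v; c3 v]`_i.

(* [mpoly.msize p] is one plus the total degree of p (0 for
   p = 0). *)
Definition in_G (k : nat) (f : density) : Prop :=
  ((fun z => f z.1 z.2) \_ (omx `*` omv M)) \in Lfun (@leb6 R) 2%:E /\
  forall (K : xidx M) (L : vidx M), exists p : mpoly.mpoly 6 R,
    (mpoly.msize p <= k.+1)%N /\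
    forall x v, ocell (xcell K) x -> ocell (vcell L) v ->
      f x v = mpoly.meval (coord6 x v) p.

Definition in_U_component (r : nat) (u : R3 R -> R) : Prop :=
  (u \_ omx) \in Lfun (@leb3 R) 2%:E /\
  forall K : xidx M, exists p : mpoly.mpoly 3 R,
    (mpoly.msize p <= r.+1)%N /\
    forall x, ocell (xcell K) x -> u x = mpoly.meval (coord3 x) p.

Definition in_U (r : nat) (U : field) : Prop :=
  [/\ in_U_component r (c1 \o U), in_U_component r (c2 \o U)
    & in_U_component r (c3 \o U)].

Definition vanishes_on_bd (f : density) : Prop :=
  forall (K : xidx M) (L : vidx M) (F : facet R) (x : R3 R) (t : R * R),
    F \in facets (vcell L) ->
    ocell (xcell K) x -> ref_facet (cshape (vcell L)) t ->
    (closure (omv M) `\` (omv M)°) (facet_map F t) ->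
    trace (vcell L) (f x) (facet_map F t) = 0.

(* Sums over the faces e of an element, e being its intersection with another
   element (up to periodicity in x).  Intersections of dimension less than 2
   do not contribute.  In v, faces contained in the boundary of [omv M] are
   absent because the numerical flux is zero there. *)
Definition x_faces (K : xidx M)
    (h : xidx M -> shift -> R3 R -> R3 R -> R) : R :=
  \sum_(K' : xidx M) \sum_(s : shift | (K', s) != (K, no_shift))
    bd_int (xcell K) [set x | ccell (xcell K') (x - offset s)] (h K' s).

Definition v_faces (L : vidx M) (h : vidx M -> R3 R -> R3 R -> R) : R :=
  \sum_(L' : vidx M | L' != L) bd_int (vcell L) (ccell (vcell L')) (h L').

Definition x_int (K : xidx M) (h : R3 R -> R) : R :=
  \int[@leb3 R]_(x in ocell (xcell K)) h x.
Definition v_int (L : vidx M) (h : R3 R -> R) : R :=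
  \int[@leb3 R]_(v in ocell (vcell L)) h v.

Definition avg {V : lmodType R} (a b : V) : V := 2^-1 *: (a + b).
(* n is the outward normal of the side where the trace is a. *)
Definition jump (a b : R) (n : R3 R) : R3 R := a *: n + b *: (- n).

(* 1 for upwind, -1 for downwind (negative step c), 0 for central. *)
Definition dissipation (vf : vlasov_flux) (c : R) : R :=
  match vf with VCentral => 0 | VUpwind => Num.sg c end.

Definition x_flux (d : R) (n v : R3 R) (fin fout : R) : R :=
  dot (avg (fin *: v) (fout *: v)
       + (d * (`|dot v n| / 2)) *: jump fin fout n) n.

(* F is the common trace of E + v x B, which is continuous in v. *)
Definition v_flux (d : R) (n F : R3 R) (fin fout : R) : R :=
  dot (avg (fin *: F) (fout *: F)
       + (d * (`|dot F n| / 2)) *: jump fin fout n) n.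

Definition lorentz (E B : field) (x v : R3 R) : R3 R := E x + cross v (B x).

Definition A_form (d : R) (f : density) (E B : field) (psi : density)
    (K : xidx M) (L : vidx M) : R :=
  - x_int K (fun x => v_int L (fun v =>
      f x v * dot v (grad (fun y => psi y v) x)))
  - x_int K (fun x => v_int L (fun v =>
      f x v * dot (lorentz E B x v) (grad (psi x) v)))
  + v_int L (fun v => x_faces K (fun K' s n x =>
      x_flux d n v (trace (xcell K) (fun y => f y v) x)
                   (trace (xcell K') (fun y => f y v) (x - offset s))
      * trace (xcell K) (fun y => psi y v) x))
  + x_int K (fun x => v_faces L (fun L' n v =>
      v_flux d n (lorentz E B x v) (trace (vcell L) (f x) v)
                                   (trace (vcell L') (f x) v)
      * trace (vcell L) (psi x) v)).

Definition num_trace (tr : trace_rule) (is_plus : bool) (a b : R3 R) : R3 R :=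
  match tr with
  | TAverage => avg a b
  | TPlus => if is_plus then a else b
  | TMinus => if is_plus then b else a
  end.

Definition C_form (tr : trace_rule) (K : xidx M) (W U : field) : R :=
  x_int K (fun x => dot (W x) (curl U x))
  + x_faces K (fun K' s n x =>
      dot (cross n (num_trace tr (xplus K K' s) (vtrace (xcell K) W x)
                      (vtrace (xcell K') W (x - offset s))))
          (vtrace (xcell K) U x)).

Definition current (f : density) : field := fun x =>
  (\int[@leb3 R]_(v in omv M) (f x v * c1 v),
   \int[@leb3 R]_(v in omv M) (f x v * c2 v),
   \int[@leb3 R]_(v in omv M) (f x v * c3 v)).

Definition midf (f g : density) : density :=
  fun x v => 2^-1 * (f x v + g x v).
Definition midF (U V : field) : field := fun x => 2^-1 *: (U x + V x).

Section Schemes.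
Variables (vf : vlasov_flux) (mf : maxwell_flux) (k r : nat).

(* (f1 - f0) / c + (transport of g by E, B) = 0. *)
Definition vlasov_eq (c : R) (f0 f1 g : density) (E B : field) : Prop :=
  forall (K : xidx M) (L : vidx M) (psi : density), in_G k psi ->
    x_int K (fun x => v_int L (fun v => (f1 x v - f0 x v) / c * psi x v))
    + A_form (dissipation vf c) g E B psi K L = 0.

Definition faraday_eq (c : R) (B0 B1 E : field) : Prop :=
  forall (K : xidx M) (U : field), in_U r U ->
    x_int K (fun x => dot (c^-1 *: (B1 x - B0 x)) (U x))
    = - C_form (rule_E mf) K E U.

Definition ampere_eq (c : R) (E0 E1 B J : field) : Prop :=
  forall (K : xidx M) (V : field), in_U r V ->
    x_int K (fun x => dot (c^-1 *: (E1 x - E0 x)) (V x))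
    = C_form (rule_B mf) K B V - x_int K (fun x => dot (J x) (V x)).

Definition in_G0 (f : density) : Prop := in_G k f /\ vanishes_on_bd f.

Record state := State { sf : density; sE : field; sB : field }.

Definition is_state (u : state) : Prop :=
  [/\ in_G0 (sf u), in_U r (sE u) & in_U r (sB u)].

Definition scheme1 (tau : R) (u : state) (Bh : field) (w : state) : Prop :=
  [/\ is_state u, is_state w, in_U r Bh
    & exists fh, in_G0 fh /\
      [/\ vlasov_eq (tau / 2) (sf u) fh (sf u) (sE u) (sB u),
          faraday_eq (tau / 2) (sB u) Bh (sE u),
          ampere_eq tau (sE u) (sE w) Bh (current fh),
          faraday_eq (tau / 2) Bh (sB w) (sE w)
        & vlasov_eq tau (sf u) (sf w) fh (midF (sE u) (sE w)) Bh]].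

Definition scheme2 (tau : R) (u w : state) : Prop :=
  [/\ is_state u, is_state w
    & exists fh, in_G0 fh /\
      [/\ vlasov_eq (tau / 2) (sf u) fh (sf u) (sE u) (sB u),
          faraday_eq tau (sB u) (sB w) (midF (sE u) (sE w)),
          ampere_eq tau (sE u) (sE w) (midF (sB u) (sB w)) (current fh)
        & vlasov_eq tau (sf u) (sf w) fh
            (midF (sE u) (sE w)) (midF (sB u) (sB w))]].

Definition scheme3 (tau : R) (u : state) (Eh : field) (w : state) : Prop :=
  [/\ is_state u, is_state w, in_U r Eh
    & [/\ ampere_eq (tau / 2) (sE u) Eh (sB u) (current (sf u)),
          faraday_eq tau (sB u) (sB w) Eh,
          vlasov_eq tau (sf u) (sf w) (midf (sf u) (sf w)) Eh
            (midF (sB u) (sB w))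
        & ampere_eq (tau / 2) Eh (sE w) (sB w) (current (sf w))]].

Definition scheme4 (tau : R) (u w : state) : Prop :=
  [/\ is_state u, is_state w
    & [/\ faraday_eq tau (sB u) (sB w) (midF (sE u) (sE w)),
          ampere_eq tau (sE u) (sE w) (midF (sB u) (sB w))
            (midF (current (sf u)) (current (sf w)))
        & vlasov_eq tau (sf u) (sf w) (midf (sf u) (sf w))
            (midF (sE u) (sE w)) (midF (sB u) (sB w))]].

Definition beta1 : R := (2 + 2 `^ (1 / 3) + 2 `^ (- (1 / 3))) / 3.
Definition beta2 : R := 1 - 2 * beta1.

Definition scheme4F (tau : R) (u w : state) : Prop :=
  exists y z, [/\ scheme4 (beta1 * tau) u y, scheme4 (beta2 * tau) y z
                & scheme4 (beta1 * tau) z w].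

End Schemes.

Definition kinetic (f : density) : R :=
  \int[@leb3 R]_(x in omx) \int[@leb3 R]_(v in omv M) (f x v * dot v v).

Definition energy (u : state) : R :=
  2^-1 * (kinetic (sf u)
    + \int[@leb3 R]_(x in omx)
        (dot (sE u x) (sE u x) + dot (sB u x) (sB u x))).

(* The value at n - 1/2 from the values W at integer times and Wh at the times
   n + 1/2, with the reflection convention at n = 0. *)
Definition prev_half (W Wh : nat -> field) (n : nat) : field :=
  if n is m.+1 then Wh m else fun x => 2 *: W 0%N x - Wh 0%N x.

Definition energy1 (u : nat -> state) (Bh : nat -> field) (n : nat) : R :=
  2^-1 * (kinetic (sf (u n))
    + \int[@leb3 R]_(x in omx)
        (dot (sE (u n) x) (sE (u n) x)
         + dot (prev_half (sB \o u) Bh n x) (Bh n x))).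

Definition energy3 (u : nat -> state) (Eh : nat -> field) (n : nat) : R :=
  2^-1 * (kinetic (sf (u n))
    + \int[@leb3 R]_(x in omx)
        (dot (sB (u n) x) (sB (u n) x)
         + dot (prev_half (sE \o u) Eh n x) (Eh n x))).

End Mesh.

(* Main.v *)
(* Testing the Vlasov equation with |v|^2, which is in the discrete space because
   k >= 2, gives the change of kinetic energy as 2 tau times the work of the
   electric field on the current: the x-transport and the magnetic force do no
   work, and each numerical flux occurs twice, with opposite normals and the same
   trace of |v|^2, so that the face terms cancel.  In Maxwell's equations the
   fields themselves are the test functions; integrating the curl by parts on
   each element, the chosen pairs of fluxes make the discrete curls of E and B
   adjoint to each other, so that only the same work of E on the current remains.
   For the staggered schemes the two half steps around t_n form a full step from
   n - 1/2 to n + 1/2 and the energy telescopes with the mixed product.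

   The cancellation on faces is geometric: almost every point of a facet of an
   element lies on an open facet of exactly one other element (or periodic image),
   with the opposite normal.  All integrands are bounded and measurable on
   elements and facets, being piecewise polynomial. *)

Require Import Defs.
From mathcomp Require Import all_boot all_order all_algebra.
From mathcomp Require mpoly.
Import (canonicals, coercions) mpoly.
From mathcomp Require Import all_classical all_reals all_analysis.
From mathcomp Require Import measurable_realfun.
From mathcomp Require Import ring lra.

Set Implicit Arguments.
Unset Strict Implicit.
Unset Printing Implicit Defensive.

Import Order.TTheory GRing.Theory Num.Theory.
Import numFieldNormedType.Exports.

Local Open Scope classical_set_scope.
Local Open Scope ring_scope.

(** Nothing says that elements meet facet to facet: closed elements cover the domain and open ones
    are disjoint, so hanging nodes are allowed. The matching of facets is derived from directions
    alone. Off finitely many lines in the parameter plane of a facet, every facet of another element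
    through the point is parallel to the given one; disjointness then forces the opposite normal,
    and covering of the points just beyond the facet forces a neighbour, which disjointness makes
    unique.

    The integral is a total function, linear only on integrable arguments, and discrete functions
    are polynomial on open elements but arbitrary on their boundaries. Integrands are therefore
    replaced cell by cell by polynomials, with which the traces agree on closed cells; the mesh
    skeleton is discarded as a null set, measurability there coming from membership in L^2.

    Green's formula comes from the fundamental theorem of calculus along one edge of a cell,
    Fubini's theorem and cyclic permutation of the edges. Different parametrizations of a face are
    compared by affine changes of variables, reduced to dimension one by elimination. *)

Local Notation mR2 R := (mR R * mR R)%type.
Local Notation mR3 R := (mR R * mR R * mR R)%type.
(* The sigma-algebra cannot be inferred on sets of type [set (R3 R)]. *)
Local Notation set2 R := (set (mR R * mR R)%type).
Local Notation set3 R := (set (mR R * mR R * mR R)%type).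

(** * Bounded measurable functions and their integrals *)

Section BoundedMeasurable.
Context d (T : measurableType d) (R : realType).
Implicit Types (D : set T) (f g : T -> R).

(** Integrals are linear only on integrable functions, and integrability is not stable under
    products. Bounded measurable functions are, and on sets of finite measure they are integrable,
    so cellwise integrands are kept in this class. *)
Definition bmeas D f :=
  measurable_fun D f /\ exists C, forall x, D x -> `|f x| <= C.

Lemma bmeas_cst D (c : R) : bmeas D (cst c).
Proof. by split; [exact: measurable_cst | exists `|c|]. Qed.

Lemma bmeasD D f g : bmeas D f -> bmeas D g -> bmeas D (fun x => f x + g x).
Proof.
move=> [mf [a fa]] [mg [b gb]]; split; first exact: measurable_funD.
exists (a + b) => x Dx; rewrite (le_trans (ler_normD _ _))// lerD//.
  exact: fa.
exact: gb.
Qed.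

Lemma bmeasM D f g : bmeas D f -> bmeas D g -> bmeas D (fun x => f x * g x).
Proof.
move=> [mf [a fa]] [mg [b gb]]; split; first exact: measurable_funM.
by exists (a * b) => x Dx; rewrite normrM ler_pM// ?fa ?gb.
Qed.

Lemma bmeas_norm D f : bmeas D f -> bmeas D (fun x => `|f x|).
Proof.
move=> [mf [a fa]]; split; first exact: measurableT_comp.
by exists a => x Dx; rewrite normr_id fa.
Qed.

Lemma bmeasZ D c f : bmeas D f -> bmeas D (fun x => c * f x).
Proof. exact/bmeasM/bmeas_cst. Qed.

Lemma bmeasN D f : bmeas D f -> bmeas D (fun x => - f x).
Proof.
move=> bf; have := bmeasZ (-1) bf.
by under eq_fun do rewrite mulN1r.
Qed.

Lemma bmeasB D f g : bmeas D f -> bmeas D g -> bmeas D (fun x => f x - g x).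
Proof. by move=> bf /bmeasN; exact: bmeasD. Qed.

Lemma bmeasX D f n : bmeas D f -> bmeas D (fun x => f x ^+ n).
Proof.
move=> bf; elim: n => [|n IHn]; first exact: (bmeas_cst D 1).
by under eq_fun do rewrite exprS; exact: bmeasM.
Qed.

Lemma eq_bmeas D f g : (forall x, D x -> f x = g x) -> bmeas D f -> bmeas D g.
Proof.
move=> fg [mf [a fa]]; split.
  by apply: eq_measurable_fun mf => x /set_mem; exact: fg.
by exists a => x Dx; rewrite -fg// fa.
Qed.

Lemma bmeas_sum D I (s : seq I) (P : pred I) (F : I -> T -> R) :
  (forall i, P i -> bmeas D (F i)) ->
  bmeas D (fun x => \sum_(i <- s | P i) F i x).
Proof.
move=> bF; elim: s => [|i s IHs].
  by apply: eq_bmeas (bmeas_cst D 0) => x _; rewrite big_nil.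
case: (boolP (P i)) => Pi.
  by apply: eq_bmeas (bmeasD (bF i Pi) IHs) => x _; rewrite big_cons Pi.
by apply: eq_bmeas IHs => x _; rewrite big_cons (negbTE Pi).
Qed.

Lemma bmeas_indic D (A : set T) : measurable A -> bmeas D (\1_A : T -> R).
Proof.
move=> mA; split; first exact: measurable_indic.
by exists 1 => x _; rewrite indicE ger0_norm// lern1 leq_b1.
Qed.

Lemma bmeasS D D' f : measurable D -> D' `<=` D -> bmeas D f -> bmeas D' f.
Proof.
move=> mD DD' [mf [a fa]]; split; first exact: measurable_funS mf.
by exists a => x /DD'; exact: fa.
Qed.

Lemma bmeasU D D' f : measurable D -> measurable D' ->
  bmeas D f -> bmeas D' f -> bmeas (D `|` D') f.
Proof.
move=> mD mD' [mf [a fa]] [mf' [b fb]]; split; first exact/measurable_funU.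
by exists (Num.max a b) => x [/fa|/fb] h; rewrite le_max h ?orbT.
Qed.

Lemma bmeas_bigcup (I : finType) (A : I -> set T) f :
  (forall i, measurable (A i)) -> (forall i, bmeas (A i) f) ->
  bmeas (\bigcup_i A i) f.
Proof.
move=> mA bf.
have -> : \bigcup_i A i = \big[setU/set0]_(i <- enum I) A i.
  rewrite -bigcup_seq; congr bigcup; apply/seteqP.
  by split => // i _ /=; rewrite mem_enum.
elim: (enum I) => [|i s IHs]; first rewrite big_nil.
  by split; [exact: measurable_fun_set0 | exists 0].
rewrite big_cons; apply: bmeasU => //; exact: bigsetU_measurable.
Qed.

Variable mu : {measure set T -> \bar R}.

Lemma bmeas_integrable D f : measurable D -> (mu D < +oo)%E -> bmeas D f ->
  mu.-integrable D (EFin \o f).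
Proof.
move=> mD fD [mf [a fa]]; apply: measurable_bounded_integrable => //.
exists a; split; first exact: num_real.
by move=> b ab x Dx /=; rewrite (le_trans (fa _ Dx))// ltW.
Qed.

Lemma eq_RintegralP D f g : (forall x, D x -> f x = g x) ->
  \int[mu]_(x in D) f x = \int[mu]_(x in D) g x.
Proof. by move=> fg; apply: eq_Rintegral => x /set_mem; exact: fg. Qed.

Lemma bRintegralD D f g : measurable D -> (mu D < +oo)%E ->
  bmeas D f -> bmeas D g ->
  \int[mu]_(x in D) (f x + g x) = \int[mu]_(x in D) f x + \int[mu]_(x in D) g x.
Proof. by move=> mD fD bf bg; apply: RintegralD => //; exact: bmeas_integrable. Qed.

Lemma bRintegralZ D c f : measurable D -> (mu D < +oo)%E -> bmeas D f ->
  \int[mu]_(x in D) (c * f x) = c * \int[mu]_(x in D) f x.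
Proof. by move=> mD fD bf; apply: RintegralZl => //; exact: bmeas_integrable. Qed.

Lemma bRintegralB D f g : measurable D -> (mu D < +oo)%E ->
  bmeas D f -> bmeas D g ->
  \int[mu]_(x in D) (f x - g x) = \int[mu]_(x in D) f x - \int[mu]_(x in D) g x.
Proof. by move=> mD fD bf bg; apply: RintegralB => //; exact: bmeas_integrable. Qed.

Lemma Rintegral0 D : \int[mu]_(x in D) 0 = 0 :> R.
Proof. by rewrite /Rintegral integral0. Qed.

Lemma bRintegral_sum D I (s : seq I) (P : pred I) (F : I -> T -> R) :
  measurable D -> (mu D < +oo)%E -> (forall i, P i -> bmeas D (F i)) ->
  \int[mu]_(x in D) \sum_(i <- s | P i) F i x =
  \sum_(i <- s | P i) \int[mu]_(x in D) F i x.
Proof.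
move=> mD fD bF; elim: s => [|i s IHs].
  by rewrite big_nil; under eq_Rintegral do rewrite big_nil; rewrite Rintegral0.
rewrite big_cons; under eq_Rintegral do rewrite big_cons.
case: ifPn => // Pi; rewrite bRintegralD ?IHs//; first exact: bF.
exact: bmeas_sum.
Qed.

Lemma Rintegral_ae_eq D N f g : measurable D -> measurable_fun D f ->
  measurable_fun D g -> measurable N -> mu N = 0%E ->
  (forall x, D x -> ~ N x -> f x = g x) ->
  \int[mu]_(x in D) f x = \int[mu]_(x in D) g x.
Proof.
move=> mD mf mg mN N0 fg; congr fine; apply: ae_eq_integral => //.
- exact/measurable_EFinP.
- exact/measurable_EFinP.
exists N; split => // x /=; apply: contraPP => Nx /not_implyP[Dx].
by apply; rewrite fg.
Qed.

Lemma Rintegral_null_diff D E f : measurable D -> measurable E ->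
  E `<=` D -> mu (D `\` E) = 0%E -> measurable_fun D f ->
  \int[mu]_(x in D) f x = \int[mu]_(x in E) f x.
Proof.
move=> mD mE ED N0 mf.
rewrite -[in RHS](setIidr ED) Rintegral_mkcondr.
apply: (@Rintegral_ae_eq _ (D `\` E)) => //.
- by apply/measurable_restrict => //; apply: measurable_funS mf => //; exact: subIsetl.
- exact: measurableD.
move=> x Dx nN; rewrite patchE; case: ifPn => // /negP nE.
by exfalso; apply: nN; split=> // /mem_set.
Qed.

(** The identity of indicator functions off a null set expresses covering and disjointness at once;
    multiplying it by [f] and integrating gives the claim. *)
Lemma Rintegral_split D N S (I : Type) (s : seq I) (P : pred I)
    (A : I -> set T) f :
  measurable D -> (mu D < +oo)%E -> bmeas D f -> measurable S ->
  (forall i, P i -> measurable (A i)) -> measurable N -> mu N = 0%E ->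
  (forall x, D x -> ~ N x -> (\1_S x : R) = \sum_(i <- s | P i) \1_(A i) x) ->
  \int[mu]_(x in D `&` S) f x = \sum_(i <- s | P i) \int[mu]_(x in D `&` A i) f x.
Proof.
move=> mD fD bf mS mA mN N0 SA.
have patchM (B : set T) x : (f \_ B) x = f x * \1_B x.
  by rewrite patchE indicE; case: ifPn; rewrite (mulr1, mulr0).
have bfM (B : set T) : measurable B -> bmeas D (fun x => f x * \1_B x).
  by move=> mB; apply: bmeasM => //; exact: bmeas_indic.
under eq_bigr do rewrite Rintegral_mkcondr.
rewrite Rintegral_mkcondr.
under eq_Rintegral do rewrite patchM.
under eq_bigr do under eq_Rintegral do rewrite patchM.
rewrite -bRintegral_sum//; last by move=> i Pi; exact/bfM/mA.
apply: (Rintegral_ae_eq _ _ _ mN) => //.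
- by case: (bfM _ mS).
- apply: (proj1 (@bmeas_sum _ _ s P (fun i x => f x * \1_(A i) x) _)) => i Pi.
  exact/bfM/mA.
by move=> x Dx Nx; rewrite SA// mulr_sumr.
Qed.

End BoundedMeasurable.

Lemma bmeas_comp d1 d2 (T1 : measurableType d1) (T2 : measurableType d2)
    (R : realType) (D : set T1) (E : set T2) (phi : T1 -> T2) (f : T2 -> R) :
  measurable E -> measurable_fun setT phi -> (forall x, D x -> E (phi x)) ->
  bmeas E f -> bmeas D (f \o phi).
Proof.
move=> mE mphi DE [mf [a fa]]; split.
  apply: (measurable_comp mE) => //; first by move=> _ [x Dx <-]; exact: DE.
  exact: measurable_funTS.
by exists a => x /DE; exact: fa.
Qed.

(** * Fubini's theorem for real-valued integrals *)

Section BoundedComposition.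
Context d1 d2 (T1 : measurableType d1) (T2 : measurableType d2) (R : realType).

Variables (m1 : {sigma_finite_measure set T1 -> \bar R})
  (m2 : {sigma_finite_measure set T2 -> \bar R}).

Let restrictE (D : set (T1 * T2)) (f : T1 * T2 -> R) x :
  (\int[m2]_y ((f \_ D) (x, y))%:E)%E
    = (\int[m2]_(y in xsection D x) (f (x, y))%:E)%E.
Proof.
rewrite [RHS]integral_mkcond; apply: eq_integral => y _.
by rewrite !patchE mem_xsection; case: ifPn.
Qed.

Lemma xsection_setX (D : set T1) (E : set T2) x :
  D x -> xsection (D `*` E) x = E.
Proof.
move=> Dx; apply/seteqP; split => y.
  by rewrite /xsection/= => /set_mem[].
by move=> Ey; rewrite /xsection/=; apply/mem_set.
Qed.

Lemma product_measure_lty (D : set T1) (E : set T2) :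
  measurable D -> measurable E -> (m1 D < +oo)%E -> (m2 E < +oo)%E ->
  ((m1 \x m2)%E (D `*` E) < +oo)%E.
Proof.
by move=> mD mE fD fE; rewrite /= product_measure1E// lte_mul_pinfty// ge0_fin_numE.
Qed.

(** Integrability is the right hypothesis for densities, which are in L^2 but need not be bounded on
    element boundaries. *)
Lemma measurable_Rintegral_xsection (D : set (T1 * T2)) (f : T1 * T2 -> R) :
  measurable D -> (m1 \x m2)%E.-integrable D (EFin \o f) ->
  measurable_fun setT (fun x => \int[m2]_(y in xsection D x) f (x, y)).
Proof.
move=> mD intf.
have int' : (m1 \x m2)%E.-integrable setT (EFin \o (f \_ D)).
  by move: intf; rewrite integrable_mkcond// restrict_EFin.
rewrite /Rintegral.
apply: (measurableT_comp (f := fine)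
  (g := fun x => (\int[m2]_(y in xsection D x) (f (x, y))%:E)%E)) => //.
have := measurable_fubini_F int'; rewrite /fubini_F/=.
by under eq_fun do rewrite restrictE.
Qed.

Lemma Rintegral_fubini (D : set (T1 * T2)) (f : T1 * T2 -> R) :
  measurable D -> ((m1 \x m2)%E D < +oo)%E -> bmeas D f ->
  \int[(m1 \x m2)%E]_(z in D) f z =
  \int[m1]_x \int[m2]_(y in xsection D x) f (x, y).
Proof.
move=> mD fD bf.
have intf : (m1 \x m2)%E.-integrable D (EFin \o f) by exact: bmeas_integrable.
have int' : (m1 \x m2)%E.-integrable setT (EFin \o (f \_ D)).
  by move: intf; rewrite integrable_mkcond// restrict_EFin.
rewrite Rintegral_mkcond /Rintegral -integral12_prod_meas1//.
congr fine.
have int1 := integrable_fubini_F int'.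
rewrite /fubini_F/= in int1 *.
under eq_integral do rewrite restrictE.
have int2 : m1.-integrable setT (fun x => (\int[m2]_(y in xsection D x) (f (x, y))%:E)%E).
  by move: int1; under eq_fun do rewrite restrictE.
(* The inner integral is finite for almost every [x] only; elsewhere [fine] may change it. *)
have [N [mN N0 HN]] := integrable_ae measurableT int2.
apply: ae_eq_integral => //.
- exact: measurable_int int2.
- apply/measurable_EFinP; apply: measurableT_comp => //.
  exact: measurable_int int2.
exists N; split => // x /= nx; apply: HN => /= fx; apply: nx => _.
by rewrite fineK// fx.
Qed.

Lemma bmeas_Rintegral (D : set T1) (E : set T2) (f : T1 -> T2 -> R) :
  measurable D -> measurable E -> (m1 D < +oo)%E -> (m2 E < +oo)%E ->
  bmeas (D `*` E) (fun z => f z.1 z.2) ->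
  bmeas D (fun x => \int[m2]_(y in E) f x y).
Proof.
move=> mD mE fD fE bf.
have mDE : measurable (D `*` E) by exact: measurableX.
split.
  have := @measurable_Rintegral_xsection (D `*` E) (fun z => f z.1 z.2) mDE.
  move=> /(_ _)/measurable_funTS H.
  apply: eq_measurable_fun (H _ _) => [x /set_mem Dx|] /=.
    by rewrite xsection_setX.
  apply: bmeas_integrable => //.
  exact: product_measure_lty.
have [mf [C fC]] := bf.
exists (`|C| * fine (m2 E)) => x Dx.
have bx : bmeas E (f x).
  apply: (@bmeas_comp _ _ _ _ _ E (D `*` E) (pair x) (fun z => f z.1 z.2)) => //.
apply: le_trans (le_normr_Rintegral _ _) _ => //.
  exact: bmeas_integrable.
rewrite -Rintegral_cst//; apply: le_Rintegral => //.
- by apply: bmeas_integrable => //; exact: bmeas_norm.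
- by apply: bmeas_integrable => //; exact: bmeas_cst.
by move=> y Ey; rewrite (le_trans (fC (x, y) _))// ler_norm.
Qed.

End BoundedComposition.

(** * Affine changes of variables *)

Section ScalesMeasure.
Context d (T : measurableType d) (R : realType).
Variable mu : {measure set T -> \bar R}.

(** For an invertible affine map [c] is the inverse of the absolute Jacobian. Preimages are
    measured, so the property says that the pushforward of [mu] is [c] times [mu], and it composes
    without inverting [S]. *)
Definition scales_measure (c : R) (S : T -> T) :=
  measurable_fun setT S /\
  forall A, measurable A -> mu (S @^-1` A) = (c%:E * mu A)%E.

Lemma scales_measure_comp a b S U : scales_measure a S -> scales_measure b U ->
  scales_measure (a * b) (U \o S).
Proof.
move=> [mS aS] [mU bU]; split; first exact: measurableT_comp.
move=> A mA; rewrite comp_preimage aS ?bU ?muleA ?EFinM//.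
by rewrite -[_ @^-1` _]setTI; exact: mU.
Qed.

Lemma eq_scales_measure a b S U : a = b -> S =1 U ->
  scales_measure a S -> scales_measure b U.
Proof. by move=> -> /funext ->. Qed.

(** The formula for pushforwards is proved for nonnegative functions and then applied to the
    positive and the negative part of [f]. *)
Lemma scales_measure_Rintegral (c : R) S (D : set T) (f : T -> R) : 0 <= c ->
  scales_measure c S -> measurable D -> (mu D < +oo)%E -> bmeas D f ->
  \int[mu]_(x in S @^-1` D) f (S x) = c * \int[mu]_(x in D) f x.
Proof.
move=> c0 [mS cS] mD fD bf.
have intf := bmeas_integrable mD fD bf.
have eqm A : measurable A -> A `<=` D -> pushforward mu S A = mscale (NngNum c0) mu A.
  by move=> mA _; rewrite /pushforward cS.
have ge0 (g : T -> \bar R) : measurable_fun D g -> (forall x, 0 <= g x)%E ->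
    (\int[mu]_(x in S @^-1` D) (g \o S) x = c%:E * \int[mu]_(x in D) g x)%E.
  move=> mg g0; rewrite -ge0_integral_pushforward//.
  rewrite (eq_measure_integral (mscale (NngNum c0) mu) eqm)//.
  by rewrite (ge0_integral_mscale mu mD (NngNum c0) mg).
rewrite /Rintegral -[c]/(fine c%:E) -fineM//; last first.
  exact: integrable_fin_num.
congr fine; rewrite integralE [in RHS]integralE.
have -> : (fun x => (f (S x))%:E) = (fun x => (f x)%:E) \o S by [].
rewrite funepos_comp funeneg_comp !ge0//.
- by rewrite -muleBr//; exact: (integrable_add_def mD intf).
- by apply: measurable_funeneg; exact: measurable_int intf.
- by apply: measurable_funepos; exact: measurable_int intf.
Qed.

End ScalesMeasure.

Section ScalesProduct.
Context d1 d2 (T1 : measurableType d1) (T2 : measurableType d2) (R : realType).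
Variables (m1 : {sigma_finite_measure set T1 -> \bar R})
  (m2 : {sigma_finite_measure set T2 -> \bar R}).

(** Cavalieri's principle: every fibre over the first factor is scaled by the same [c], hence so is
    the integral of the fibre measures. *)
Lemma scales_measure_fiber2 (c : R) (S : T1 -> T2 -> T2) : 0 <= c ->
  measurable_fun setT (fun z : T1 * T2 => S z.1 z.2) ->
  (forall x, scales_measure m2 c (S x)) ->
  scales_measure (m1 \x m2)%E c (fun z => (z.1, S z.1 z.2)).
Proof.
move=> c0 mS cS; split; first by apply: measurable_fun_pair => //; exact: measurable_fst.
move=> A mA; rewrite /= /product_measure1.
rewrite -ge0_integralZl//=; last exact: measurable_fun_xsection.
apply: eq_integral => x _; rewrite -(proj2 (cS x)); last exact: measurable_xsection.
congr (m2 _); apply/seteqP; split => y; rewrite /xsection/= !inE//=.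
Qed.

Lemma scales_measure_fiber1 (c : R) (S : T2 -> T1 -> T1) : 0 <= c ->
  measurable_fun setT (fun z : T1 * T2 => S z.2 z.1) ->
  (forall y, scales_measure m1 c (S y)) ->
  scales_measure (m1 \x m2)%E c (fun z => (S z.2 z.1, z.2)).
Proof.
move=> c0 mS cS.
have mSS : measurable_fun setT (fun z : T1 * T2 => (S z.2 z.1, z.2)).
  by apply: measurable_fun_pair => //; exact: measurable_snd.
split => // A mA.
(* The two iterated definitions of the product measure agree by uniqueness on rectangles; the one
   over fibres of the second factor is needed here. *)
have prodE B : measurable B -> ((m1 \x m2) B = (m1 \x^ m2) B)%E.
  by apply: product_measure_unique => X Y mX mY; rewrite /= product_measure2E.
rewrite /= !prodE//; last by rewrite -[_ @^-1` _]setTI; exact: mSS.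
rewrite /product_measure2.
rewrite -ge0_integralZl//=; last exact: measurable_fun_ysection.
apply: eq_integral => x _; rewrite -(proj2 (cS x)); last exact: measurable_ysection.
congr (m1 _); apply/seteqP; split => y; rewrite /ysection/= !inE//=.
Qed.

End ScalesProduct.

Section AffineMaps.
Variable R : realType.

(** The pushforward rescaled by [|a|] gives each half-open interval its length, which characterizes
    Lebesgue measure. For [a < 0] the preimage is half-open on the other side, with the same
    length. *)
Lemma scales_measure_affine1 (a b : R) : a != 0 ->
  scales_measure (leb1 R) `|a|^-1 (fun x : mR R => a * x + b : mR R).
Proof.
move=> a0.
have mS : measurable_fun setT (fun x : mR R => a * x + b : mR R).
  by apply: measurable_funD => //; exact: mulrl_measurable.
have na0 : `|a| != 0 by rewrite normr_eq0.
split => // A mA.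
pose S := (fun x : mR R => a * x + b : mR R).
pose nu := measure_function_pushforward__canonical__measure_function_Measure
  (leb1 R) (mS : measurable_fun setT S).
suff E : lebesgue_measure A = mscale (NngNum (normr_ge0 a)) nu A.
  transitivity (`|a|^-1%:E * lebesgue_measure A)%E => //.
  by rewrite E /mscale/= muleA -EFinM mulVf// mul1e.
apply: (@lebesgue_measure_unique R (mscale (NngNum (normr_ge0 a)) nu)) => // _ [[l u] _ <-] /=.
rewrite /mscale/= /pushforward /leb1 /=.
case/orP: (lt_total a0) => [an|ap].
  have -> : S @^-1` `]l, u]%classic = `[(u - b) / a, (l - b) / a[%classic.
    apply/seteqP; split => x /=; rewrite !in_itv/= /S.
      by move=> /andP[lx xu]; rewrite ler_ndivrMr// ltr_ndivlMr//; apply/andP; lra.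
    by rewrite ler_ndivrMr// ltr_ndivlMr// => /andP[lx xu]; apply/andP; lra.
  rewrite !lebesgue_measure_itv/= !lte_fin ltr_nM2r ?invr_lt0// ltrD2r.
  case: ifPn => // _; last by rewrite mule0.
  rewrite -!EFinB -EFinM ltr0_norm//; congr EFin; field; lra.
have -> : S @^-1` `]l, u]%classic = `](l - b) / a, (u - b) / a]%classic.
  apply/seteqP; split => x /=; rewrite !in_itv/= /S.
    by move=> /andP[lx xu]; rewrite ler_pdivlMr// ltr_pdivrMr//; apply/andP; lra.
  by rewrite ler_pdivlMr// ltr_pdivrMr// => /andP[lx xu]; apply/andP; lra.
rewrite !lebesgue_measure_itv/= !lte_fin ltr_pM2r ?invr_gt0// ltrD2r.
case: ifPn => // _; last by rewrite mule0.
rewrite -!EFinB -EFinM gtr0_norm//; congr EFin; field; lra.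
Qed.

Let mfst : measurable_fun setT (fun z : mR2 R => z.1 : mR R).
Proof. exact: measurable_fst. Qed.
Let msnd : measurable_fun setT (fun z : mR2 R => z.2 : mR R).
Proof. exact: measurable_snd. Qed.

Let mlin2 (a b c : R) :
  measurable_fun setT (fun z : mR2 R => a * z.1 + b * z.2 + c : mR R).
Proof.
by apply: measurable_funD => //; apply: measurable_funD; apply: measurable_funM.
Qed.

Lemma scales_measure_shear2y (c d f : R) : d != 0 ->
  scales_measure (@leb2 R) `|d|^-1
    (fun z : mR2 R => (z.1, c * z.1 + d * z.2 + f) : mR2 R).
Proof.
move=> d0; apply: (scales_measure_fiber2 (leb1 R) (m2 := leb1 R)
  (S := fun x y => c * x + d * y + f : mR R)) => // x.
by apply: eq_scales_measure (scales_measure_affine1 (c * x + f) d0) => // y; ring.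
Qed.

Lemma scales_measure_shear2x (a b e : R) : a != 0 ->
  scales_measure (@leb2 R) `|a|^-1
    (fun z : mR2 R => (a * z.1 + b * z.2 + e, z.2) : mR2 R).
Proof.
move=> a0; apply: (scales_measure_fiber1 (leb1 R) (m1 := leb1 R)
  (S := fun y x => a * x + b * y + e : mR R)) => // y.
by apply: eq_scales_measure (scales_measure_affine1 (b * y + e) a0) => // x; ring.
Qed.

(** A shear in the second coordinate followed by one in the first, with pivot [d], reduces the claim
    to dimension one on fibres. *)
Lemma scales_measure_affine2 (a b e c d f : R) : a * d - b * c != 0 ->
  scales_measure (@leb2 R) `|a * d - b * c|^-1
    (fun z : mR2 R =>
       (a * z.1 + b * z.2 + e, c * z.1 + d * z.2 + f) : mR2 R).
Proof.
have pivot a' b' e' c' d' f' : a' * d' - b' * c' != 0 -> d' != 0 ->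
    scales_measure (@leb2 R) `|a' * d' - b' * c'|^-1
    (fun z : mR2 R =>
       (a' * z.1 + b' * z.2 + e', c' * z.1 + d' * z.2 + f') : mR2 R).
  move=> D0 d0; have h : a' - b' * c' / d' != 0.
    by apply: contra_neq D0 => h; rewrite -[LHS](mulfK d0) -(mul0r d') -h; field.
  apply: eq_scales_measure (scales_measure_comp (scales_measure_shear2y c' f' d0)
    (scales_measure_shear2x (b' / d') (e' - b' * f' / d') h)) => [|z /=].
    by rewrite -invfM -normrM; congr (`|_|^-1); field.
  by congr pair; field.
have [->|d0] := eqVneq d 0; last by move=> D0; exact: pivot.
move=> D0; have b0 : b != 0.
  by apply: contra_neq D0 => ->; ring.
(* For [d = 0], adding the first row to the second makes the pivot [b]; the shear by [- 1] applied
   afterwards subtracts it again. *)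
have D0' : a * (0 + b) - b * (c + a) != 0.
  by rewrite (_ : _ - _ = a * 0 - b * c)//; ring.
have b0' : 0 + b != 0 by rewrite add0r.
have n10 : (1 : R) != 0 by exact: oner_neq0.
apply: eq_scales_measure (scales_measure_comp (pivot a b e _ _ (f + e) D0' b0')
  (scales_measure_shear2y (- 1) 0 n10)) => [|z /=].
  by rewrite normr1 invr1 mulr1; congr (`|_|^-1); ring.
by congr pair; ring.
Qed.

Let m3 (g1 g2 g3 e : R) : measurable_fun setT
  (fun z : mR3 R => g1 * z.1.1 + g2 * z.1.2 + g3 * z.2 + e : mR R).
Proof.
have m1 : measurable_fun setT (fun z : mR3 R => z.1).
  exact: measurable_fst.
have m2 : measurable_fun setT (fun z : mR3 R => z.2 : mR R).
  exact: measurable_snd.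
apply: measurable_funD => //; apply: measurable_funD => //.
  apply: measurable_funD => //; apply: measurable_funM => //.
    exact: (measurableT_comp mfst m1).
  exact: (measurableT_comp msnd m1).
exact: measurable_funM.
Qed.

Lemma scales_measure_shear3 (g1 g2 g3 e : R) : g3 != 0 ->
  scales_measure (@leb3 R) `|g3|^-1 (fun z : mR3 R =>
    (z.1, g1 * z.1.1 + g2 * z.1.2 + g3 * z.2 + e) : mR3 R).
Proof.
move=> g0; apply: (scales_measure_fiber2 (@leb2 R) (m2 := leb1 R)
  (S := fun (p : mR2 R) y => g1 * p.1 + g2 * p.2 + g3 * y + e : mR R)) => // -[x y].
by apply: eq_scales_measure
  (scales_measure_affine1 (g1 * x + g2 * y + e) g0) => // w /=; ring.
Qed.

(** Elimination with the lower right entry as pivot: a shear in the third coordinate, then, at fixed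
    third coordinate, the planar affine map whose matrix [u1, u2, v1, v2] is the Schur complement. A
    zero pivot is repaired by adding the first or the second row to the third. *)
Lemma scales_measure_affine3 (a1 a2 a3 b1 b2 b3 g1 g2 g3 e1 e2 e3 D : R) :
  D = a1 * (b2 * g3 - b3 * g2) - a2 * (b1 * g3 - b3 * g1)
      + a3 * (b1 * g2 - b2 * g1) ->
  D != 0 ->
  scales_measure (@leb3 R) `|D|^-1 (fun z : mR3 R =>
    (a1 * z.1.1 + a2 * z.1.2 + a3 * z.2 + e1,
     b1 * z.1.1 + b2 * z.1.2 + b3 * z.2 + e2,
     g1 * z.1.1 + g2 * z.1.2 + g3 * z.2 + e3) : mR3 R).
Proof.
have pivot (r1 r2 r3 s1 s2 s3 t1 t2 t3 f1 f2 f3 E : R) :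
    E = r1 * (s2 * t3 - s3 * t2) - r2 * (s1 * t3 - s3 * t1)
      + r3 * (s1 * t2 - s2 * t1) ->
    E != 0 -> t3 != 0 ->
    scales_measure (@leb3 R) `|E|^-1 (fun z : mR3 R =>
      (r1 * z.1.1 + r2 * z.1.2 + r3 * z.2 + f1,
       s1 * z.1.1 + s2 * z.1.2 + s3 * z.2 + f2,
       t1 * z.1.1 + t2 * z.1.2 + t3 * z.2 + f3) : mR3 R).
  move=> EE E0 t0.
  pose u1 := r1 - r3 * t1 / t3; pose u2 := r2 - r3 * t2 / t3.
  pose v1 := s1 - s3 * t1 / t3; pose v2 := s2 - s3 * t2 / t3.
  have EK : E = t3 * (u1 * v2 - u2 * v1).
    by rewrite EE /u1 /u2 /v1 /v2; field.
  have uv0 : u1 * v2 - u2 * v1 != 0.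
    by apply: contra_neq E0 => h; rewrite EK h mulr0.
  have H : scales_measure (@leb3 R) `|u1 * v2 - u2 * v1|^-1
     (fun z : mR3 R =>
       ((u1 * z.1.1 + u2 * z.1.2 + (r3 / t3 * z.2 + (f1 - r3 * f3 / t3)),
        v1 * z.1.1 + v2 * z.1.2 + (s3 / t3 * z.2 + (f2 - s3 * f3 / t3))), z.2)
          : mR3 R).
    apply: (scales_measure_fiber1 (leb1 R) (m1 := @leb2 R)
      (S := fun (w : mR R) (p : mR2 R) =>
       (u1 * p.1 + u2 * p.2 + (r3 / t3 * w + (f1 - r3 * f3 / t3)),
        v1 * p.1 + v2 * p.2 + (s3 / t3 * w + (f2 - s3 * f3 / t3)))
          : mR2 R)) => //.
      apply: measurable_fun_pair.
        under eq_fun do rewrite addrA; exact: m3.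
      under eq_fun do rewrite addrA; exact: m3.
    by move=> w; exact: scales_measure_affine2.
  apply: eq_scales_measure (scales_measure_comp
    (scales_measure_shear3 t1 t2 f3 t0) H) => [|z /=].
    by rewrite -invfM -normrM EK.
  by congr (pair (pair _ _) _); rewrite /u1 /u2 /v1 /v2; field.
move=> DE D0.
have [g30|g0] := eqVneq g3 0; last exact: pivot DE D0 g0.
have n10 : (1 : R) != 0 by exact: oner_neq0.
have [a30|a0] := eqVneq a3 0.
  have b0 : b3 != 0.
    by apply: contra_neq D0 => b30; rewrite DE g30 a30 b30; ring.
  have b0' : g3 + b3 != 0 by rewrite g30 add0r.
  apply: eq_scales_measure (scales_measure_comp
    (pivot a1 a2 a3 b1 b2 b3 (g1 + b1) (g2 + b2) (g3 + b3) e1 e2 (e3 + e2) D _ D0 b0')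
    (scales_measure_shear3 0 (- 1) 0 n10)) => [|z /=|].
  - by rewrite normr1 invr1 mulr1.
  - by congr pair; ring.
  - by rewrite DE; ring.
have a0' : g3 + a3 != 0 by rewrite g30 add0r.
apply: eq_scales_measure (scales_measure_comp
  (pivot a1 a2 a3 b1 b2 b3 (g1 + a1) (g2 + a2) (g3 + a3) e1 e2 (e3 + e1) D _ D0 a0')
  (scales_measure_shear3 (- 1) 0 0 n10)) => [|z /=|].
- by rewrite normr1 invr1 mulr1.
- by congr pair; ring.
- by rewrite DE; ring.
Qed.

End AffineMaps.

(** * Polynomials as functions: bounds, derivatives, integrals along segments *)

(** The induction through which boundedness, continuity and differentiability pass to all
    polynomials: each is stable under the ring operations and holds for constants and
    coordinates. *)
Lemma meval_closed (R : realType) n X (coord : X -> 'I_n -> R)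
    (P : (X -> R) -> Prop) :
  (forall c, P (fun=> c)) -> (forall i, P (coord^~ i)) ->
  (forall f g, P f -> P g -> P (fun x => f x + g x)) ->
  (forall f g, P f -> P g -> P (fun x => f x * g x)) ->
  forall p : mpoly.mpoly n R, P (fun x => mpoly.meval (coord x) p).
Proof.
move=> Pcst Pcoord PD PM p.
have -> : (fun x => mpoly.meval (coord x) p) = fun x =>
    \sum_(m <- mpoly.msupp p) mpoly.mcoeff m p * \prod_i coord x i ^+ m i.
  by apply/funext => x; rewrite mpoly.mevalE.
elim: (mpoly.msupp p) => [|m s IHs].
  by rewrite (_ : (fun _ => _) = fun=> 0)//; apply/funext => x; rewrite big_nil.
rewrite (_ : (fun _ => _) = fun x => mpoly.mcoeff m p * \prod_i coord x i ^+ m i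
  + \sum_(m <- s) mpoly.mcoeff m p * \prod_i coord x i ^+ m i); last first.
  by apply/funext => x; rewrite big_cons.
apply: (PD) => //; apply: (PM) => //.
elim: (index_enum 'I_n) => [|i t IHt].
  by rewrite (_ : (fun _ => _) = fun=> 1)//; apply/funext => x; rewrite big_nil.
rewrite (_ : (fun _ => _) = fun x => coord x i ^+ m i *
  \prod_(i <- t) coord x i ^+ m i); last by apply/funext => x; rewrite big_cons.
apply: (PM) => //; elim: (m i) => [|j IHj].
  by rewrite (_ : (fun _ => _) = fun=> 1).
rewrite (_ : (fun _ => _) = fun x => coord x i * coord x i ^+ j); first exact: PM.
by apply/funext => x; rewrite exprS.
Qed.

Lemma bmeas_meval d (T : measurableType d) (R : realType) n (D : set T)
    (coord : T -> 'I_n -> R) (p : mpoly.mpoly n R) :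
  (forall i, bmeas D (coord^~ i)) ->
  bmeas D (fun x => mpoly.meval (coord x) p).
Proof.
move=> bcoord; apply: (@meval_closed R n T coord (bmeas D)) => //.
- by move=> c; exact: bmeas_cst.
- by move=> f g; exact: bmeasD.
- by move=> f g; exact: bmeasM.
Qed.

Section PolynomialFunctions.
Variable R : realType.
Implicit Types (p q : mpoly.mpoly 3 R) (x v : R3 R).

Definition peval p x : R := mpoly.meval (coord3 x) p.

Lemma ord3_case (P : 'I_3 -> Prop) :
  P (inord 0) -> P (inord 1) -> P (inord 2) -> forall i, P i.
Proof.
move=> P0 P1 P2 [[|[|[|//]]] i].
- by have -> : Ordinal i = inord 0 by apply: val_inj; rewrite /= inordK.
- by have -> : Ordinal i = inord 1 by apply: val_inj; rewrite /= inordK.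
- by have -> : Ordinal i = inord 2 by apply: val_inj; rewrite /= inordK.
Qed.

Lemma coord3_fun (i : 'I_3) :
  [\/ (fun x => coord3 x i) = c1 :> (R3 R -> R), (fun x => coord3 x i) = c2 :> (R3 R -> R)
    | (fun x => coord3 x i) = c3 :> (R3 R -> R)].
Proof.
elim/ord3_case: i; rewrite /coord3 !inordK//=.
- exact: Or31.
- exact: Or32.
- exact: Or33.
Qed.

Lemma continuous_c1 : continuous (@c1 R).
Proof. by move=> x; apply: cvg_comp; [exact: cvg_fst | exact: cvg_fst]. Qed.
Lemma continuous_c2 : continuous (@c2 R).
Proof. by move=> x; apply: cvg_comp; [exact: cvg_fst | exact: cvg_snd]. Qed.
Lemma continuous_c3 : continuous (@c3 R).
Proof. by move=> x; exact: cvg_snd. Qed.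

Lemma continuous_peval p : continuous (peval p).
Proof.
apply: (@meval_closed R 3 (R3 R) (@coord3 R) (fun u : R3 R -> R => continuous u)).
- by move=> c; exact: cst_continuous.
- move=> i; have [->|->|->] := coord3_fun i.
  + exact: continuous_c1.
  + exact: continuous_c2.
  + exact: continuous_c3.
- by move=> f g cf cg x; apply: (cvgD (cf x) (cg x)).
- by move=> f g cf cg x; apply: (cvgM (cf x) (cg x)).
Qed.

Lemma is_derive_linear (l : R3 R -> R) x v :
  (forall (h : R) y z, l (h *: y + z) = h * l y + l z) -> is_derive x v l (l v).
Proof.
move=> linl; have H : (fun h : R => h^-1 *: ((l \o shift x) (h *: v) - l x)) @ 0^' --> l v.
  have H0 : (fun=> l v) @ (0 : R)^' --> l v by exact: cvg_cst.
  apply: cvg_trans H0; apply: near_eq_cvg.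
  near=> h; rewrite /= linl addrK /GRing.scale/= mulKf//.
  by near: h; exact: nbhs_dnbhs_neq.
split; first exact: cvgP H.
exact: cvg_lim H.
Unshelve. all: by end_near.
Qed.

Lemma is_derive_c1 x v : is_derive x v (@c1 R) (c1 v).
Proof. exact: is_derive_linear. Qed.
Lemma is_derive_c2 x v : is_derive x v (@c2 R) (c2 v).
Proof. exact: is_derive_linear. Qed.
Lemma is_derive_c3 x v : is_derive x v (@c3 R) (c3 v).
Proof. exact: is_derive_linear. Qed.

(** It only matters that the partial derivatives are polynomials, so they are not computed. The
    induction also carries that the function is itself a polynomial, since the product rule involves
    the factors. *)
Lemma is_derive_peval p : exists q1 q2 q3, forall x v,
  is_derive x v (peval p)
    (c1 v * peval q1 x + c2 v * peval q2 x + c3 v * peval q3 x).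
Proof.
pose P (u : R3 R -> R) := (exists p, u = peval p) /\
  exists q1 q2 q3, forall x v, is_derive x v u
    (c1 v * peval q1 x + c2 v * peval q2 x + c3 v * peval q3 x).
suff [] : P (peval p) by [].
have pevalE c : peval (mpoly.mpolyC 3 c) = fun=> c.
  by apply/funext => x; rewrite /peval mpoly.mevalC.
apply: (@meval_closed R 3 (R3 R) (@coord3 R) P).
- move=> c; split; first by exists (mpoly.mpolyC 3 c); rewrite pevalE.
  exists (mpoly.mpolyC 3 0), (mpoly.mpolyC 3 0), (mpoly.mpolyC 3 0) => x v.
  by rewrite pevalE !mulr0 !addr0; exact: is_derive_cst.
- move=> i; split.
    exists (mpoly.mpolyX R (mpoly.mnm1 i)); apply/funext => x.
    by rewrite /peval mpoly.mevalXU.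
  have [E|E|E] := coord3_fun i; rewrite E.
  + exists (mpoly.mpolyC 3 1), (mpoly.mpolyC 3 0), (mpoly.mpolyC 3 0) => x v.
    by rewrite !pevalE mulr1 !mulr0 !addr0; exact: is_derive_c1.
  + exists (mpoly.mpolyC 3 0), (mpoly.mpolyC 3 1), (mpoly.mpolyC 3 0) => x v.
    by rewrite !pevalE mulr1 !mulr0 !addr0 add0r; exact: is_derive_c2.
  + exists (mpoly.mpolyC 3 0), (mpoly.mpolyC 3 0), (mpoly.mpolyC 3 1) => x v.
    by rewrite !pevalE mulr1 !mulr0 !add0r; exact: is_derive_c3.
- move=> f g [[pf ->] [f1 [f2 [f3 Hf]]]] [[pg ->] [g1 [g2 [g3 Hg]]]]; split.
    by exists (pf + pg); apply/funext => x; rewrite /peval mpoly.mevalD.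
  exists (f1 + g1), (f2 + g2), (f3 + g3) => x v.
  apply: (is_derive_eq (is_deriveD (Hf x v) (Hg x v))).
  by rewrite /peval !mpoly.mevalD; ring.
move=> f g [[pf ->] [f1 [f2 [f3 Hf]]]] [[pg ->] [g1 [g2 [g3 Hg]]]]; split.
  by exists (pf * pg); apply/funext => x; rewrite /peval mpoly.mevalM.
exists (pf * g1 + pg * f1), (pf * g2 + pg * f2), (pf * g3 + pg * f3) => x v.
apply: (is_derive_eq (is_deriveM (Hf x v) (Hg x v))).
by rewrite /peval !mpoly.mevalD !mpoly.mevalM /GRing.scale/=; ring.
Qed.

Lemma continuous_segment (x v : R3 R) : continuous (fun s : R => x + s *: v).
Proof.
move=> s; apply: (@cvgD _ _ _ _ _ (fun=> x) (fun s : R => s *: v)).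
  exact: cvg_cst.
by apply: cvgZr_tmp; exact: cvg_id.
Qed.

(* The difference quotient of [s |-> u (x + s v)] at [s] is the one defining
   ['D_v u (x + s v)]. *)
Lemma is_derive_segment (u : R3 R -> R) x v (s : R) df :
  is_derive (x + s *: v) v u df -> is_derive s 1 (fun s => u (x + s *: v)) df.
Proof.
move=> [du Du].
have E : (fun h : R => h^-1 *:
      (((fun s => u (x + s *: v)) \o shift s) (h *: (1 : R)) - u (x + s *: v)))
   = (fun h => h^-1 *: ((u \o shift (x + s *: v)) (h *: v) - u (x + s *: v))).
  apply/funext => h /=; congr (_ *: (u _ - _)).
  by rewrite [h *: (1 : R)]mulr1 scalerDl addrCA.
split; first by rewrite /derivable E.
by rewrite /derive E.
Qed.

Lemma FTC_segment p (q : R3 R -> R) x v (a b : R) : a < b ->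
  continuous q -> (forall y, is_derive y v (peval p) (q y)) ->
  \int[leb1 R]_(s in `]a, b[) q (x + s *: v)
    = peval p (x + b *: v) - peval p (x + a *: v).
Proof.
move=> ab cq Hq; pose F s := peval p (x + s *: v); pose f s := q (x + s *: v).
have cont (g : R3 R -> R) : continuous g -> continuous (fun s : R => g (x + s *: v)).
  by move=> cg s; apply: continuous_comp; [exact: continuous_segment|exact: cg].
have contF := cont _ (@continuous_peval p); have contf := cont _ cq.
have dF (s : R) : is_derive s (1 : R) F (f s) by apply: is_derive_segment.
have cf : {within `[a, b], continuous f}.
  exact: continuous_subspaceT.
have mf : measurable_fun `]a, b[ f.
  by apply: measurable_funTS; apply: continuous_measurable_fun.
have dLR : derivable_oo_LRcontinuous F a b.
  split; first by move=> s _; case: (dF s).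
  - exact/cvg_at_right_filter/contF.
  - exact/cvg_at_left_filter/contF.
have F'f : {in `]a, b[, derive1 F =1 f}.
  by move=> s _; rewrite derive1E; exact: derive_val.
have /(congr1 fine)/= := continuous_FTC2 ab cf dLR F'f.
rewrite integral_itv_bndoo//; exact/measurable_EFinP.
Qed.

End PolynomialFunctions.

(** * Vector algebra in three dimensions *)

Section VectorAlgebra.
Variable R : realType.
Implicit Types (x y z : R3 R) (k : R).

Lemma c1D x y : c1 (x + y) = c1 x + c1 y. Proof. by []. Qed.
Lemma c2D x y : c2 (x + y) = c2 x + c2 y. Proof. by []. Qed.
Lemma c3D x y : c3 (x + y) = c3 x + c3 y. Proof. by []. Qed.
Lemma c1N x : c1 (- x) = - c1 x. Proof. by []. Qed.
Lemma c2N x : c2 (- x) = - c2 x. Proof. by []. Qed.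
Lemma c3N x : c3 (- x) = - c3 x. Proof. by []. Qed.
Lemma c1Z k x : c1 (k *: x) = k * c1 x. Proof. by []. Qed.
Lemma c2Z k x : c2 (k *: x) = k * c2 x. Proof. by []. Qed.
Lemma c3Z k x : c3 (k *: x) = k * c3 x. Proof. by []. Qed.
Lemma c1P (a b c : R) : c1 (a, b, c) = a. Proof. by []. Qed.
Lemma c2P (a b c : R) : c2 (a, b, c) = b. Proof. by []. Qed.
Lemma c3P (a b c : R) : c3 (a, b, c) = c. Proof. by []. Qed.

Lemma c10 : c1 (0 : R3 R) = 0. Proof. by []. Qed.
Lemma c20 : c2 (0 : R3 R) = 0. Proof. by []. Qed.
Lemma c30 : c3 (0 : R3 R) = 0. Proof. by []. Qed.

Definition coordE := (c10, c20, c30,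
  c1D, c2D, c3D, c1N, c2N, c3N, c1Z, c2Z, c3Z, c1P, c2P, c3P).

Lemma R3P x y : c1 x = c1 y -> c2 x = c2 y -> c3 x = c3 y -> x = y.
Proof. by case: x y => [[? ?] ?] [[? ?] ?]; rewrite !coordE => -> -> ->. Qed.

Lemma dotC x y : dot x y = dot y x. Proof. by rewrite /dot; ring. Qed.
Lemma dotDr x y z : dot x (y + z) = dot x y + dot x z.
Proof. by rewrite /dot !coordE; ring. Qed.
Lemma dotNr x y : dot x (- y) = - dot x y.
Proof. by rewrite /dot !coordE; ring. Qed.
Lemma dotBr x y z : dot x (y - z) = dot x y - dot x z.
Proof. by rewrite dotDr dotNr. Qed.
Lemma dotZr k x y : dot x (k *: y) = k * dot x y.
Proof. by rewrite /dot !coordE; ring. Qed.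
Lemma dotDl x y z : dot (y + z) x = dot y x + dot z x.
Proof. by rewrite /dot !coordE; ring. Qed.
Lemma dotNl x y : dot (- y) x = - dot y x.
Proof. by rewrite /dot !coordE; ring. Qed.
Lemma dotZl k x y : dot (k *: y) x = k * dot y x.
Proof. by rewrite /dot !coordE; ring. Qed.

Lemma dot_ge0 x : 0 <= dot x x.
Proof. by rewrite /dot; nra. Qed.

Lemma dot_eq0 x : dot x x = 0 -> x = 0.
Proof.
move=> xx0; apply: R3P; rewrite ?coordE; move: xx0.
- by rewrite /dot => h; apply/eqP; rewrite -sqrf_eq0; apply/eqP; nra.
- by rewrite /dot => h; apply/eqP; rewrite -sqrf_eq0; apply/eqP; nra.
- by rewrite /dot => h; apply/eqP; rewrite -sqrf_eq0; apply/eqP; nra.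
Qed.

Lemma enorm_sqr x : enorm x ^+ 2 = dot x x.
Proof. by rewrite /enorm sqr_sqrtr// dot_ge0. Qed.

Lemma enorm_gt0 x : x != 0 -> 0 < enorm x.
Proof.
move=> x0; rewrite /enorm sqrtr_gt0 lt0r dot_ge0 andbT.
by apply: contra_neq x0; exact: dot_eq0.
Qed.

End VectorAlgebra.

(** * Cells in reference coordinates and the planes of their facets *)

Section CellGeometry.
Variable R : realType.
Implicit Types (K : cell R) (F G : facet R) (x y : R3 R).

Definition cell_det K := dot (cross (edge1 K) (edge2 K)) (edge3 K).

(** In the Cartesian case the Gram identity [gram] shows that the squared determinant of orthogonal
    edges is the product of their squared lengths. *)
Lemma cell_det_neq0 K : valid_cell K -> cell_det K != 0.
Proof.
rewrite /valid_cell /cell_det; case: (cshape K) => // -[[a0 b0 c0] [ab bc ca]].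
move: a0 b0 c0 ab bc ca; set a := edge1 K; set b := edge2 K; set c := edge3 K.
move=> a0 b0 c0 ab bc ca; apply/eqP => D0.
have gram : dot (cross a b) c ^+ 2 = dot a a * (dot b b * dot c c - dot b c ^+ 2)
    - dot a b * (dot a b * dot c c - dot b c * dot c a)
    + dot c a * (dot a b * dot b c - dot b b * dot c a).
  by rewrite /dot /cross !coordE; ring.
have : dot a a * dot b b * dot c c = 0.
  by move: gram; rewrite D0 ab bc ca => gram; rewrite expr0n/= in gram; lra.
move=> /eqP; rewrite !mulf_eq0 => /orP[/orP[]|] /eqP/dot_eq0/eqP; exact/negP.
Qed.

(* Cramer's rule for the inverse of [cell_map K]. *)
Definition ref_coord K x : R3 R :=
  (dot (cross (edge2 K) (edge3 K)) (x - org K) / cell_det K,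
   dot (cross (edge3 K) (edge1 K)) (x - org K) / cell_det K,
   dot (cross (edge1 K) (edge2 K)) (x - org K) / cell_det K).

Lemma ref_coordK K : valid_cell K -> cancel (ref_coord K) (cell_map K).
Proof.
move=> /cell_det_neq0 D0 x; move: D0.
rewrite /cell_map /ref_coord /cell_det /cross /dot !coordE => D0.
by apply: R3P; rewrite !coordE; field.
Qed.

Lemma cell_mapK K : valid_cell K -> cancel (cell_map K) (ref_coord K).
Proof.
move=> /cell_det_neq0 D0 x; move: D0.
rewrite /cell_map /ref_coord /cell_det /cross /dot !coordE => D0.
by apply: R3P; rewrite !coordE; field.
Qed.

Lemma ocellE K : valid_cell K -> ocell K = ref_coord K @^-1` ref_open (cshape K).
Proof.
move=> vK; apply/seteqP; split => [x [t Kt <-]|x Kx] /=; first by rewrite cell_mapK.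
by exists (ref_coord K x) => //; rewrite ref_coordK.
Qed.

Lemma ccellE K : valid_cell K -> ccell K = ref_coord K @^-1` ref_closed (cshape K).
Proof.
move=> vK; apply/seteqP; split => [x [t Kt <-]|x Kx] /=; first by rewrite cell_mapK.
by exists (ref_coord K x) => //; rewrite ref_coordK.
Qed.

(* Affine functions on the reference element, in the order of [facets]: the
   element is the set where they are nonpositive. *)
Definition ref_lams (sh : Defs.shape) : seq (R3 R -> R) :=
  match sh with
  | Cartesian => [:: (fun t => - c1 t); (fun t => c1 t - 1);
      (fun t => - c2 t); (fun t => c2 t - 1);
      (fun t => - c3 t); (fun t => c3 t - 1)]
  | Simplex => [:: (fun t => - c1 t); (fun t => - c2 t); (fun t => - c3 t);
      (fun t => c1 t + c2 t + c3 t - 1)]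
  end.

(* Negative on the side of K. *)
Definition facet_dist K F x := dot (outward_normal K F) (x - forg F).

Lemma size_facets K : size (facets K) = size (ref_lams (cshape K)).
Proof. by rewrite /facets; case: (cshape K). Qed.

Let F0 : facet R := (0, 0, 0).
Let l0 : R3 R -> R := fun=> 0.
Local Notation fnth K i := (nth F0 (facets K) i).
Local Notation lnth K i := (nth l0 (ref_lams (cshape K)) i).

(** The sign in [outward_normal] is evaluated at the barycenter, where [l] is negative: it is the
    sign of [e], and turns the factor [e] into its absolute value. *)
Lemma facet_distE K F (l : R3 R -> R) (e : R) : e != 0 ->
  (forall x, dot (facet_dir F) (x - forg F) = e * l x) ->
  l (barycenter K) < 0 ->
  facet_dir F != 0 /\
  forall x, facet_dist K F x = `|e| / enorm (facet_dir F) * l x.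
Proof.
move=> e0 El lb; split.
  apply/eqP => d0; have := El (barycenter K).
  rewrite d0 /dot /= !mul0r !addr0 => /esym/eqP; rewrite mulf_eq0 (negbTE e0)/=.
  by move=> /eqP h; rewrite h ltxx in lb.
move=> x; rewrite /facet_dist /outward_normal dotZl El.
have -> : forg F - barycenter K = - (barycenter K - forg F) by rewrite opprB.
rewrite dotNr El -mulrN sgrM (@gtr0_sg _ (- _)) ?oppr_gt0// mulr1.
by rewrite [in RHS]normrEsg; ring.
Qed.

(** Carries every inequality about facets to the reference element, where it is linear in the
    coordinates. *)
Lemma facet_dist_ref K i : valid_cell K -> (i < size (facets K))%N ->
  facet_dir (fnth K i) != 0 /\ exists2 m : R, 0 < m &
    forall x, facet_dist K (fnth K i) x = m * lnth K i (ref_coord K x).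
Proof.
move=> vK; have D0 := cell_det_neq0 vK.
(* The constant [e] is [- cell_det K] for the facets through the vertex [org K] and [cell_det K] for
   the others. *)
suff H : (i < size (facets K))%N -> exists2 e, e != 0 & [/\
   forall x, dot (facet_dir (fnth K i)) (x - forg (fnth K i))
      = e * lnth K i (ref_coord K x) &
    lnth K i (ref_coord K (barycenter K)) < 0].
  move=> /H[e e0 [He lb]]; have [d0 dE] := facet_distE e0 He lb.
  split => //; exists (`|e| / enorm (facet_dir (fnth K i))) => //.
  by rewrite divr_gt0 ?normr_gt0 ?enorm_gt0.
pose a := edge1 K; pose b := edge2 K; pose c := edge3 K; pose p := org K.
have Dx1 x : dot (cross b c) (x - p) = cell_det K * c1 (ref_coord K x).
  by rewrite /ref_coord coordE mulrC divfK.
have Dx2 x : dot (cross c a) (x - p) = cell_det K * c2 (ref_coord K x).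
  by rewrite /ref_coord coordE mulrC divfK.
have Dx3 x : dot (cross a b) (x - p) = cell_det K * c3 (ref_coord K x).
  by rewrite /ref_coord coordE mulrC divfK.
have nD0 : - cell_det K != 0 by rewrite oppr_eq0.
rewrite /barycenter /facets; case: (cshape K) => /=.
  have -> : ref_coord K (org K + 2^-1 *: (a + b + c)) = (2^-1, 2^-1, 2^-1).
    have -> : org K + 2^-1 *: (a + b + c) = cell_map K (2^-1, 2^-1, 2^-1).
      by rewrite /cell_map !coordE -!scalerDr.
    by rewrite cell_mapK.
  have h1 : - 2^-1 < 0 :> R by lra.
  have h2 : 2^-1 - 1 < 0 :> R by lra.
  case: i => [|[|[|[|[|[|//]]]]]] _ /=.
  - exists (- cell_det K) => //; split; last by rewrite ?coordE.
    move=> x.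
    by rewrite [LHS]Dx1; ring.
  - exists (cell_det K) => //; split; last by rewrite ?coordE.
    move=> x.
    rewrite mulrBr -[_ * c1 _]Dx1 /facet_dir /forg /fedge1 /fedge2/= -/a -/b -/c -/p.
    by rewrite /cell_det -/a -/b -/c /dot /cross !coordE; ring.
  - exists (- cell_det K) => //; split; last by rewrite ?coordE.
    move=> x.
    by rewrite [LHS]Dx2; ring.
  - exists (cell_det K) => //; split; last by rewrite ?coordE.
    move=> x.
    rewrite mulrBr -[_ * c2 _]Dx2 /facet_dir /forg /fedge1 /fedge2/= -/a -/b -/c -/p.
    by rewrite /cell_det -/a -/b -/c /dot /cross !coordE; ring.
  - exists (- cell_det K) => //; split; last by rewrite ?coordE.
    move=> x.
    by rewrite [LHS]Dx3 mulrNN.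
  - exists (cell_det K) => //; split; last by rewrite ?coordE.
    move=> x.
    transitivity (cell_det K * (c3 (ref_coord K x) - 1)) => //.
    rewrite mulrBr -Dx3 /facet_dir /forg /fedge1 /fedge2/= -/a -/b -/c -/p.
    by rewrite /cell_det -/a -/b -/c /dot /cross !coordE; ring.
have -> : ref_coord K (org K + 4^-1 *: (a + b + c)) = (4^-1, 4^-1, 4^-1).
  have -> : org K + 4^-1 *: (a + b + c) = cell_map K (4^-1, 4^-1, 4^-1).
    by rewrite /cell_map !coordE -!scalerDr.
  by rewrite cell_mapK.
have h1 : - 4^-1 < 0 :> R by lra.
have h2 : 4^-1 + 4^-1 + 4^-1 - 1 < 0 :> R by lra.
case: i => [|[|[|[|//]]]] _ /=.
- exists (- cell_det K) => //; split; last by rewrite ?coordE.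
    move=> x.
  by rewrite [LHS]Dx1; ring.
- exists (- cell_det K) => //; split; last by rewrite ?coordE.
    move=> x.
  by rewrite [LHS]Dx2; ring.
- exists (- cell_det K) => //; split; last by rewrite ?coordE.
    move=> x.
  by rewrite [LHS]Dx3 mulrNN.
- exists (cell_det K) => //; split; last by rewrite ?coordE.
    move=> x.
  transitivity (cell_det K *
    (c1 (ref_coord K x) + c2 (ref_coord K x) + c3 (ref_coord K x) - 1)) => //.
  rewrite mulrBr !mulrDr -Dx1 -Dx2 -Dx3.
  rewrite /facet_dir /forg /fedge1 /fedge2/= -/a -/b -/c -/p.
  by rewrite /cell_det -/a -/b -/c /dot /cross !coordE; ring.
Qed.

End CellGeometry.

Section Facets.
Variable R : realType.
Implicit Types (K : cell R) (F G : facet R) (x y : R3 R).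

Let F0 : facet R := (0, 0, 0).
Let l0 : R3 R -> R := fun=> 0.

Lemma ref_openP sh (t : R3 R) : ref_open sh t <->
  forall i, (i < size (ref_lams R sh))%N -> nth l0 (ref_lams R sh) i t < 0.
Proof.
case: sh => /=; split.
- by move=> [/andP[? ?] /andP[? ?] /andP[? ?]] [|[|[|[|[|[|//]]]]]] _ /=; lra.
- move=> H; have := H 0%N isT; have := H 1%N isT; have := H 2%N isT.
  have := H 3%N isT; have := H 4%N isT; have := H 5%N isT => /= *.
  by split; apply/andP; split; lra.
- by move=> [? ? ? ?] [|[|[|[|//]]]] _ /=; lra.
- move=> H; have := H 0%N isT; have := H 1%N isT; have := H 2%N isT.
  by have := H 3%N isT => /= *; split; lra.
Qed.

Lemma ref_closedP sh (t : R3 R) : ref_closed sh t <->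
  forall i, (i < size (ref_lams R sh))%N -> nth l0 (ref_lams R sh) i t <= 0.
Proof.
case: sh => /=; split.
- by move=> [/andP[? ?] /andP[? ?] /andP[? ?]] [|[|[|[|[|[|//]]]]]] _ /=; lra.
- move=> H; have := H 0%N isT; have := H 1%N isT; have := H 2%N isT.
  have := H 3%N isT; have := H 4%N isT; have := H 5%N isT => /= *.
  by split; apply/andP; split; lra.
- by move=> [? ? ? ?] [|[|[|[|//]]]] _ /=; lra.
- move=> H; have := H 0%N isT; have := H 1%N isT; have := H 2%N isT.
  by have := H 3%N isT => /= *; split; lra.
Qed.

Lemma ocellP K x : valid_cell K ->
  ocell K x <-> forall F, F \in facets K -> facet_dist K F x < 0.
Proof.
move=> vK; rewrite ocellE//= ref_openP; split => [H F /(nthP F0)[i iK <-]|H i iK].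
  have [_ [m m0 ->]] := facet_dist_ref vK iK.
  by rewrite pmulr_rlt0// H// -size_facets.
rewrite -size_facets in iK; have [_ [m m0 E]] := facet_dist_ref vK iK.
by rewrite -(pmulr_rlt0 _ m0) -E H// mem_nth.
Qed.

Lemma ccellP K x : valid_cell K ->
  ccell K x <-> forall F, F \in facets K -> facet_dist K F x <= 0.
Proof.
move=> vK; rewrite ccellE//= ref_closedP; split => [H F /(nthP F0)[i iK <-]|H i iK].
  have [_ [m m0 ->]] := facet_dist_ref vK iK.
  by rewrite pmulr_rle0// H// -size_facets.
rewrite -size_facets in iK; have [_ [m m0 E]] := facet_dist_ref vK iK.
by rewrite -(pmulr_rle0 _ m0) -E H// mem_nth.
Qed.

Lemma facet_dir_neq0 K F : valid_cell K -> F \in facets K -> facet_dir F != 0.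
Proof.
by move=> vK /(nthP F0)[i iK <-]; case: (facet_dist_ref vK iK).
Qed.

Lemma barycenter_ocell K : valid_cell K -> ocell K (barycenter K).
Proof.
move=> vK; rewrite /ocell /barycenter; case: (cshape K).
  exists (2^-1, 2^-1, 2^-1); last by rewrite /cell_map !coordE -!scalerDr.
  by rewrite /= !coordE; split; apply/andP; split; lra.
exists (4^-1, 4^-1, 4^-1); last by rewrite /cell_map !coordE -!scalerDr.
by rewrite /= !coordE; split; lra.
Qed.

Lemma facet_mapP K i t : valid_cell K -> (i < size (facets K))%N ->
  ref_facet (cshape K) t <->
  facet_dist K (nth F0 (facets K) i) (facet_map (nth F0 (facets K) i) t) = 0 /\
  forall j, (j < size (facets K))%N -> j != i ->
    facet_dist K (nth F0 (facets K) j) (facet_map (nth F0 (facets K) i) t) < 0.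
Proof.
move=> vK iK.
suff H : ref_facet (cshape K) t <->
  nth l0 (ref_lams R (cshape K)) i
    (ref_coord K (facet_map (nth F0 (facets K) i) t)) = 0 /\
  forall j, (j < size (facets K))%N -> j != i ->
    nth l0 (ref_lams R (cshape K)) j
      (ref_coord K (facet_map (nth F0 (facets K) i) t)) < 0.
  apply: (iff_trans H); split => -[Hi Hj].
    split.
      by have [_ [m m0 ->]] := facet_dist_ref vK iK; rewrite Hi mulr0.
    move=> j jK ji; have [_ [m m0 ->]] := facet_dist_ref vK jK.
    by rewrite pmulr_rlt0// Hj.
  split.
    have [_ [m m0 E]] := facet_dist_ref vK iK; move: Hi => /eqP.
    by rewrite E mulf_eq0 gt_eqF//= => /eqP.
  move=> j jK ji; have [_ [m m0 E]] := facet_dist_ref vK jK.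
  by rewrite -(pmulr_rlt0 _ m0) -E Hj.
have coordE' (y : R3 R) s : y = cell_map K s -> ref_coord K y = s.
  by move=> ->; rewrite cell_mapK.
move: iK; rewrite /facets.
case: (cshape K) => /= iK.
(* [s] is the point with parameter [t] in reference coordinates, listed facet by facet; the places
   of [t.1] and [t.2] follow the cyclic order of the edges in [facets]. *)
{ pose s : R3 R := nth (0, 0, 0) [:: (0, t.1, t.2); (1, t.1, t.2); (t.2, 0, t.1);
    (t.2, 1, t.1); (t.1, t.2, 0); (t.1, t.2, 1)] i.
  rewrite (coordE' _ s); last first.
    rewrite /s /facet_map /cell_map /forg /fedge1 /fedge2.
    by case: i iK {s} => [|[|[|[|[|[|//]]]]]] _ /=; apply: R3P; rewrite !coordE; ring.
  rewrite {}/s.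
  case: i iK => [|[|[|[|[|[|//]]]]]] _; rewrite /c1 /c2 /c3 /=; split.
  all: try by [move=> [/andP[? ?] /andP[? ?]]; split; [lra |
    move=> [|[|[|[|[|[|//]]]]]] //= _ _; lra]].
  all: move=> [_ H]; try have /= h0 := H 0%N isT isT; try have /= h1 := H 1%N isT isT;
    try have /= h2 := H 2%N isT isT; try have /= h3 := H 3%N isT isT;
    try have /= h4 := H 4%N isT isT; try have /= h5 := H 5%N isT isT; split; lra. }
pose s : R3 R := nth (0, 0, 0) [:: (0, t.1, t.2); (t.2, 0, t.1); (t.1, t.2, 0);
  (1 - t.1 - t.2, t.1, t.2)] i.
rewrite (coordE' _ s); last first.
  rewrite /s /facet_map /cell_map /forg /fedge1 /fedge2.
  by case: i iK {s} => [|[|[|[|//]]]] _ /=; apply: R3P; rewrite !coordE; ring.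
rewrite {}/s.
case: i iK => [|[|[|[|//]]]] _; rewrite /c1 /c2 /c3 /=; split.
all: try by [move=> [? ? ?]; split; [lra |
  move=> [|[|[|[|//]]]] //= _ _; lra]].
all: move=> [_ H]; try have /= h0 := H 0%N isT isT; try have /= h1 := H 1%N isT isT;
  try have /= h2 := H 2%N isT isT; try have /= h3 := H 3%N isT isT; split; lra.
Qed.

End Facets.

(** * Open facets, unit normals and directions into a cell *)

Section FacetGeometry.
Variable R : realType.
Implicit Types (K : cell R) (F G : facet R) (x y w : R3 R) (t : R * R).

Let F0 : facet R := (0, 0, 0).

Lemma ref_facet_neq0 sh : exists t : R * R, ref_facet sh t.
Proof.
by exists (4^-1, 4^-1); case: sh => /=; split; try (apply/andP; split); lra.
Qed.

(** A point of the open facet with index [i] has distance 0 to that facet and negative distance to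
    those of all other indices. *)
Lemma uniq_facets K : valid_cell K -> uniq (facets K).
Proof.
move=> vK; apply/(uniqP F0) => i j; rewrite !inE => iK jK ij.
apply/eqP; apply: contraT => nij.
have [t Kt] := ref_facet_neq0 (cshape K).
have [e0 _] := (facet_mapP _ vK iK).1 Kt.
have [_ /(_ i iK nij)] := (facet_mapP _ vK jK).1 Kt.
by rewrite ij -ij e0 ltxx.
Qed.

Definition open_facet K F : set (R3 R) := facet_map F @` ref_facet (cshape K).

Lemma open_facet_dist K F x : valid_cell K -> F \in facets K -> open_facet K F x ->
  facet_dist K F x = 0 /\
  forall G, G \in facets K -> G != F -> facet_dist K G x < 0.
Proof.
move=> vK /(nthP F0)[i iK <-] [t Kt <-].
have [e0 H] := (facet_mapP _ vK iK).1 Kt; split => // G /(nthP F0)[j jK <-] GF.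
by apply: H => //; apply: contra_neq GF => ->.
Qed.

Lemma open_facet_uniq K F G x : valid_cell K -> F \in facets K ->
  G \in facets K -> open_facet K F x -> open_facet K G x -> F = G.
Proof.
move=> vK FK GK /(open_facet_dist vK FK)[F0x _] /(open_facet_dist vK GK)[_ HG].
by apply/eqP; apply: contraT => FG; have := HG _ FK FG; rewrite F0x ltxx.
Qed.

Lemma open_facet_ccell K F x : valid_cell K -> F \in facets K ->
  open_facet K F x -> ccell K x.
Proof.
move=> vK FK /(open_facet_dist vK FK)[Fx HG]; apply/(ccellP _ vK) => G GK.
have [->|GF] := eqVneq G F; first by rewrite Fx.
exact/ltW/HG.
Qed.

(* The coordinates in the basis [fedge1 F, fedge2 F] of a vector of their span. *)
Definition facet_coord F x : R * R :=
  (dot (cross (x - forg F) (fedge2 F)) (facet_dir F) / dot (facet_dir F) (facet_dir F),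
   dot (cross (fedge1 F) (x - forg F)) (facet_dir F) / dot (facet_dir F) (facet_dir F)).

Lemma facet_dot_neq0 F : facet_dir F != 0 -> dot (facet_dir F) (facet_dir F) != 0.
Proof. by apply: contra_neq; exact: dot_eq0. Qed.

Lemma facet_mapK F : facet_dir F != 0 -> cancel (facet_map F) (facet_coord F).
Proof.
move=> /facet_dot_neq0; rewrite /facet_coord /facet_map /facet_dir => d0 [s t].
congr pair.
  apply: (mulIf d0); rewrite divfK//.
  by rewrite /dot /cross !coordE /=; ring.
apply: (mulIf d0); rewrite divfK//.
by rewrite /dot /cross !coordE /=; ring.
Qed.

Lemma facet_coordK F x : facet_dir F != 0 -> dot (facet_dir F) (x - forg F) = 0 ->
  facet_map F (facet_coord F x) = x.
Proof.
move=> /facet_dot_neq0 d0 H; rewrite /facet_map /facet_coord /=.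
set n := facet_dir F in d0 H *.
have E : dot n n *: (x - forg F) = dot (cross (x - forg F) (fedge2 F)) n *: fedge1 F
    + dot (cross (fedge1 F) (x - forg F)) n *: fedge2 F + dot n (x - forg F) *: n.
  by apply: R3P; rewrite /n /facet_dir /dot /cross !coordE; ring.
rewrite H scale0r addr0 in E.
rewrite [_ / dot n n]mulrC [X in _ + X *: _]mulrC -!scalerA -scalerDr -E.
by rewrite scalerA mulVf// scale1r addrC subrK.
Qed.

Lemma facet_dist_eq0 K F x : valid_cell K -> F \in facets K ->
  facet_dist K F x = 0 -> dot (facet_dir F) (x - forg F) = 0.
Proof.
move=> vK FK; have d0 := facet_dir_neq0 vK FK.
rewrite /facet_dist /outward_normal dotZl => /eqP; rewrite mulf_eq0 => /orP[|/eqP//].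
rewrite mulf_eq0 invr_eq0 (gt_eqF (enorm_gt0 d0)) orbF sgr_eq0 => /eqP e0.
have := (ocellP (barycenter K) vK).1 (barycenter_ocell vK) F FK.
rewrite /facet_dist /outward_normal dotZl -[forg F - _]opprB dotNr.
by rewrite -[dot _ (barycenter K - _)]opprK -dotNr opprB e0 oppr0 mulr0 ltxx.
Qed.

Lemma open_facetP K F x : valid_cell K -> F \in facets K ->
  open_facet K F x <-> facet_dist K F x = 0 /\
    forall G, G \in facets K -> G != F -> facet_dist K G x < 0.
Proof.
move=> vK FK; split; first exact: open_facet_dist.
move=> [Fx HG].
have E : facet_map F (facet_coord F x) = x.
  by apply: facet_coordK; [exact: facet_dir_neq0 FK|exact: facet_dist_eq0 Fx].
exists (facet_coord F x) => //.
move: FK Fx HG E => /(nthP F0)[i iK <-] Fx HG E.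
apply/(facet_mapP _ vK iK); rewrite E; split => // j jK ji.
apply: HG; first exact: mem_nth.
by rewrite nth_uniq// uniq_facets.
Qed.

Lemma dot_outward_normal K F : valid_cell K -> F \in facets K ->
  dot (outward_normal K F) (outward_normal K F) = 1.
Proof.
move=> vK FK; have d0 := facet_dir_neq0 vK FK.
have e0 : enorm (facet_dir F) != 0 by rewrite gt_eqF// enorm_gt0.
have s0 : Num.sg (dot (facet_dir F) (forg F - barycenter K)) != 0.
  have := (ocellP (barycenter K) vK).1 (barycenter_ocell vK) F FK.
  rewrite /facet_dist /outward_normal dotZl; apply: contraTneq => ->.
  by rewrite !mul0r ltxx.
rewrite sgr_eq0 in s0.
rewrite /outward_normal dotZl dotZr -enorm_sqr.
set e := enorm _ in e0 *; set s := dot _ _ in s0 *.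
have : Num.sg s ^+ 2 = 1 by rewrite sqr_sg s0.
by move=> s1; rewrite -s1; field.
Qed.

Lemma normal_unique K F w : valid_cell K -> F \in facets K -> dot w w = 1 ->
  dot w (fedge1 F) = 0 -> dot w (fedge2 F) = 0 ->
  w = outward_normal K F \/ w = - outward_normal K F.
Proof.
move=> vK FK w1 we1 we2; have /facet_dot_neq0 d0 := facet_dir_neq0 vK FK.
have n1 := dot_outward_normal vK FK.
set m := outward_normal K F in n1 *; set n := facet_dir F in d0.
(* The expansion of [w] in the normal and the two edges; the edge coefficients come from the inverse
   Gram matrix, whose determinant is [dot n n] by Lagrange's identity. *)
have E : dot n n *: w = dot n w *: n
    + (dot w (fedge1 F) * dot (fedge2 F) (fedge2 F)
       - dot w (fedge2 F) * dot (fedge1 F) (fedge2 F)) *: fedge1 F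
    + (dot w (fedge2 F) * dot (fedge1 F) (fedge1 F)
       - dot w (fedge1 F) * dot (fedge1 F) (fedge2 F)) *: fedge2 F.
  by apply: R3P; rewrite /n /facet_dir /dot /cross !coordE; ring.
rewrite we1 we2 !mul0r subrr !scale0r !addr0 in E.
have [c mE] : exists c, m = c *: n by rewrite /m /outward_normal; eexists.
have c0 : c != 0.
  by apply: contra_eq_neq n1 => c0; rewrite mE c0 dotZl mul0r eq_sym oner_neq0.
pose k := dot n w / dot n n / c.
have wE : w = k *: m.
  rewrite mE scalerA /k divfK//.
  by rewrite [_ / dot n n]mulrC -scalerA -E scalerA mulVf// scale1r.
have : (k - 1) * (k + 1) = 0.
  by move: w1; rewrite wE dotZl dotZr n1 => ?; lra.
move=> /eqP; rewrite mulf_eq0 => /orP[/eqP k1|/eqP k1].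
  by left; rewrite wE (_ : k = 1) ?scale1r//; lra.
by right; rewrite wE (_ : k = -1) ?scaleN1r//; lra.
Qed.

Lemma facet_dist_affine K F x w (e : R) :
  facet_dist K F (x + e *: w) = facet_dist K F x + e * dot (outward_normal K F) w.
Proof. by rewrite /facet_dist -dotZr -dotDr addrAC. Qed.

Lemma near_lt0 (a b : R) : a < 0 -> \forall e \near 0^'+, a + e * b < 0.
Proof.
have b1 : 0 < `|b| + 1 by rewrite ltr_wpDl.
move=> a0; near=> e.
have e0 : 0 < e by near: e; exact: nbhs_right_gt.
have eb : e < - a / (`|b| + 1).
  by near: e; apply: nbhs_right_lt; rewrite divr_gt0 ?oppr_gt0.
have : e * b <= e * `|b| by rewrite ler_pM2l// ler_norm.
by move: eb; rewrite ltr_pdivlMr//; lra.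
Unshelve. all: by end_near.
Qed.

Lemma near_all_seq (T : eqType) (s : seq T) (P : T -> R -> Prop) :
  (forall i, i \in s -> \forall e \near 0^'+, P i e) ->
  \forall e \near 0^'+, forall i, i \in s -> P i e.
Proof.
elim: s => [_|i s IHs H]; first by near=> e.
have Hi := H i (mem_head _ _).
have /IHs Hs : forall j, j \in s -> \forall e \near 0^'+, P j e.
  by move=> j js; apply: H; rewrite inE js orbT.
near=> e => j; rewrite inE => /predU1P[->|].
  by near: e.
by move: j; near: e.
Unshelve. all: by end_near.
Qed.

(** Strict inequalities survive a short step, and equalities at [x] become strict because [w] points
    inward; as there are finitely many facets, one range of step lengths serves all. *)
Lemma near_ocell K x w : valid_cell K ->
  (forall F, F \in facets K -> facet_dist K F x < 0 \/
     facet_dist K F x = 0 /\ dot (outward_normal K F) w < 0) ->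
  \forall e \near 0^'+, ocell K (x + e *: w).
Proof.
move=> vK H.
have : \forall e \near 0^'+, forall F, F \in facets K ->
    facet_dist K F (x + e *: w) < 0.
  apply: near_all_seq => F FK.
  suff : \forall e \near 0^'+, facet_dist K F x + e * dot (outward_normal K F) w < 0.
    by apply: filterS => e; rewrite facet_dist_affine.
  have [h|[-> h]] := H F FK; first exact: near_lt0.
  apply: filterS (nbhs_right_gt 0) => e e0.
  by rewrite add0r pmulr_rlt0.
by apply: filterS => e He; apply/(ocellP _ vK).
Qed.

Lemma near_not_ccell K x w : valid_cell K ->
  (exists2 F, F \in facets K & 0 < facet_dist K F x \/
     facet_dist K F x = 0 /\ 0 < dot (outward_normal K F) w) ->
  \forall e \near 0^'+, ~ ccell K (x + e *: w).
Proof.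
move=> vK [F FK H].
have : \forall e \near 0^'+, - facet_dist K F (x + e *: w) < 0.
  suff : \forall e \near 0^'+,
      - facet_dist K F x + e * - dot (outward_normal K F) w < 0.
    by apply: filterS => e; rewrite facet_dist_affine mulrN -opprD.
  have [h|[-> h]] := H; first by apply: near_lt0; rewrite oppr_lt0.
  apply: filterS (nbhs_right_gt 0) => e e0.
  by rewrite oppr0 add0r pmulr_rlt0 ?oppr_lt0.
apply: filterS => e He /(ccellP _ vK) /(_ F FK).
by rewrite -oppr_ge0 leNgt He.
Qed.

End FacetGeometry.

(** * Measurability of cells and facets, null sets *)

Section MeasurableSets.
Context d (T : measurableType d) (R : realType).

Lemma measurable_lt0 (f : T -> R) : measurable_fun setT f ->
  measurable [set x | f x < 0].
Proof.
move=> mf; rewrite -[X in measurable X]setTI.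
have -> : [set x | f x < 0] = f @^-1` `]-oo, 0[%classic.
  by apply/seteqP; split => x /=; rewrite in_itv.
exact: mf.
Qed.

Lemma measurable_le0 (f : T -> R) : measurable_fun setT f ->
  measurable [set x | f x <= 0].
Proof.
move=> mf; rewrite -[X in measurable X]setTI.
have -> : [set x | f x <= 0] = f @^-1` `]-oo, 0]%classic.
  by apply/seteqP; split => x /=; rewrite in_itv.
exact: mf.
Qed.

Lemma measurable_eq0 (f : T -> R) : measurable_fun setT f ->
  measurable [set x | f x = 0].
Proof.
move=> mf; rewrite -[X in measurable X]setTI.
have -> : [set x | f x = 0] = f @^-1` [set 0] by [].
exact: mf.
Qed.

Lemma measurable_all_seq (I : eqType) (s : seq I) (P : I -> set T) :
  (forall i, i \in s -> measurable (P i)) ->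
  measurable [set x | forall i, i \in s -> P i x].
Proof.
elim: s => [_|i s IHs H].
  by rewrite (_ : mkset _ = setT)//; apply/seteqP; split.
rewrite (_ : mkset _ = P i `&` [set x | forall j, j \in s -> P j x]).
  apply: measurableI; first exact: H (mem_head _ _).
  by apply: IHs => j js; apply: H; rewrite inE js orbT.
apply/seteqP; split => [x Hx|x [Pi Hx] j].
  split; first exact: Hx (mem_head _ _).
  by move=> j js; apply: Hx; rewrite inE js orbT.
by rewrite inE => /predU1P[->//|]; exact: Hx.
Qed.

Lemma null_all_seq (mu : {measure set T -> \bar R}) (I : eqType) (s : seq I)
    (P : I -> T -> Prop) :
  (forall i, i \in s -> exists N, [/\ measurable N, mu N = 0%E
     & forall x, ~ N x -> P i x]) ->
  exists N, [/\ measurable N, mu N = 0%E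
     & forall x, ~ N x -> forall i, i \in s -> P i x].
Proof.
elim: s => [_|i s IHs H]; first by exists set0; split.
have [N [mN N0 HN]] := H i (mem_head _ _).
have [|N' [mN' N'0 HN']] := IHs.
  by move=> j js; apply: H; rewrite inE js orbT.
exists (N `|` N'); split; first exact: measurableU.
  by rewrite measureU0.
move=> x /not_orP[nN nN'] j; rewrite inE => /predU1P[->|]; first exact: HN.
exact: HN'.
Qed.

End MeasurableSets.

Section AffineMeasurability.
Variable R : realType.

Lemma measurable_affine2 (a b c : R) :
  measurable_fun setT (fun z : mR2 R => a * z.1 + b * z.2 + c : mR R).
Proof.
have m1 : measurable_fun setT (fun z : mR2 R => z.1 : mR R).
  exact: measurable_fst.
have m2 : measurable_fun setT (fun z : mR2 R => z.2 : mR R).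
  exact: measurable_snd.
by apply: measurable_funD => //; apply: measurable_funD; apply: measurable_funM.
Qed.

Lemma measurable_c1 : measurable_fun setT (c1 : mR3 R -> mR R).
Proof. exact: (measurableT_comp measurable_fst measurable_fst). Qed.
Lemma measurable_c2 : measurable_fun setT (c2 : mR3 R -> mR R).
Proof. exact: (measurableT_comp measurable_snd measurable_fst). Qed.
Lemma measurable_c3 : measurable_fun setT (c3 : mR3 R -> mR R).
Proof. exact: measurable_snd. Qed.

Lemma measurable_facet_dist (K : cell R) F :
  measurable_fun setT (facet_dist K F : mR3 R -> mR R).
Proof.
rewrite /facet_dist /dot.
by apply: measurable_funD; first apply: measurable_funD;
  apply: measurable_funM => //; apply: measurable_funD => //;
  (exact: measurable_c1 || exact: measurable_c2 || exact: measurable_c3).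
Qed.

Lemma measurable_facet_map (F : facet R) :
  measurable_fun setT (facet_map F : mR2 R -> mR3 R).
Proof.
rewrite (_ : facet_map F = (fun t =>
  (c1 (fedge1 F) * t.1 + c1 (fedge2 F) * t.2 + c1 (forg F),
   c2 (fedge1 F) * t.1 + c2 (fedge2 F) * t.2 + c2 (forg F),
   c3 (fedge1 F) * t.1 + c3 (fedge2 F) * t.2 + c3 (forg F)))).
  apply: measurable_fun_pair; last exact: measurable_affine2.
  by apply: measurable_fun_pair; exact: measurable_affine2.
by apply/funext => t; apply: R3P; rewrite !coordE; ring.
Qed.

Implicit Types K : cell R.

Lemma measurable_ocell K : valid_cell K ->
  measurable (ocell K : set3 R).
Proof.
move=> vK.
rewrite (_ : ocell K = [set x | forall F, F \in facets K -> facet_dist K F x < 0]).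
  by apply: measurable_all_seq => F _; apply: measurable_lt0; exact: measurable_facet_dist.
by apply/seteqP; split => x /(ocellP _ vK).
Qed.

Lemma measurable_ccell K : valid_cell K ->
  measurable (ccell K : set3 R).
Proof.
move=> vK.
rewrite (_ : ccell K = [set x | forall F, F \in facets K -> facet_dist K F x <= 0]).
  by apply: measurable_all_seq => F _; apply: measurable_le0; exact: measurable_facet_dist.
by apply/seteqP; split => x /(ccellP _ vK).
Qed.

Lemma measurable_open_facet K F : valid_cell K -> F \in facets K ->
  measurable (open_facet K F : set3 R).
Proof.
move=> vK FK.
rewrite (_ : open_facet K F = [set x | facet_dist K F x = 0] `&`
  [set x | forall G, G \in facets K -> (G != F -> facet_dist K G x < 0)]).
  apply: measurableI; first by apply: measurable_eq0; exact: measurable_facet_dist.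
  apply: measurable_all_seq => G _; have [_|] := eqVneq G F.
    by rewrite (_ : (fun _ => _) = setT)//; apply/seteqP; split.
  move=> GF; rewrite (_ : (fun _ => _) = [set x | facet_dist K G x < 0]).
    by apply: measurable_lt0; exact: measurable_facet_dist.
  by apply/seteqP; split => [x /=|x /= ? _//]; exact.
by apply/seteqP; split => x /(open_facetP _ vK FK).
Qed.

Lemma measurable_facet_preimage F (A : set3 R) :
  measurable A -> measurable (facet_map F @^-1` A : set2 R).
Proof.
move=> mA; rewrite -[X in measurable X]setTI.
exact: (measurable_facet_map F).
Qed.

(** The reference element as a cell, so that measurability and boundedness on the reference sets are
    instances of the results for cells. *)
Definition unit_cell sh : cell R :=
  Cell sh 0 (@basis1 R) (@basis2 R) (@basis3 R).

Lemma valid_unit_cell sh : valid_cell (unit_cell sh).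
Proof.
have n10 : (1 : R) != 0 by exact: oner_neq0.
rewrite /unit_cell /basis1 /basis2 /basis3; case: sh; rewrite /valid_cell /=; last first.
  by rewrite /dot /cross /c1 /c2 /c3 /= !(mulr0, mul0r, mulr1, mul1r, subr0, addr0, add0r).
split; last by split; rewrite /dot /c1 /c2 /c3 /= !(mulr0, mul0r, addr0).
by split; apply: contra_neq n10 => e; [exact: (congr1 c1 e)|exact: (congr1 c2 e)
  |exact: (congr1 c3 e)].
Qed.

Lemma measurable_ref_facet sh : measurable (@ref_facet R sh : set2 R).
Proof.
have vK := valid_unit_cell sh; pose F := head (0, 0, 0) (facets (unit_cell sh)).
have FK : F \in facets (unit_cell sh) by rewrite /F; case: sh {vK F}; exact: mem_head.
rewrite (_ : ref_facet sh = facet_map F @^-1` open_facet (unit_cell sh) F).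
  by apply: measurable_facet_preimage; exact: measurable_open_facet.
apply/seteqP; split => [t Kt|t [s Ks]]; first by exists t.
by move=> /(can_inj (facet_mapK (facet_dir_neq0 vK FK))) <-.
Qed.

Lemma leb2_square_lty : (@leb2 R (`[0%R, 1%R]%classic `*` `[0%R, 1%R]%classic) < +oo)%E.
Proof.
apply: (product_measure_lty (m1 := leb1 R) (m2 := leb1 R)) => //.
  by rewrite /leb1 /= lebesgue_measure_itv /= lte01 -EFinB ltry.
by rewrite /leb1 /= lebesgue_measure_itv /= lte01 -EFinB ltry.
Qed.

Lemma ref_facet_square sh : @ref_facet R sh `<=` `[0%R, 1%R]%classic `*` `[0%R, 1%R]%classic.
Proof.
case: sh => t /=; rewrite !in_itv /=.
  by move=> [/andP[? ?] /andP[? ?]]; split; apply/andP; split; exact: ltW.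
by move=> [? ? ?]; split; apply/andP; split; lra.
Qed.

Lemma ref_facet_lty sh : (@leb2 R (ref_facet sh) < +oo)%E.
Proof.
apply: le_lt_trans leb2_square_lty; apply: le_measure => //; rewrite ?inE.
- exact: measurable_ref_facet.
- exact: measurableX.
exact: ref_facet_square.
Qed.

Lemma leb2_line (a b c : R) : (a != 0) || (b != 0) ->
  @leb2 R [set t : mR2 R | a * t.1 + b * t.2 + c = 0] = 0%E.
Proof.
move=> ab0; set A := (X in leb2 X).
have mA : measurable A by apply: measurable_eq0; exact: measurable_affine2.
rewrite /leb2 /= /product_measure1.
have [b0|b0] := eqVneq b 0.
  have a0 : a != 0 by move: ab0; rewrite b0 eqxx orbF.
  have AE : A = [set - c / a] `*` setT.
    apply/seteqP; split => -[x y] /=; rewrite /A /= b0.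
      by move=> h; split => //; apply: (mulIf a0); rewrite divfK//; lra.
    by move=> [-> _]; field.
  transitivity ((leb1 R \x leb1 R)%E A) => //.
  rewrite AE /= product_measure1E//.
  by rewrite [X in (X * _)%E](_ : _ = 0%E) ?mul0e//; exact: lebesgue_measure_set1.
rewrite integral0_eq// => x _ /=.
have -> : xsection A x = [set (- c - a * x) / b].
  apply/seteqP; split => y; rewrite /xsection /A /=.
    by move=> /set_mem /= h; apply: (mulIf b0); rewrite divfK//; lra.
  by move=> ->; apply/mem_set => /=; field.
exact: lebesgue_measure_set1.
Qed.

End AffineMeasurability.

(** * Facets shared by two elements *)

Section SharedFaces.
Variable R : realType.
Implicit Types (K : cell R) (F G : facet R) (x y w : R3 R) (t : R * R).

Lemma facet_dist_facet_map K F G t :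
  facet_dist K G (facet_map F t) = dot (outward_normal K G) (fedge1 F) * t.1
    + dot (outward_normal K G) (fedge2 F) * t.2 + facet_dist K G (forg F).
Proof. by rewrite /facet_dist /facet_map /dot !coordE; ring. Qed.

(* Away from a null set of parameters of a facet [F], only planes parallel to
   [F] are hit. *)
Lemma transversal_null K F : exists N : set2 R,
  [/\ measurable N, @leb2 R N = 0%E & forall t, ~ N t ->
    forall G, G \in facets K -> facet_dist K G (facet_map F t) = 0 ->
    dot (outward_normal K G) (fedge1 F) = 0 /\
    dot (outward_normal K G) (fedge2 F) = 0].
Proof.
apply: null_all_seq => G _.
have [/andP[/eqP h1 /eqP h2]|/nandP h] := boolP
  ((dot (outward_normal K G) (fedge1 F) == 0) &&
   (dot (outward_normal K G) (fedge2 F) == 0)); first by exists set0; split.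
exists [set t : mR2 R | dot (outward_normal K G) (fedge1 F) * t.1
    + dot (outward_normal K G) (fedge2 F) * t.2 + facet_dist K G (forg F) = 0].
split.
- by apply: measurable_eq0; exact: measurable_affine2.
- by apply: leb2_line; apply/orP.
by move=> t nt; rewrite facet_dist_facet_map => /nt.
Qed.

(** The form in which disjointness of interiors is used: no direction leads from [x] into both
    elements. *)
Lemma disjoint_near K1 K2 x w : ocell K1 `&` ocell K2 = set0 ->
  (\forall e \near 0^'+, ocell K1 (x + e *: w)) ->
  (\forall e \near 0^'+, ocell K2 (x + e *: w)) -> False.
Proof.
move=> dis H1 H2; have : \forall e \near 0^'+, (ocell K1 `&` ocell K2) (x + e *: w).
  by near=> e; split; near: e.
rewrite dis => H; have := @filter_ex _ _ _ _ H.
by move=> [].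
Unshelve. all: by end_near.
Qed.

Lemma facet_dist_sub K F x y :
  facet_dist K F y = facet_dist K F x + dot (outward_normal K F) (y - x).
Proof. by rewrite /facet_dist -dotDr [in RHS]addrC subrKA. Qed.

Lemma facet_dist_parallel K F G x y : outward_normal K F = outward_normal K G ->
  facet_dist K F x = facet_dist K G x -> facet_dist K F y = facet_dist K G y.
Proof.
by move=> n Ex; rewrite [LHS](facet_dist_sub K F x) n Ex -facet_dist_sub.
Qed.

Lemma near_open_facet K G x w : valid_cell K -> G \in facets K ->
  open_facet K G x -> dot (outward_normal K G) w < 0 ->
  \forall e \near 0^'+, ocell K (x + e *: w).
Proof.
move=> vK GK /(open_facet_dist vK GK)[Gx HG] nw; apply: near_ocell => // H HK.
have [->|HnG] := eqVneq H G; first by right.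
by left; exact: HG.
Qed.

(** Off the null set of [transversal_null], the facets of [K2] through the point are parallel to
    [F]. The direction [- outward_normal K1 F] enters [K1]; if no facet of [K2] there had the
    opposite normal, it would enter [K2] as well. The facet [G] so found is the only one through the
    point: another with the normal of [F] would leave no room for the barycenter of [K2], and
    another with the normal of [G] would have the open facet [G] in its plane. *)
Lemma shared_face K1 K2 F : valid_cell K1 -> valid_cell K2 ->
  ocell K1 `&` ocell K2 = set0 -> F \in facets K1 ->
  exists N : set2 R, [/\ measurable N, @leb2 R N = 0%E &
    forall t, ~ N t -> ref_facet (cshape K1) t -> ccell K2 (facet_map F t) ->
    exists G, [/\ G \in facets K2, outward_normal K2 G = - outward_normal K1 F
      & open_facet K2 G (facet_map F t)]].
Proof.
move=> v1 v2 dis FK; have [N [mN N0 HN]] := transversal_null K2 F.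
exists N; split => // t nt Kt /(ccellP _ v2) K2x; set x := facet_map F t.
have fx : open_facet K1 F x by exists t.
have n1 := dot_outward_normal v1 FK.
have par G : G \in facets K2 -> facet_dist K2 G x = 0 ->
    outward_normal K2 G = outward_normal K1 F \/
    outward_normal K2 G = - outward_normal K1 F.
  move=> GK Gx; have [h1 h2] := HN t nt G GK Gx.
  exact: normal_unique (dot_outward_normal v2 GK) h1 h2.
have inK1 : \forall e \near 0^'+, ocell K1 (x + e *: - outward_normal K1 F).
  by apply: near_open_facet fx _ => //; rewrite dotNr n1 oppr_lt0.
have [G [GK Gx Gn]] : exists G, [/\ G \in facets K2, facet_dist K2 G x = 0 &
    outward_normal K2 G = - outward_normal K1 F].
  apply: contrapT => nG; apply: (disjoint_near dis inK1).
  apply: near_ocell => // G GK; have := K2x G GK.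
  rewrite -/x le_eqVlt => /predU1P[Gx|]; last by left.
  right; split => //; have [->|Gn] := par G GK Gx.
    by rewrite dotNr n1 oppr_lt0.
  by exfalso; apply: nG; exists G.
exists G; split => //; apply/(open_facetP _ v2 GK); split => // H HK HG.
have := K2x H HK; rewrite -/x le_eqVlt => /predU1P[Hx|//].
have [Hn|Hn] := par H HK Hx.
  have b := barycenter_ocell v2.
  have hb := (ocellP _ v2).1 b H HK; have gb := (ocellP _ v2).1 b G GK.
  have E J : facet_dist K2 J x = 0 -> facet_dist K2 J (barycenter K2)
      = dot (outward_normal K2 J) (barycenter K2 - x).
    by move=> Jx; rewrite (facet_dist_sub K2 J x) Jx add0r.
  by move: hb gb; rewrite !E// Hn Gn dotNl; lra.
have [s Ks] := ref_facet_neq0 R (cshape K2).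
have Gs : open_facet K2 G (facet_map G s) by exists s.
have [g0 /(_ H HK HG)] := open_facet_dist v2 GK Gs.
rewrite (@facet_dist_parallel K2 H G x); [|by rewrite Hn Gn|by rewrite Hx Gx].
by rewrite g0 ltxx.
Qed.

Lemma facet_coord_facet_map F G t : facet_coord G (facet_map F t) =
  (dot (cross (fedge1 F) (fedge2 G)) (facet_dir G) / dot (facet_dir G) (facet_dir G) * t.1
   + dot (cross (fedge2 F) (fedge2 G)) (facet_dir G) / dot (facet_dir G) (facet_dir G) * t.2
   + (facet_coord G (forg F)).1,
   dot (cross (fedge1 G) (fedge1 F)) (facet_dir G) / dot (facet_dir G) (facet_dir G) * t.1
   + dot (cross (fedge1 G) (fedge2 F)) (facet_dir G) / dot (facet_dir G) (facet_dir G) * t.2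
   + (facet_coord G (forg F)).2).
Proof.
rewrite /facet_coord /=; set k := (dot (facet_dir G) (facet_dir G))^-1.
set n := facet_dir G.
by congr pair; rewrite /facet_map /dot /cross !coordE; ring.
Qed.

(* Both sides are the surface integral of [g] over the common part of two
   coplanar facets. *)
Lemma facet_change_of_variables K1 K2 F G (g : R3 R -> R) :
  valid_cell K1 -> valid_cell K2 -> F \in facets K1 -> G \in facets K2 ->
  outward_normal K2 G = - outward_normal K1 F ->
  bmeas (ref_facet (cshape K2) : set2 R) (g \o facet_map G) ->
  enorm (facet_dir F) * \int[@leb2 R]_(t in ref_facet (cshape K1) `&`
      facet_map F @^-1` open_facet K2 G) g (facet_map F t) =
  enorm (facet_dir G) * \int[@leb2 R]_(t in ref_facet (cshape K2) `&`
      facet_map G @^-1` open_facet K1 F) g (facet_map G t).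
Proof.
move=> v1 v2 FK GK Gn bg.
have [[x0 Fx0 Gx0]|no] := pselect (exists2 x, open_facet K1 F x & open_facet K2 G x); last first.
  rewrite [X in Rintegral _ X _](_ : _ = set0); last first.
    apply/seteqP; split => // t [/= Kt Gt]; apply: no.
    by exists (facet_map F t) => //; exists t.
  rewrite [X in _ = _ * Rintegral _ X _](_ : _ = set0); last first.
    apply/seteqP; split => // t [/= Kt Ft]; apply: no.
    by exists (facet_map G t) => //; exists t.
  by rewrite !Rintegral_set0 !mulr0.
have dF := facet_dir_neq0 v1 FK; have dG := facet_dir_neq0 v2 GK.
have dG2 := facet_dot_neq0 dG.
(* The common point [x0] makes the two parallel planes coincide. *)
have plane t : dot (facet_dir G) (facet_map F t - forg G) = 0.
  apply: (facet_dist_eq0 v2 GK).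
  have [e1 _] := open_facet_dist v1 FK Fx0; have [e2 _] := open_facet_dist v2 GK Gx0.
  rewrite (facet_dist_sub K2 G x0) e2 Gn dotNl add0r.
  apply/eqP; rewrite oppr_eq0; apply/eqP.
  have := facet_dist_sub K1 F x0 (facet_map F t); rewrite e1 add0r => <-.
  rewrite /facet_dist /outward_normal dotZl.
  have -> : dot (facet_dir F) (facet_map F t - forg F) = 0.
    by rewrite /facet_map /facet_dir /dot /cross !coordE; ring.
  by rewrite mulr0.
pose S t := facet_coord G (facet_map F t).
have SE t : facet_map G (S t) = facet_map F t by exact: facet_coordK.
pose q := dot (facet_dir G) (facet_dir G).
pose a := dot (cross (fedge1 F) (fedge2 G)) (facet_dir G) / q.
pose b := dot (cross (fedge2 F) (fedge2 G)) (facet_dir G) / q.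
pose c := dot (cross (fedge1 G) (fedge1 F)) (facet_dir G) / q.
pose d := dot (cross (fedge1 G) (fedge2 F)) (facet_dir G) / q.
have SE' t : S t = (a * t.1 + b * t.2 + (facet_coord G (forg F)).1,
                   c * t.1 + d * t.2 + (facet_coord G (forg F)).2).
  exact: facet_coord_facet_map.
have S00 := SE (0, 0); rewrite SE' /facet_map /= in S00.
have E1 : fedge1 F = a *: fedge1 G + c *: fedge2 G.
  have S10 := SE (1, 0); rewrite SE' /facet_map /= in S10.
  apply: R3P; [have := congr1 c1 S10; have := congr1 c1 S00
              |have := congr1 c2 S10; have := congr1 c2 S00
              |have := congr1 c3 S10; have := congr1 c3 S00];
  rewrite !coordE; lra.
have E2 : fedge2 F = b *: fedge1 G + d *: fedge2 G.
  have S01 := SE (0, 1); rewrite SE' /facet_map /= in S01.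
  apply: R3P; [have := congr1 c1 S01; have := congr1 c1 S00
              |have := congr1 c2 S01; have := congr1 c2 S00
              |have := congr1 c3 S01; have := congr1 c3 S00];
  rewrite !coordE; lra.
(* [D] is the Jacobian determinant of [S] and, by [dirE], its absolute value is the ratio of the two
   surface elements, so that these factors cancel. *)
pose D := a * d - b * c.
have dirE : facet_dir F = D *: facet_dir G.
  by apply: R3P; rewrite /facet_dir E1 E2 /D /cross !coordE; ring.
have D0 : D != 0 by apply: contra_neq dF => D0; rewrite dirE D0 scale0r.
have enE : enorm (facet_dir F) = `|D| * enorm (facet_dir G).
  by rewrite dirE /enorm dotZl dotZr mulrA -expr2 sqrtrM ?sqr_ge0// sqrtr_sqr.
have SS : scales_measure (@leb2 R) `|D|^-1 (S : mR2 R -> mR2 R).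
  apply: eq_scales_measure (scales_measure_affine2 (facet_coord G (forg F)).1
    (facet_coord G (forg F)).2 D0); [by []|].
  by move=> t; exact: (esym (SE' t)).
pose A : set2 R := ref_facet (cshape K2) `&` facet_map G @^-1` open_facet K1 F.
have mr := @measurable_ref_facet R (cshape K2).
have mA : measurable A.
  apply: measurableI => //; apply: measurable_facet_preimage.
  exact: measurable_open_facet.
have fA : (@leb2 R A < +oo)%E.
  apply: le_lt_trans (ref_facet_lty R (cshape K2)); apply: le_measure; rewrite ?inE//.
  exact: subIsetl.
have D1 : 0 <= `|D|^-1 by rewrite invr_ge0.
have bA : bmeas A (g \o facet_map G).
  by apply: bmeasS bg => //; exact: subIsetl.
have := scales_measure_Rintegral D1 SS mA fA bA.
have -> : S @^-1` A = ref_facet (cshape K1) `&` facet_map F @^-1` open_facet K2 G.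
  apply/seteqP; split => t.
    move=> [KS FS]; have [s Ks] : open_facet K1 F (facet_map F t) by rewrite -SE.
    move=> /(can_inj (facet_mapK dF)) st.
    by split; [rewrite -st | exists (S t)].
  move=> [Kt [s Ks Gs]]; have St : S t = s.
    by apply: (can_inj (facet_mapK dG)); rewrite SE.
  split; first by rewrite /= St.
  by rewrite /= SE; exists t.
have -> : \int[@leb2 R]_(x in ref_facet (cshape K1) `&` facet_map F @^-1` open_facet K2 G)
    (g \o facet_map G) (S x) = \int[@leb2 R]_(x in ref_facet (cshape K1) `&`
    facet_map F @^-1` open_facet K2 G) g (facet_map F x).
  by apply: eq_Rintegral => t _; rewrite /= SE.
by move=> ->; rewrite enE (mulrC `|D|) -mulrA (mulrA `|D|) mulfV ?normr_eq0// mul1r.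
Qed.

End SharedFaces.

(** * Boundary integrals seen from both sides of a face *)

Section BoundaryIntegrals.
Variable R : realType.
Implicit Types (K : cell R) (F G : facet R) (x y w n : R3 R) (t : R * R).

(** Required on all triangles and parallelograms at once, so that it does not depend on an element
    and is stable under translation. *)
Definition surf_bmeas (g : R3 R -> R) := forall sh F,
  bmeas (ref_facet sh : set2 R) (g \o facet_map F).

Lemma facet_part K F (S : set3 R) (g : R3 R -> R) :
  measurable S -> surf_bmeas g ->
  let A : set2 R := ref_facet (cshape K) `&` facet_map F @^-1` S in
  [/\ measurable A, (@leb2 R A < +oo)%E & bmeas A (fun t => g (facet_map F t))].
Proof.
move=> mS bg A; have mr := @measurable_ref_facet R (cshape K).
have mA : measurable A by apply: measurableI => //; exact: measurable_facet_preimage.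
split => //; last by apply: (bmeasS mr _ (bg (cshape K) F)); exact: subIsetl.
apply: le_lt_trans (ref_facet_lty R (cshape K)).
by apply: le_measure; rewrite ?inE//; exact: subIsetl.
Qed.

Lemma bd_intD K (S : set3 R) h1 h2 : measurable S ->
  (forall n, surf_bmeas (h1 n)) -> (forall n, surf_bmeas (h2 n)) ->
  bd_int K S (fun n x => h1 n x + h2 n x) = bd_int K S h1 + bd_int K S h2.
Proof.
move=> mS b1 b2; rewrite /bd_int -big_split /=; apply: eq_bigr => F _.
have [mA lA bA1] := facet_part K F mS (b1 (outward_normal K F)).
have [_ _ bA2] := facet_part K F mS (b2 (outward_normal K F)).
by rewrite -mulrDr bRintegralD.
Qed.

Lemma bd_intZ K (S : set3 R) k h : measurable S ->
  (forall n, surf_bmeas (h n)) ->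
  bd_int K S (fun n x => k * h n x) = k * bd_int K S h.
Proof.
move=> mS bh; rewrite /bd_int mulr_sumr; apply: eq_bigr => F _.
have [mA lA bA] := facet_part K F mS (bh (outward_normal K F)).
by rewrite mulrCA bRintegralZ.
Qed.

Lemma bd_intN K (S : set3 R) h : measurable S ->
  (forall n, surf_bmeas (h n)) ->
  bd_int K S (fun n x => - h n x) = - bd_int K S h.
Proof.
move=> mS bh; rewrite -mulN1r -bd_intZ//; congr bd_int.
by apply/funext => n; apply/funext => x; rewrite mulN1r.
Qed.

Lemma eq_bd_int K (S : set (R3 R)) h h' : valid_cell K ->
  (forall n x, S x -> ccell K x -> h n x = h' n x) ->
  bd_int K S h = bd_int K S h'.
Proof.
move=> vK hh'; rewrite /bd_int !big_seq; apply: eq_bigr => F FK; congr (_ * _).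
apply: eq_RintegralP => t [Kt St]; apply: hh' => //.
by apply: (open_facet_ccell vK FK); exists t.
Qed.

(** By [shared_face], almost every point of [F] in [K2] lies on exactly one open facet of [K2], and
    that facet has the opposite normal; only such pairs contribute. *)
Lemma bd_int_split K1 K2 h : valid_cell K1 -> valid_cell K2 ->
  ocell K1 `&` ocell K2 = set0 -> (forall n, surf_bmeas (h n)) ->
  bd_int K1 (ccell K2) h = \sum_(F <- facets K1)
    \sum_(G <- facets K2 | outward_normal K2 G == - outward_normal K1 F)
      enorm (facet_dir F) * \int[@leb2 R]_(t in ref_facet (cshape K1) `&`
        facet_map F @^-1` open_facet K2 G) h (outward_normal K1 F) (facet_map F t).
Proof.
move=> v1 v2 dis bh; rewrite /bd_int !big_seq; apply: eq_bigr => F FK.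
rewrite -mulr_sumr; congr (_ * _).
have [N [mN N0 HN]] := shared_face v1 v2 dis FK.
rewrite [RHS]big_seq_cond.
apply: (Rintegral_split (N := N)) => //.
- exact: measurable_ref_facet.
- exact: ref_facet_lty.
- exact: bh.
- by apply: measurable_facet_preimage; exact: measurable_ccell.
- move=> G /andP[GK _].
  by apply: measurable_facet_preimage; exact: measurable_open_facet.
move=> t Kt nt; rewrite -big_seq_cond.
have [Ct|nCt] := pselect (ccell K2 (facet_map F t)); last first.
  rewrite indicE memNset// big_seq_cond big1// => G /andP[GK _].
  by rewrite indicE memNset// => Gt; apply: nCt; exact: open_facet_ccell Gt.
have [G [GK Gn Gt]] := HN t nt Kt Ct.
rewrite indicE mem_set// big_mkcond (bigD1_seq G) ?uniq_facets//= Gn eqxx.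
rewrite indicE mem_set// big_seq_cond big1 ?addr0// => H /andP[HK HG].
case: ifP => // _; rewrite indicE memNset// => Ht.
by move/eqP: HG; apply; exact: open_facet_uniq Ht Gt.
Qed.

(** Both integrals are sums over pairs of facets with opposite normals: the two sums are exchanged,
    and each term changes from one parametrization to the other. [h2] is [h1] written with the
    normal of the other side. *)
Lemma bd_int_sym K1 K2 h1 h2 : valid_cell K1 -> valid_cell K2 ->
  ocell K1 `&` ocell K2 = set0 -> (forall n, surf_bmeas (h1 n)) ->
  (forall n x, h1 n x = h2 (- n) x) ->
  bd_int K1 (ccell K2) h1 = bd_int K2 (ccell K1) h2.
Proof.
move=> v1 v2 dis bh1 h12.
have h21 n x : h2 n x = h1 (- n) x by rewrite h12 opprK.
have bh2 n : surf_bmeas (h2 n).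
  by rewrite (_ : h2 n = h1 (- n))//; apply/funext.
rewrite !bd_int_split//; last by rewrite setIC.
rewrite (exchange_big_dep xpredT)//= big_seq [RHS]big_seq.
apply: eq_bigr => G GK.
rewrite big_seq_cond [RHS]big_seq_cond.
apply: eq_big => [F|F /andP[FK /eqP Gn]].
  by rewrite eq_sym eqr_oppLR.
under [in RHS]eq_Rintegral do rewrite h21 Gn opprK.
exact: (facet_change_of_variables v1 v2 FK GK Gn (bh1 (outward_normal K1 F) _ G)).
Qed.

(** A periodic image is again a cell, so that results on two disjoint cells apply to periodic
    neighbours. *)
Definition shift_cell K (o : R3 R) : cell R :=
  Cell (cshape K) (org K + o) (edge1 K) (edge2 K) (edge3 K).

Lemma valid_shift_cell K o : valid_cell K -> valid_cell (shift_cell K o).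
Proof. by []. Qed.

Lemma cell_map_shift K o (t : R3 R) : cell_map (shift_cell K o) t = cell_map K t + o.
Proof. by rewrite /cell_map /= addrAC. Qed.

Lemma ocell_shift K o x : ocell (shift_cell K o) x <-> ocell K (x - o).
Proof.
split=> [[t Kt <-]|[t Kt tE]].
  by rewrite cell_map_shift addrK; exists t.
by exists t => //; rewrite cell_map_shift tE subrK.
Qed.

Lemma ccell_shift K o x : ccell (shift_cell K o) x <-> ccell K (x - o).
Proof.
split=> [[t Kt <-]|[t Kt tE]].
  by rewrite cell_map_shift addrK; exists t.
by exists t => //; rewrite cell_map_shift tE subrK.
Qed.

Lemma barycenter_shift K o : barycenter (shift_cell K o) = barycenter K + o.
Proof. by rewrite /barycenter /=; case: (cshape K); rewrite addrAC. Qed.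

Definition shift_facet (o : R3 R) F : facet R := (forg F + o, fedge1 F, fedge2 F).

Lemma facets_shift K o :
  facets (shift_cell K o) = [seq shift_facet o F | F <- facets K].
Proof.
rewrite /facets /=; case: (cshape K) => /=; rewrite /shift_facet /forg /fedge1 /fedge2 /=.
  by rewrite !(addrAC (org K) o).
by rewrite (addrAC (org K) o).
Qed.

Lemma facet_map_shift F o t : facet_map (shift_facet o F) t = facet_map F t + o.
Proof. by rewrite /facet_map /= addrAC. Qed.

Lemma outward_normal_shift K F o :
  outward_normal (shift_cell K o) (shift_facet o F) = outward_normal K F.
Proof.
rewrite /outward_normal barycenter_shift.
have -> : forg (shift_facet o F) - (barycenter K + o) = forg F - barycenter K.
  by rewrite /forg /= opprD addrACA subrr addr0.
by [].
Qed.

Lemma bd_int_shift K o S h : bd_int (shift_cell K o) S h =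
  bd_int K [set x | S (x + o)] (fun n x => h n (x + o)).
Proof.
rewrite /bd_int facets_shift big_map; apply: eq_bigr => F _.
rewrite -[facet_dir (shift_facet o F)]/(facet_dir F); congr (_ * _).
rewrite outward_normal_shift.
have -> : facet_map (shift_facet o F) @^-1` S = facet_map F @^-1` [set x | S (x + o)].
  by apply/seteqP; split => t; rewrite /= facet_map_shift.
by apply: eq_Rintegral => t _; rewrite facet_map_shift.
Qed.

Lemma surf_bmeas_shift g o : surf_bmeas g -> surf_bmeas (fun x => g (x + o)).
Proof.
move=> bg sh F; have := bg sh (shift_facet o F).
by apply: eq_bmeas => t _ /=; rewrite facet_map_shift.
Qed.

End BoundaryIntegrals.

(** * Faces of the periodic mesh and of the velocity mesh *)

Section MeshFaces.
Variables (R : realType) (M : dg_mesh R).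
Hypothesis vM : valid_mesh M.

Local Notation xc := (@xcell R M).
Local Notation vc := (@vcell R M).

Definition xshift (p : xidx M * Defs.shift) := shift_cell (xc p.1) (offset M p.2).

Lemma valid_xcell K : valid_cell (xc K).
Proof. by case: vM => _ [+ _ _] _ _; exact. Qed.
Lemma valid_vcell L : valid_cell (vc L).
Proof. by case: vM => _ _ [+ _ _] _; exact. Qed.
Lemma valid_xshift p : valid_cell (xshift p).
Proof. exact/valid_shift_cell/valid_xcell. Qed.

Lemma ccell_xshift p : [set x | ccell (xc p.1) (x - offset M p.2)] = ccell (xshift p).
Proof. by apply/seteqP; split => x; rewrite /= ccell_shift. Qed.

Lemma ocell_ccell (K : cell R) : ocell K `<=` ccell K.
Proof.
move=> _ [t Kt <-]; exists t => //; move: Kt; case: (cshape K) => /=.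
  by move=> [/andP[? ?] /andP[? ?] /andP[? ?]]; split; apply/andP; split; exact: ltW.
by move=> [? ? ? ?]; split; exact: ltW.
Qed.

Lemma ccell_omx K : ccell (xc K) `<=` omx M.
Proof. by case: vM => _ [_ -> _] _ _ x Kx; exists K. Qed.

Lemma opp_shiftK : involutive opp_shift.
Proof. by move=> s; apply/ffunP => i; rewrite !ffunE rev_ordK. Qed.

Lemma opp_no_shift : opp_shift no_shift = no_shift.
Proof. by apply/ffunP => i; rewrite !ffunE; apply: val_inj; rewrite /= inordK. Qed.

Definition zshift (s : Defs.shift) (i : nat) : R := (s (inord i) : nat)%:R - 1.

Lemma offsetE s : offset M s = (zshift s 0 * c1 (xhi M - xlo M),
  zshift s 1 * c2 (xhi M - xlo M), zshift s 2 * c3 (xhi M - xlo M)).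
Proof. by []. Qed.

Lemma offset_opp s : offset M (opp_shift s) = - offset M s.
Proof.
have E i : zshift (opp_shift s) i = - zshift s i.
  rewrite /zshift ffunE /=; case: (s (inord i)) => -[|[|[|//]]] /= _;
  by rewrite ?subSS ?subn0; ring.
by rewrite !offsetE !E; apply: R3P; rewrite !coordE; ring.
Qed.

Lemma offset_no_shift : offset M no_shift = 0.
Proof.
have E i : zshift no_shift i = 0 by rewrite /zshift ffunE inordK// subrr.
by rewrite !offsetE !E !mul0r.
Qed.

Lemma xshift_no_shift K : xshift (K, no_shift) = xc K.
Proof.
by rewrite /xshift /= offset_no_shift /shift_cell addr0; case: (xc K).
Qed.

Lemma box_gt0 : [/\ 0 < c1 (xhi M - xlo M), 0 < c2 (xhi M - xlo M)
  & 0 < c3 (xhi M - xlo M)].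
Proof. by case: vM => -[h1 h2 h3] _ _ _; rewrite !coordE; split; lra. Qed.

(** From an interior point one can move a little along both directions of each axis inside the
    closed box, so its inequalities are strict. *)
Lemma ocell_box K x : ocell (xc K) x ->
  [/\ c1 (xlo M) < c1 x < c1 (xhi M), c2 (xlo M) < c2 x < c2 (xhi M)
    & c3 (xlo M) < c3 x < c3 (xhi M)].
Proof.
move=> Kx; have near w : exists2 e, 0 < e & omx M (x + e *: w).
  have : \forall e \near 0^'+, 0 < e /\ ocell (xc K) (x + e *: w).
    near=> e; split; first by near: e; exact: nbhs_right_gt.
    near: e; apply: (near_ocell (valid_xcell K)) => F FK; left.
    exact: ((ocellP _ (valid_xcell K)).1 Kx).
  move=> /filter_ex[e [e0 Ke]]; exists e => //.
  by apply: (@ccell_omx K); exact: ocell_ccell.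
split; apply/andP; split.
- have [e e0 [+ _ _]] := near (- 1, 0, 0); rewrite !coordE => /andP[? ?]; lra.
- have [e e0 [+ _ _]] := near (1, 0, 0); rewrite !coordE => /andP[? ?]; lra.
- have [e e0 [_ + _]] := near (0, - 1, 0); rewrite !coordE => /andP[? ?]; lra.
- have [e e0 [_ + _]] := near (0, 1, 0); rewrite !coordE => /andP[? ?]; lra.
- have [e e0 [_ _ +]] := near (0, 0, - 1); rewrite !coordE => /andP[? ?]; lra.
- have [e e0 [_ _ +]] := near (0, 0, 1); rewrite !coordE => /andP[? ?]; lra.
Unshelve. all: by end_near.
Qed.

Lemma zshift_neq (s s' : Defs.shift) i : s (inord i) != s' (inord i) ->
  zshift s i + 1 <= zshift s' i \/ zshift s' i + 1 <= zshift s i.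
Proof.
rewrite -val_eqE /= neq_ltn /zshift => /orP[h|h]; [left|right];
by rewrite -(ler_nat R) -natr1 in h; lra.
Qed.

(** For equal shifts this is the partition property. Different shifts differ by at least one period
    in some coordinate, while open elements stay strictly inside one period of the box. *)
Lemma xshift_disjoint p q : p != q -> ocell (xshift p) `&` ocell (xshift q) = set0.
Proof.
case: p q => [K s] [K' s'] pq; apply/seteqP; split => // x [].
move=> /ocell_shift /= Kx /ocell_shift /= Kx'.
have [ss'|ss'] := eqVneq s s'.
  have KK' : K != K' by apply: contra_neq pq => ->; rewrite ss'.
  case: vM => _ [_ _ /(_ K K' KK') dis] _ _.
  have : (ocell (xc K) `&` ocell (xc K')) (x - offset M s).
    by split => //; rewrite ss'.
  by rewrite dis.
have [h1 h2 h3] := ocell_box Kx; have [h1' h2' h3'] := ocell_box Kx'.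
have [l1 l2 l3] := box_gt0.
have /existsP[i] : [exists i, s i != s' i].
  rewrite -negb_forall; apply: contra_neqN ss' => /forallP H.
  by apply/ffunP => i; exact/eqP.
have far (z z' l lo hi b : R) : l = hi - lo -> 0 < l -> z + 1 <= z' ->
    lo < b - z * l < hi -> lo < b - z' * l < hi -> False.
  move=> -> l0 zz' /andP[? ?] /andP[? ?].
  have : 0 <= (z' - (z + 1)) * (hi - lo) by apply: mulr_ge0; lra.
  by rewrite mulrBl mulrDl; lra.
have e1 u : c1 (x - offset M u) = c1 x - zshift u 0 * c1 (xhi M - xlo M) by [].
have e2 u : c2 (x - offset M u) = c2 x - zshift u 1 * c2 (xhi M - xlo M) by [].
have e3 u : c3 (x - offset M u) = c3 x - zshift u 2 * c3 (xhi M - xlo M) by [].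
rewrite !(e1, e2, e3) in h1 h2 h3 h1' h2' h3'.
elim/ord3_case: i => /zshift_neq[] zz'.
- exact: (far _ _ _ _ _ _ erefl l1 zz' h1 h1').
- exact: (far _ _ _ _ _ _ erefl l1 zz' h1' h1).
- exact: (far _ _ _ _ _ _ erefl l2 zz' h2 h2').
- exact: (far _ _ _ _ _ _ erefl l2 zz' h2' h2).
- exact: (far _ _ _ _ _ _ erefl l3 zz' h3 h3').
- exact: (far _ _ _ _ _ _ erefl l3 zz' h3' h3).
Qed.

(** A step shorter than a period leaves the box by less than one period in each coordinate, so a
    translation by -1, 0 or 1 periods per coordinate brings the point back. *)
Lemma near_cover x w : omx M x ->
  \forall e \near 0^'+, exists p, ccell (xshift p) (x + e *: w).
Proof.
move=> [h1 h2 h3]; have [l1 l2 l3] := box_gt0.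
have small (b l : R) : 0 < l -> \forall e \near 0^'+, - l < e * b < l.
  move=> l0; near=> e; apply/andP; split.
    suff : - l + e * - b < 0 by lra.
    by near: e; apply: near_lt0; rewrite oppr_lt0.
  suff : - l + e * b < 0 by lra.
  by near: e; apply: near_lt0; rewrite oppr_lt0.
near=> e.
have : - c1 (xhi M - xlo M) < e * c1 w < c1 (xhi M - xlo M) by near: e; exact: small.
have : - c2 (xhi M - xlo M) < e * c2 w < c2 (xhi M - xlo M) by near: e; exact: small.
have : - c3 (xhi M - xlo M) < e * c3 w < c3 (xhi M - xlo M) by near: e; exact: small.
set y := x + e *: w; move=> /andP[e3 e3'] /andP[e2 e2'] /andP[e1 e1'].
have pick (lo hi b l : R) : l = hi - lo -> lo - l <= b <= hi + l ->
    exists j : 'I_3, lo <= b - ((j : nat)%:R - 1) * l <= hi.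
  move=> lE /andP[b1 b2]; have [blo|blo] := ltP b lo.
    by exists (inord 0); rewrite inordK//; apply/andP; split; lra.
  have [bhi|bhi] := ltP hi b.
    by exists (inord 2); rewrite inordK//; apply/andP; split; lra.
  by exists (inord 1); rewrite inordK//; apply/andP; split; lra.
have [||j1 H1] := @pick (c1 (xlo M)) (c1 (xhi M)) (c1 y) (c1 (xhi M - xlo M)) => //.
  by rewrite /y !coordE; move: h1 e1 e1'; rewrite !coordE => /andP[? ?] *; apply/andP; split; lra.
have [||j2 H2] := @pick (c2 (xlo M)) (c2 (xhi M)) (c2 y) (c2 (xhi M - xlo M)) => //.
  by rewrite /y !coordE; move: h2 e2 e2'; rewrite !coordE => /andP[? ?] *; apply/andP; split; lra.
have [||j3 H3] := @pick (c3 (xlo M)) (c3 (xhi M)) (c3 y) (c3 (xhi M - xlo M)) => //.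
  by rewrite /y !coordE; move: h3 e3 e3'; rewrite !coordE => /andP[? ?] *; apply/andP; split; lra.
pose s : Defs.shift := [ffun i : 'I_3 => nth j1 [:: j1; j2; j3] i].
have : omx M (y - offset M s).
  by rewrite offsetE /zshift /s !ffunE !inordK.
case: vM => _ [_ -> _] _ _ [K _ Ky].
by exists (K, s); exact: (ccell_shift _ _ _).2 Ky.
Unshelve. all: by end_near.
Qed.

Lemma x_facesE K h : x_faces K h = \sum_(p | p != (K, no_shift))
  bd_int (xc K) (ccell (xshift p)) (h p.1 p.2).
Proof.
rewrite /x_faces (pair_big_dep xpredT (fun K' s => (K', s) != (K, no_shift))).
by apply: eq_big => [[K' s]|[K' s] _] //=; rewrite -(ccell_xshift (K', s)).
Qed.

(** Green's formula produces integrals over the whole boundary of an element, the scheme sums over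
    faces; this identifies the two, since almost every boundary point belongs to exactly one
    neighbour or periodic image. *)
Lemma x_faces_cover K h : (forall n, surf_bmeas (h n)) ->
  x_faces K (fun _ _ => h) = bd_int (xc K) setT h.
Proof.
move=> bh; rewrite x_facesE /bd_int exchange_big /= big_seq [RHS]big_seq.
apply: eq_bigr => F FK; rewrite -mulr_sumr; congr (_ * _); apply/esym.
have vK := valid_xcell K.
pose opposite p x := exists G, [/\ G \in facets (xshift p),
  outward_normal (xshift p) G = - outward_normal (xc K) F & open_facet (xshift p) G x].
have [N [mN N0 HN]] : exists N : set2 R, [/\ measurable N, @leb2 R N = 0%E &
    forall t, ~ N t -> forall p, p \in enum [pred p | p != (K, no_shift)] ->
    ref_facet (cshape (xc K)) t -> ccell (xshift p) (facet_map F t) ->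
    opposite p (facet_map F t)].
  apply: null_all_seq => p; rewrite mem_enum inE => pK.
  apply: shared_face => //; first exact: valid_xshift.
  by rewrite -(xshift_no_shift K) xshift_disjoint// eq_sym.
apply: (Rintegral_split (N := N)) => //.
- exact: measurable_ref_facet.
- exact: ref_facet_lty.
- exact: bh.
- by apply: measurable_facet_preimage; exact: measurableT.
- move=> p _; apply: measurable_facet_preimage.
  exact: (measurable_ccell (valid_xshift p)).
move=> t Kt nt; rewrite indicE mem_set//; set x := facet_map F t.
have fx : open_facet (xc K) F x by exists t.
have n1 := dot_outward_normal vK FK.
(* Existence: if no other image contained [x], the points just beyond [F] along its normal would lie
   in no image at all. *)
have [p pK px] : exists2 p, p != (K, no_shift) & ccell (xshift p) x.
  apply: contrapT => no.
  have xM : omx M x by apply: (@ccell_omx K); exact: (open_facet_ccell vK FK).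
  have := near_cover (outward_normal (xc K) F) xM.
  have : \forall e \near 0^'+, forall p, p \in enum predT ->
      ~ ccell (xshift p) (x + e *: outward_normal (xc K) F).
    apply: near_all_seq => p _.
    have [->|pK] := eqVneq p (K, no_shift).
      rewrite xshift_no_shift; apply: near_not_ccell => //; exists F => //; right.
      by rewrite n1; split => //; case: (open_facet_dist vK FK fx).
    have vp := valid_xshift p; apply: near_not_ccell => //.
    apply: contrapT => nF; apply: no; exists p => //; apply/(ccellP _ vp) => G Gp.
    by rewrite leNgt; apply/negP => Gx; apply: nF; exists G => //; left.
  move=> H1 H2; have : \forall e \near (0:R)^'+, False.
    near=> e; have [q] : exists p, ccell (xshift p) (x + e *: outward_normal (xc K) F).
      by near: e.
    have : forall p, p \in enum predT ->
      ~ ccell (xshift p) (x + e *: outward_normal (xc K) F) by near: e.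
    by move=> /(_ q); rewrite mem_enum => /(_ isT).
  by move=> /filter_ex[].
rewrite (bigD1 p)//= indicE mem_set// big1 ?addr0// => q /andP[qK qp].
rewrite indicE memNset// => qx.
have [G [Gp Gn Gx]] : opposite p x by apply: HN => //; rewrite mem_enum.
have [H [Hq Hn Hx]] : opposite q x by apply: HN => //; rewrite mem_enum.
(* Uniqueness: the outward normal of [F] would lead into both [p] and [q]. *)
apply: (@disjoint_near R (xshift p) (xshift q) x (outward_normal (xc K) F)).
- by rewrite xshift_disjoint// eq_sym.
- by apply: near_open_facet Gx _ => //; [exact: valid_xshift|rewrite Gn dotNl n1 oppr_lt0].
- by apply: near_open_facet Hx _ => //; [exact: valid_xshift|rewrite Hn dotNl n1 oppr_lt0].
Unshelve. all: by end_near.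
Qed.

Lemma sum_involution_anti (T : finType) (P : pred T) (f : T -> T) (b : T -> R) :
  involutive f -> (forall x, P (f x) = P x) ->
  (forall x, P x -> b (f x) = - b x) -> \sum_(x | P x) b x = 0.
Proof.
move=> fK Pf bf; have : \sum_(x | P x) b x = - \sum_(x | P x) b x.
  rewrite [LHS](reindex_inj (inv_inj fK)) -sumrN.
  by apply: eq_big => [x|x]; rewrite Pf//; exact: bf.
by move=> h; lra.
Qed.

(** [h] contains traces, which are known only on closed cells; [g] is its polynomial counterpart,
    bounded and measurable on every facet. The involution [f] passes to the other side of a face,
    reversing the shift, and changes the sign of the face integral. *)
Lemma x_faces_sum0 (h g : xidx M -> xidx M -> Defs.shift -> R3 R -> R3 R -> R) :
  (forall K K' s n, surf_bmeas (g K K' s n)) ->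
  (forall K K' s n x, ccell (xc K) x -> ccell (xc K') (x - offset M s) ->
    h K K' s n x = g K K' s n x) ->
  (forall K K' s n x, (K', s) != (K, no_shift) ->
    g K' K (opp_shift s) (- n) (x - offset M s) = - g K K' s n x) ->
  \sum_K x_faces K (h K) = 0.
Proof.
move=> bg hg gN.
pose b (q : xidx M * (xidx M * Defs.shift)) :=
  bd_int (xc q.1) (ccell (xshift q.2)) (g q.1 q.2.1 q.2.2).
pose f (q : xidx M * (xidx M * Defs.shift)) := (q.2.1, (q.1, opp_shift q.2.2)).
transitivity (\sum_(q | q.2 != (q.1, no_shift)) b q).
  rewrite -(pair_big_dep xpredT (fun K p => p != (K, no_shift)) (fun K p => b (K, p))).
  apply: eq_bigr => K _; rewrite x_facesE; apply: eq_bigr => p _.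
  apply: eq_bd_int; first exact: valid_xcell.
  by move=> n x /ccell_shift xp Kx; rewrite /= hg.
apply: (@sum_involution_anti _ _ f).
- by move=> [K [K' s]]; rewrite /f /= opp_shiftK.
- move=> [K [K' s]]; rewrite /f /= !xpair_eqE eq_sym; congr (~~ (_ && _)).
  by rewrite -(inj_eq (inv_inj opp_shiftK)) opp_shiftK opp_no_shift.
move=> [K [K' s]] /= neq; rewrite /b /f /=.
have -> : bd_int (xc K) (ccell (xshift (K', s))) (g K K' s) =
    bd_int (xc K') (ccell (xshift (K, opp_shift s)))
      (fun n x => g K K' s (- n) (x + offset M s)).
  rewrite (@bd_int_sym _ _ _ _ (fun n x => g K K' s (- n) x)).
  - rewrite bd_int_shift; congr bd_int; apply/seteqP.
    by split => x; rewrite /= ccell_shift offset_opp opprK.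
  - exact: valid_xcell.
  - exact: valid_xshift.
  - by rewrite -(xshift_no_shift K) xshift_disjoint// eq_sym.
  - exact: bg.
  - by move=> n x; rewrite opprK.
have -> : (fun n x => g K K' s (- n) (x + offset M s)) =
    (fun n x => - g K' K (opp_shift s) n x).
  apply/funext => n; apply/funext => x; apply/eqP; rewrite -eqr_oppLR; apply/eqP.
  by rewrite -gN// opprK addrK.
by rewrite (bd_intN _
  (measurable_ccell (valid_xshift (K, opp_shift s))) (bg K' K (opp_shift s))) opprK.
Qed.

Lemma v_faces_sum0 (h g : vidx M -> vidx M -> R3 R -> R3 R -> R) :
  (forall L L' n, surf_bmeas (g L L' n)) ->
  (forall L L' n x, ccell (vc L) x -> ccell (vc L') x -> h L L' n x = g L L' n x) ->
  (forall L L' n x, g L' L (- n) x = - g L L' n x) ->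
  \sum_L v_faces L (h L) = 0.
Proof.
move=> bg hg gN.
pose b (q : vidx M * vidx M) := bd_int (vc q.1) (ccell (vc q.2)) (g q.1 q.2).
pose f (q : vidx M * vidx M) := (q.2, q.1).
transitivity (\sum_(q | q.2 != q.1) b q).
  rewrite -(pair_big_dep xpredT (fun L L' => L' != L) (fun L L' => b (L, L'))).
  apply: eq_bigr => L _; apply: eq_bigr => L' _.
  apply: eq_bd_int; first exact: valid_vcell.
  by move=> n x xp Kx; rewrite /= hg.
apply: (@sum_involution_anti _ _ f) => [[L L']//|[L L']|[L L']] /=; first by rewrite eq_sym.
move=> neq; rewrite /b /f /=.
have dis : ocell (vc L) `&` ocell (vc L') = set0.
  by case: vM => _ _ [_ _ dis] _; apply: dis; rewrite eq_sym.
rewrite (@bd_int_sym _ (vc L) (vc L') _ (fun n x => g L L' (- n) x))//.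
- have -> : (fun n x => g L L' (- n) x) = (fun n x => - g L' L n x).
    by apply/funext => n; apply/funext => x; rewrite gN.
  by rewrite (bd_intN _ (measurable_ccell (valid_vcell L)) (bg L' L)) opprK.
- exact: valid_vcell.
- exact: valid_vcell.
- by move=> n x; rewrite opprK.
Qed.

End MeshFaces.

(** * Measure of cells and bounds for polynomials on them *)

Section CellMeasure.
Variable R : realType.
Implicit Types (K : cell R) (F : facet R) (p : mpoly.mpoly 3 R).

Lemma measurable_affine3 (a b c e : R) : measurable_fun setT
  (fun z : mR3 R => a * c1 z + b * c2 z + c * c3 z + e : mR R).
Proof.
apply: measurable_funD => //; apply: measurable_funD => //.
  by apply: measurable_funD; apply: measurable_funM => //;
    [exact: measurable_c1|exact: measurable_c2].
by apply: measurable_funM => //; exact: measurable_c3.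
Qed.

Lemma leb3_plane (a b c e : R) : (a, b, c) != (0 : R3 R) ->
  @leb3 R [set z : mR3 R | a * c1 z + b * c2 z + c * c3 z + e = 0] = 0%E.
Proof.
move=> abc0; set A := (X in leb3 X).
rewrite /leb3 /= /product_measure1.
have [c0|c0] := eqVneq c 0.
  have ab0 : (a != 0) || (b != 0).
    by rewrite -negb_and; apply: contra_neqN abc0 => /andP[/eqP -> /eqP ->]; rewrite c0.
  have AE : A = [set t : mR2 R | a * t.1 + b * t.2 + e = 0] `*` setT.
    apply/seteqP; split => -[[x y] z] /=; rewrite /A /= c0 /c1 /c2 /c3 /=.
      by move=> h; split => //; lra.
    by move=> [h _]; lra.
  transitivity ((@leb2 R \x leb1 R)%E A) => //.
  rewrite AE product_measure1E//; last by apply: measurable_eq0; exact: measurable_affine2.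
  by rewrite [X in (X * _)%E](_ : _ = 0%E) ?mul0e//; exact: leb2_line.
rewrite integral0_eq// => -[x y] _ /=.
have -> : xsection A (x, y) = [set (- e - a * x - b * y) / c].
  apply/seteqP; split => z; rewrite /xsection /A /=.
    move=> /set_mem; rewrite /c1 /c2 /c3 /= => h.
    by apply: (mulIf c0); rewrite divfK//; lra.
  by move=> ->; apply/mem_set; rewrite /c1 /c2 /c3 /=; field.
exact: lebesgue_measure_set1.
Qed.

(** The boundary lies in the finitely many planes of the facets. *)
Lemma ccell_null K : valid_cell K -> @leb3 R (ccell K `\` ocell K) = 0%E.
Proof.
move=> vK.
have [N [mN N0 HN]] : exists N : set3 R, [/\ measurable N,
    @leb3 R N = 0%E & forall x, ~ N x -> forall F, F \in facets K -> facet_dist K F x <> 0].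
  apply: null_all_seq => F FK.
  have n0 : outward_normal K F != 0.
    apply: contra_eq_neq (dot_outward_normal vK FK) => ->.
    by rewrite /dot !mul0r !addr0 eq_sym oner_neq0.
  pose n := outward_normal K F.
  exists [set x : mR3 R | c1 n * c1 x + c2 n * c2 x + c3 n * c3 x
     + (- dot n (forg F)) = 0]; split.
  - by apply: measurable_eq0; exact: measurable_affine3.
  - apply: leb3_plane; apply: contra_neq n0 => n0.
    by apply: R3P; [exact: (congr1 c1 n0)|exact: (congr1 c2 n0)|exact: (congr1 c3 n0)].
  move=> x Nx Fx; apply: Nx => /=; move: Fx; rewrite /facet_dist -/n dotBr.
  by rewrite {1}/dot.
apply: (subset_measure0 _ mN _ N0).
  by apply: measurableD; [exact: measurable_ccell|exact: measurable_ocell].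
move=> x [/(ccellP _ vK) Kx nKx]; apply: contrapT => Nx; apply: nKx.
apply/(ocellP _ vK) => F FK; rewrite lt_neqAle Kx// andbT.
by apply/eqP; exact: HN.
Qed.

Lemma scales_measure_cell_map K : valid_cell K ->
  scales_measure (@leb3 R) `|cell_det K|^-1
    (cell_map K : mR3 R -> mR3 R).
Proof.
move=> vK; have D0 := cell_det_neq0 vK.
apply: eq_scales_measure (@scales_measure_affine3 R
  (c1 (edge1 K)) (c1 (edge2 K)) (c1 (edge3 K))
  (c2 (edge1 K)) (c2 (edge2 K)) (c2 (edge3 K))
  (c3 (edge1 K)) (c3 (edge2 K)) (c3 (edge3 K))
  (c1 (org K)) (c2 (org K)) (c3 (org K)) (cell_det K) _ D0) => //.
  move=> t; apply: R3P; rewrite /cell_map !coordE /c1 /c2 /c3 /=; ring.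
by rewrite /cell_det /dot /cross !coordE; ring.
Qed.

Lemma cell_map_preimage K : valid_cell K ->
  cell_map K @^-1` ocell K = ref_open (cshape K).
Proof. by move=> vK; rewrite ocellE//; apply/seteqP; split => t /=; rewrite cell_mapK. Qed.

Lemma ocell_unit_cell sh : ocell (unit_cell R sh) = ref_open sh.
Proof.
have E (t : R3 R) : cell_map (unit_cell R sh) t = t.
  by apply: R3P; rewrite /cell_map /unit_cell; cbn [org edge1 edge2 edge3];
    rewrite /basis1 /basis2 /basis3 !coordE; ring.
apply/seteqP; split => [_ [t Kt <-]|t Kt]; first by rewrite E.
by exists t.
Qed.

Lemma measurable_ref_open sh : measurable (@ref_open R sh : set3 R).
Proof. by rewrite -ocell_unit_cell; apply: measurable_ocell; exact: valid_unit_cell. Qed.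

Lemma ref_open_cube sh (t : R3 R) : ref_open sh t ->
  [/\ 0 <= c1 t <= 1, 0 <= c2 t <= 1 & 0 <= c3 t <= 1].
Proof.
case: sh => /=.
  by move=> [/andP[? ?] /andP[? ?] /andP[? ?]]; split; apply/andP; split; lra.
by move=> [? ? ? ?]; split; apply/andP; split; lra.
Qed.

Lemma ref_open_lty sh : (@leb3 R (ref_open sh) < +oo)%E.
Proof.
have mI : measurable (`[0%R, 1%R]%classic : set (mR R)) by exact: measurable_itv.
have lI : (leb1 R `[0%R, 1%R]%classic < +oo)%E.
  by rewrite /leb1 /= lebesgue_measure_itv /= lte01 -EFinB ltry.
have mII : measurable (`[0%R, 1%R]%classic `*` `[0%R, 1%R]%classic : set2 R).
  exact: measurableX.
have := product_measure_lty (m1 := @leb2 R) (m2 := leb1 R) mII mI (leb2_square_lty R) lI.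
apply: le_lt_trans; apply: le_measure; rewrite ?inE.
- exact: measurable_ref_open.
- exact: measurableX.
move=> [[x y] z] /ref_open_cube; rewrite /c1 /c2 /c3 /= => -[? ? ?].
by rewrite /= !in_itv.
Qed.

Lemma ocell_lty K : valid_cell K -> (@leb3 R (ocell K) < +oo)%E.
Proof.
move=> vK; have [_ /(_ _ (measurable_ocell vK))] := scales_measure_cell_map vK.
rewrite cell_map_preimage// => E; have := ref_open_lty (cshape K); rewrite E.
have D0 : 0 < `|cell_det K|^-1 by rewrite invr_gt0 normr_gt0 cell_det_neq0.
rewrite !ltey; apply: contra_neq => /= ->.
by rewrite gt0_muley// lte_fin.
Qed.

Lemma Rintegral_ocell K (g : R3 R -> R) : valid_cell K ->
  bmeas (ocell K : set3 R) g ->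
  \int[@leb3 R]_(x in ocell K) g x =
  `|cell_det K| * \int[@leb3 R]_(t in ref_open (cshape K)) g (cell_map K t).
Proof.
move=> vK bg; have D0 : `|cell_det K| != 0 by rewrite normr_eq0 cell_det_neq0.
have D1 : 0 <= `|cell_det K|^-1 by rewrite invr_ge0.
have := scales_measure_Rintegral D1 (scales_measure_cell_map vK)
  (measurable_ocell vK) (ocell_lty vK) bg.
by rewrite cell_map_preimage// => ->; rewrite mulrA mulfV// mul1r.
Qed.

End CellMeasure.

Section BoundedPolynomials.
Variable R : realType.
Implicit Types (K : cell R) (F : facet R) (p : mpoly.mpoly 3 R).

Lemma bmeas_coord3 d (T : measurableType d) (D : set T) (phi : T -> R3 R) p :
  bmeas D (c1 \o phi) -> bmeas D (c2 \o phi) -> bmeas D (c3 \o phi) ->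
  bmeas D (peval p \o phi).
Proof.
move=> b1 b2 b3; apply: bmeas_meval => i.
have [E|E|E] := coord3_fun R i.
- by apply: eq_bmeas b1 => x _; rewrite /= -E.
- by apply: eq_bmeas b2 => x _; rewrite /= -E.
- by apply: eq_bmeas b3 => x _; rewrite /= -E.
Qed.

Lemma bmeas_ref_facet sh : bmeas (ref_facet sh : set2 R) (fun t => t.1) /\
  bmeas (ref_facet sh : set2 R) (fun t => t.2).
Proof.
split; split.
- by apply: measurable_funTS; exact: measurable_fst.
- by exists 1 => t /ref_facet_square[/=]; rewrite !in_itv/= => /andP[? ?] _; rewrite ger0_norm.
- by apply: measurable_funTS; exact: measurable_snd.
- by exists 1 => t /ref_facet_square[/=]; rewrite !in_itv/= => _ /andP[? ?]; rewrite ger0_norm.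
Qed.

Lemma surf_bmeas_c : [/\ surf_bmeas (@c1 R), surf_bmeas (@c2 R) & surf_bmeas (@c3 R)].
Proof.
have H (a b c : R) sh : bmeas (ref_facet sh : set2 R)
    (fun t => a + (t.1 * b + t.2 * c)).
  have [b1 b2] := bmeas_ref_facet sh.
  apply: bmeasD; first exact: bmeas_cst.
  by apply: bmeasD; apply: bmeasM => //; exact: bmeas_cst.
by split => sh F; exact: H.
Qed.

Lemma surf_bmeas_peval p : surf_bmeas (peval p).
Proof.
have [b1 b2 b3] := surf_bmeas_c => sh F.
by apply: bmeas_coord3; [exact: b1|exact: b2|exact: b3].
Qed.

Lemma bmeas_ccell_c (K : cell R) : valid_cell K ->
  [/\ bmeas (ccell K : set3 R) c1,
  bmeas (ccell K : set3 R) c2 &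
  bmeas (ccell K : set3 R) c3].
Proof.
move=> vK; have cube (t : R3 R) : ref_closed (cshape K) t ->
    [/\ 0 <= c1 t <= 1, 0 <= c2 t <= 1 & 0 <= c3 t <= 1].
  case: (cshape K) => //=.
  by move=> [? ? ? ?]; split; apply/andP; split; lra.
have bnd (a b c d s t u : R) : 0 <= s <= 1 -> 0 <= t <= 1 -> 0 <= u <= 1 ->
    `|a + (s * b + t * c + u * d)| <= `|a| + (`|b| + `|c| + `|d|).
  move=> /andP[? ?] /andP[? ?] /andP[? ?].
  have mul (w z : R) : 0 <= w -> w <= 1 -> `|w * z| <= `|z|.
    by move=> ? ?; rewrite normrM ger0_norm// ler_piMl.
  apply: le_trans (ler_normD _ _) _; rewrite lerD2l.
  apply: le_trans (ler_normD _ _) _; apply: lerD; last exact: mul.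
  by apply: le_trans (ler_normD _ _) _; apply: lerD; exact: mul.
split; split.
- by apply: measurable_funTS; exact: measurable_c1.
- eexists => _ [t /cube[h1 h2 h3] <-]; exact: bnd h1 h2 h3.
- by apply: measurable_funTS; exact: measurable_c2.
- eexists => _ [t /cube[h1 h2 h3] <-]; exact: bnd h1 h2 h3.
- by apply: measurable_funTS; exact: measurable_c3.
- eexists => _ [t /cube[h1 h2 h3] <-]; exact: bnd h1 h2 h3.
Qed.

Lemma bmeas_ocell_c K : valid_cell K ->
  [/\ bmeas (ocell K : set3 R) c1,
  bmeas (ocell K : set3 R) c2 &
  bmeas (ocell K : set3 R) c3].
Proof.
move=> vK; have mK := measurable_ccell vK; have [b1 b2 b3] := bmeas_ccell_c vK.
by split; apply: (bmeasS mK (@ocell_ccell _ K)).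
Qed.

Lemma bmeas_ref_open sh : [/\ bmeas (ref_open sh : set3 R) c1,
  bmeas (ref_open sh : set3 R) c2 &
  bmeas (ref_open sh : set3 R) c3].
Proof. by rewrite -ocell_unit_cell; apply: bmeas_ocell_c; exact: valid_unit_cell. Qed.

Lemma bmeas_ocell_peval K p : valid_cell K ->
  bmeas (ocell K : set3 R) (peval p).
Proof.
move=> vK; have [b1 b2 b3] := bmeas_ocell_c vK.
exact: (@bmeas_coord3 _ _ _ id).
Qed.

Lemma bmeas_ref_open_peval K p sh :
  bmeas (ref_open sh : set3 R) (peval p \o cell_map K).
Proof.
have [b1 b2 b3] := bmeas_ref_open sh.
have H (a b c d : R) : bmeas (ref_open sh : set3 R)
    (fun t => a + (c1 t * b + c2 t * c + c3 t * d)).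
  apply: bmeasD; first exact: bmeas_cst.
  by apply: bmeasD; [apply: bmeasD|]; apply: bmeasM => //; exact: bmeas_cst.
by apply: bmeas_coord3; exact: H.
Qed.

End BoundedPolynomials.

(** * The divergence theorem on a cell *)

Section Divergence.
Variable R : realType.
Implicit Types (K : cell R) (F : facet R) (p : mpoly.mpoly 3 R).

(** The surface element cancels the normalization of the normal and leaves the signed vector
    [facet_dir F]. *)
Lemma facet_flux K F w (g : R3 R -> R) : valid_cell K -> F \in facets K ->
  bmeas (ref_facet (cshape K) : set2 R) (g \o facet_map F) ->
  enorm (facet_dir F) * \int[@leb2 R]_(t in ref_facet (cshape K) `&`
     facet_map F @^-1` setT) (dot (outward_normal K F) w * g (facet_map F t))
  = Num.sg (dot (facet_dir F) (forg F - barycenter K)) * dot (facet_dir F) w *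
    \int[@leb2 R]_(t in ref_facet (cshape K)) g (facet_map F t).
Proof.
move=> vK FK bg; rewrite preimage_setT setIT.
rewrite (bRintegralZ _ (@measurable_ref_facet R (cshape K)) (@ref_facet_lty R (cshape K)) bg).
rewrite /outward_normal dotZl !mulrA; congr (_ * _).
have e0 : enorm (facet_dir F) != 0 by rewrite gt_eqF// enorm_gt0// (facet_dir_neq0 vK FK).
by field.
Qed.

(** The affine map of determinant 1 that permutes the barycentric coordinates of the triangle
    cyclically; it relates different parametrizations of the slanted facet of a simplex. *)
Lemma Rintegral_triangle_rot (g : R * R -> R) :
  bmeas (ref_facet Simplex : set2 R) g ->
  \int[@leb2 R]_(t in ref_facet Simplex) g (1 - t.1 - t.2, t.1) =
  \int[@leb2 R]_(t in ref_facet Simplex) g t.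
Proof.
move=> bg; have D0 : (-1) * 0 - (-1) * 1 != 0 :> R.
  by rewrite mulr0 mulr1 sub0r opprK oner_neq0.
have S := scales_measure_affine2 1 0 D0.
have c0 : 0 <= `|(-1) * 0 - (-1) * 1|^-1 :> R by rewrite invr_ge0.
have := scales_measure_Rintegral c0 S (@measurable_ref_facet R Simplex)
  (@ref_facet_lty R Simplex) bg.
rewrite mulr0 mulr1 sub0r opprK normr1 invr1 mul1r => <-.
rewrite [in RHS](_ : _ @^-1` _ = ref_facet Simplex); last first.
  apply/seteqP; split => t /=.
    by move=> [? ? ?]; split; lra.
  by move=> [? ? ?]; split; lra.
by apply: eq_RintegralP => t _; congr (g _); congr pair; ring.
Qed.

Lemma Rintegral_ref_open sh (g : R3 R -> R) :
  bmeas (ref_open sh : set3 R) g ->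
  \int[@leb3 R]_(t in ref_open sh) g t = \int[@leb2 R]_(t in ref_facet sh)
    \int[leb1 R]_(s in `]0, if sh is Cartesian then 1 else 1 - t.1 - t.2[) g (t, s).
Proof.
move=> bg.
have := Rintegral_fubini (m1 := @leb2 R) (m2 := leb1 R)
  (@measurable_ref_open R sh) (@ref_open_lty R sh) bg.
move=> ->; rewrite [RHS]Rintegral_mkcond; apply: eq_RintegralP => t _.
have secE : xsection (ref_open sh) t = [set s | ref_open sh (t, s)].
  by apply/seteqP; split => s; rewrite /xsection /= inE.
rewrite secE patchE; case: ifPn => [/set_mem Kt|/negP nKt].
  congr (Rintegral _ _ _); apply/seteqP.
  split => s /=; rewrite in_itv /=; case: sh Kt {bg secE} => /=;
  rewrite /c1 /c2 /c3 /=.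
  - by move=> _ [_ _ ?].
  - by move=> _ [? ? ? ?]; apply/andP; split; lra.
  - by move=> [? ?].
  - by move=> [? ? ?] /andP[? ?]; split; lra.
rewrite (_ : mkset _ = set0) ?Rintegral_set0//.
apply/seteqP; split => // s /= Ks; apply: nKt; apply/mem_set; move: Ks.
case: sh {bg secE} => /=; rewrite /c1 /c2 /c3 /=.
  by move=> [? ? _].
by move=> [? ? ? ?]; split; lra.
Qed.

Lemma dot_cross_l (x y : R3 R) : dot (cross x y) x = 0.
Proof. by rewrite /dot /cross !coordE; ring. Qed.

Lemma dot_cross_r (x y : R3 R) : dot (cross x y) y = 0.
Proof. by rewrite /dot /cross !coordE; ring. Qed.

Lemma dot_crossC (x y z : R3 R) : dot (cross y z) x = dot (cross x y) z.
Proof. by rewrite /dot /cross !coordE; ring. Qed.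

Lemma cross_slanted (x y z : R3 R) :
  cross (y - x) (z - x) = cross x y + cross y z + cross z x.
Proof. by apply: R3P; rewrite /cross !coordE; ring. Qed.

Lemma facet_dirE (x y z : R3 R) : facet_dir (x, y, z) = cross y z. Proof. by []. Qed.
Lemma fedge1E (x y z : R3 R) : fedge1 (x, y, z) = y. Proof. by []. Qed.
Lemma fedge2E (x y z : R3 R) : fedge2 (x, y, z) = z. Proof. by []. Qed.
Lemma forgE (x y z : R3 R) : forg (x, y, z) = x. Proof. by []. Qed.
Lemma cell_detE K : dot (cross (edge1 K) (edge2 K)) (edge3 K) = cell_det K.
Proof. by []. Qed.

Local Opaque dot cross.

(** The fundamental theorem along [edge3 K] leaves the values on the facet spanned by the other two
    edges and on the opposite or slanted facet. The remaining facets contain the direction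
    [edge3 K], so their normals are orthogonal to it. *)
Lemma divergence_edge3 K p (q : R3 R -> R) : valid_cell K -> continuous q ->
  (forall x, is_derive x (edge3 K) (peval p) (q x)) ->
  bmeas (ocell K : set3 R) q ->
  bmeas (ref_open (cshape K) : set3 R) (q \o cell_map K) ->
  \int[@leb3 R]_(x in ocell K) q x =
    bd_int K setT (fun n x => dot n (edge3 K) * peval p x).
Proof.
move=> vK cq dq bq bq'; rewrite Rintegral_ocell// Rintegral_ref_open//.
have cmE (t : R * R) s : cell_map K (t, s)
    = org K + (t.1 *: edge1 K + t.2 *: edge2 K) + s *: edge3 K.
  by rewrite /cell_map /c1 /c2 /c3 /= addrA.
have D0 := cell_det_neq0 vK.
have bp F : bmeas (ref_facet (cshape K) : set2 R) (peval p \o facet_map F).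
  exact: surf_bmeas_peval.
transitivity (`|cell_det K| * \int[@leb2 R]_(t in ref_facet (cshape K))
   (peval p (org K + (t.1 *: edge1 K + t.2 *: edge2 K) +
      (if cshape K is Cartesian then 1 else 1 - t.1 - t.2) *: edge3 K)
    - peval p (org K + (t.1 *: edge1 K + t.2 *: edge2 K)))).
  congr (_ * _); apply: eq_RintegralP => t Kt.
  under eq_Rintegral do rewrite cmE.
  rewrite (@FTC_segment _ p q _ _ 0 _ _ cq dq) ?scale0r ?addr0//.
  move: Kt; case: (cshape K) => /=; first by rewrite ltr01.
  by move=> [? ? ?]; lra.
have mr := @measurable_ref_facet R (cshape K).
have lr := @ref_facet_lty R (cshape K).
pose a := edge1 K; pose b := edge2 K; pose c := edge3 K; pose o := org K.
have fl F : F \in facets K -> _ := fun h => @facet_flux K F c (peval p) vK h (bp F).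
rewrite /bd_int big_seq (eq_bigr _ fl) -big_seq => {fl}.
have z3 : dot (cross a b) c = cell_det K := cell_detE K.
have sgD : Num.sg (cell_det K) * cell_det K = `|cell_det K| by rewrite -normrEsg.
have n1 := dot_cross_l a b; have n2 := dot_cross_r a b.
have z1 := dot_cross_r b c; have z2 := dot_cross_l c a.
rewrite /facets /barycenter -/a -/b -/c -/o; clearbody a b c o.
move: mr lr bp; case: (cshape K) => mr lr bp; cbv iota.
  rewrite !big_cons big_nil addr0 !facet_dirE !forgE z1 z2 z3.
  rewrite !mulr0 !mul0r !add0r.
  have -> : dot (cross a b) (o - (o + 2^-1 *: (a + b + c))) = - (2^-1 * cell_det K).
    by rewrite opprD addrA subrr add0r dotNr dotZr !dotDr n1 n2 z3 !add0r.
  have -> : dot (cross a b) (o + c - (o + 2^-1 *: (a + b + c))) = 2^-1 * cell_det K.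
    rewrite (_ : o + c - _ = c - 2^-1 *: (a + b + c)).
      rewrite dotBr dotZr !dotDr n1 n2 z3 !add0r.
      by field.
    by rewrite [_ + c]addrC opprD addrA addrK.
  rewrite sgrN sgrM (@gtr0_sg _ 2^-1) ?invr_gt0// mul1r mulNr sgD.
  rewrite mulNr addrC -mulrBr -(bRintegralB mr lr (bp (o + c, a, b)) (bp (o, a, b))).
  by congr (_ * _); apply: eq_RintegralP => t _; rewrite scale1r /facet_map /= [_ + c + _]addrAC.
rewrite !big_cons big_nil addr0 !facet_dirE !forgE z1 z2 z3.
rewrite !mulr0 !mul0r !add0r.
have -> : dot (cross (b - a) (c - a)) c = cell_det K.
  by rewrite cross_slanted !dotDl z1 z2 z3 !addr0.
have -> : dot (cross a b) (o - (o + 4^-1 *: (a + b + c))) = - (4^-1 * cell_det K).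
  by rewrite opprD addrA subrr add0r dotNr dotZr !dotDr n1 n2 z3 !add0r.
have -> : dot (cross (b - a) (c - a)) (o + a - (o + 4^-1 *: (a + b + c))) = 4^-1 * cell_det K.
  rewrite (_ : o + a - _ = a - 4^-1 *: (a + b + c)).
    rewrite cross_slanted dotBr dotZr !dotDr !dotDl n1 n2 z1 z2 z3.
    rewrite (dot_cross_r c a) (dot_cross_l b c).
    rewrite (dot_crossC b c a) (dot_crossC a b c) z3.
    by field.
  by rewrite [_ + a]addrC opprD addrA addrK.
rewrite sgrN sgrM (@gtr0_sg _ 4^-1) ?invr_gt0// mul1r mulNr sgD.
rewrite mulNr addrC -mulrBr.
(* [g] parametrizes the slanted facet as a graph over the facet spanned by [a] and [b]; [facet_map]
   starts from another vertex, whence the rotation. *)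
pose g (t : R * R) := peval p (o + (t.1 *: a + t.2 *: b) + (1 - t.1 - t.2) *: c).
have gS (t : R * R) : peval p (facet_map (o + a, b - a, c - a) t)
    = g (1 - t.1 - t.2, t.1).
  rewrite /g /facet_map /forg /fedge1 /fedge2 /=; congr peval.
  by apply: R3P; rewrite !coordE; ring.
have bg : bmeas (ref_facet Simplex : set2 R) g.
  have := bp (o + c, a - c, b - c); apply: eq_bmeas => t _.
  rewrite /g /facet_map /forg /fedge1 /fedge2 /=; congr peval.
  by apply: R3P; rewrite !coordE; ring.
rewrite [X in _ = _ * (X - _)](_ : _ = \int[@leb2 R]_(t in ref_facet Simplex) g t).
  by rewrite -(bRintegralB mr lr bg (bp (o, a, b))).
rewrite -(Rintegral_triangle_rot bg); apply: eq_RintegralP => t _; exact: gS.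
Qed.

Local Transparent dot cross.

(** The same set with its edges permuted cyclically, so that a result for the third edge applies to
    each edge. *)
Definition rot_cell K : cell R :=
  Cell (cshape K) (org K) (edge2 K) (edge3 K) (edge1 K).

Lemma barycenter_rot K : barycenter (rot_cell K) = barycenter K.
Proof.
by rewrite /barycenter /=; case: (cshape K); congr (_ + _ *: _); rewrite addrC addrA.
Qed.

Lemma valid_rot_cell K : valid_cell K -> valid_cell (rot_cell K).
Proof.
rewrite /valid_cell /=; case: (cshape K); first by move=> [[? ? ?] [? ? ?]].
by rewrite -dot_crossC -dot_crossC.
Qed.

Lemma ocell_rot K : ocell (rot_cell K) = ocell K.
Proof.
apply/seteqP; split => x [t Kt <-].
  exists (c3 t, c1 t, c2 t).
    move: Kt; rewrite /=; case: (cshape K); rewrite /ref_open /= !coordE.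
      by move=> [? ? ?].
    by move=> [? ? ? ?]; split; lra.
  by apply: R3P; rewrite /cell_map !coordE /=; ring.
exists (c2 t, c3 t, c1 t).
  move: Kt; rewrite /=; case: (cshape K); rewrite /ref_open /= !coordE.
    by move=> [? ? ?].
  by move=> [? ? ? ?]; split; lra.
by apply: R3P; rewrite /cell_map !coordE /=; ring.
Qed.

(** The rotated cell has the same facets in another order, except that the slanted facet of a
    simplex is parametrized from another vertex. *)
Lemma bd_int_rot K h : (forall n, surf_bmeas (h n)) ->
  bd_int (rot_cell K) setT h = bd_int K setT h.
Proof.
move=> bh; pose term F := enorm (facet_dir F) *
  \int[@leb2 R]_(t in ref_facet (cshape K) `&` facet_map F @^-1` setT)
     h (outward_normal K F) (facet_map F t).
transitivity (\sum_(F <- facets (rot_cell K)) term F).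
  by apply: eq_bigr => F _; rewrite /outward_normal barycenter_rot.
have bh' := fun F => bh (outward_normal K F) (cshape K) F.
rewrite -[RHS]/(\sum_(F <- facets K) term F) {}/term.
move: bh'; rewrite /facets /outward_normal /barycenter /=; case: (cshape K) => bh'.
  apply: perm_big; exact: (permEl (perm_rot 2 [:: (org K, edge2 K, edge3 K);
    (org K + edge1 K, edge2 K, edge3 K); (org K, edge3 K, edge1 K);
    (org K + edge2 K, edge3 K, edge1 K); (org K, edge1 K, edge2 K);
    (org K + edge3 K, edge1 K, edge2 K)])).
pose a := edge1 K; pose b := edge2 K; pose c := edge3 K; pose o := org K.
rewrite !big_cons !big_nil -/a -/b -/c -/o !addr0.
move: bh'; rewrite -/a -/b -/c -/o; set m := o + 4^-1 *: (a + b + c) => bh'.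
rewrite [RHS]addrCA; congr (_ + _); rewrite [RHS]addrCA; congr (_ + _); congr (_ + _).
have dE : facet_dir (o + b, c - b, a - b) = facet_dir (o + a, b - a, c - a).
  by rewrite !facet_dirE; apply: R3P; rewrite /cross !coordE; ring.
have sE : dot (facet_dir (o + a, b - a, c - a)) (forg (o + b, c - b, a - b) - m)
    = dot (facet_dir (o + a, b - a, c - a)) (forg (o + a, b - a, c - a) - m).
  by rewrite !facet_dirE !forgE /dot /cross !coordE; ring.
rewrite dE sE; congr (_ * _); rewrite !preimage_setT !setIT.
have := Rintegral_triangle_rot (bh' (o + a, b - a, c - a)) => /= <-.
apply: eq_RintegralP => t _; congr (h _ _); rewrite /facet_map !forgE !fedge1E !fedge2E.
by apply: R3P; rewrite !coordE /=; ring.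
Qed.

Lemma surf_bmeasD (f g : R3 R -> R) : surf_bmeas f -> surf_bmeas g ->
  surf_bmeas (fun x => f x + g x).
Proof. by move=> bf bg sh F; exact: bmeasD (bf sh F) (bg sh F). Qed.

Lemma surf_bmeasM (f g : R3 R -> R) : surf_bmeas f -> surf_bmeas g ->
  surf_bmeas (fun x => f x * g x).
Proof. by move=> bf bg sh F; exact: bmeasM (bf sh F) (bg sh F). Qed.

Lemma surf_bmeas_cst (k : R) : surf_bmeas (fun=> k).
Proof. by move=> sh F; exact: bmeas_cst. Qed.

(** [I] and [B] have the same products with all three edges, by [divergence_edge3] for the cell and
    its two rotations, and the edges form a basis. *)
Lemma divergence K p q1 q2 q3 : valid_cell K ->
  (forall x v, is_derive x v (peval p)
    (c1 v * peval q1 x + c2 v * peval q2 x + c3 v * peval q3 x)) ->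
  [/\ \int[@leb3 R]_(x in ocell K) peval q1 x
      = bd_int K setT (fun n x => c1 n * peval p x),
    \int[@leb3 R]_(x in ocell K) peval q2 x
      = bd_int K setT (fun n x => c2 n * peval p x) &
    \int[@leb3 R]_(x in ocell K) peval q3 x
      = bd_int K setT (fun n x => c3 n * peval p x)].
Proof.
move=> vK dp; pose I : R3 R := (\int[@leb3 R]_(x in ocell K) peval q1 x,
  \int[@leb3 R]_(x in ocell K) peval q2 x, \int[@leb3 R]_(x in ocell K) peval q3 x).
pose B : R3 R := (bd_int K setT (fun n x => c1 n * peval p x),
  bd_int K setT (fun n x => c2 n * peval p x), bd_int K setT (fun n x => c3 n * peval p x)).
suff IB : I = B.
  by split; [exact: (congr1 c1 IB)|exact: (congr1 c2 IB)|exact: (congr1 c3 IB)].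
have bp k : surf_bmeas (fun x => k * peval p x).
  by apply: surf_bmeasM; [exact: surf_bmeas_cst|exact: surf_bmeas_peval].
have mT : measurable (setT : set3 R) by exact: measurableT.
have mK := measurable_ocell vK; have lK := ocell_lty vK.
have bK q := bmeas_ocell_peval q vK.
have BE w : bd_int K setT (fun n x => dot n w * peval p x) = dot w B.
{ rewrite /B {2}/dot !coordE -!bd_intZ//.
  rewrite -!bd_intD//; first by congr bd_int; apply/funext => n; apply/funext => x;
    rewrite /dot; ring.
  all: move=> n; repeat apply: surf_bmeasD; apply: surf_bmeasM => //; exact: surf_bmeas_cst. }
have IE w : \int[@leb3 R]_(x in ocell K)
    (c1 w * peval q1 x + c2 w * peval q2 x + c3 w * peval q3 x) = dot w I.
{ rewrite /I /dot !coordE bRintegralD ?bRintegralD ?bRintegralZ//.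
  all: repeat apply: bmeasD; apply: bmeasZ; exact: bK. }
have step K' : valid_cell K' -> ocell K' = ocell K ->
    (forall h, (forall n, surf_bmeas (h n)) -> bd_int K' setT h = bd_int K setT h) ->
    dot (edge3 K') I = dot (edge3 K') B.
  move=> vK' oE bE; rewrite -IE -BE -bE; last by move=> n; exact: bp.
  rewrite -oE; apply: divergence_edge3 => //.
  - move=> x; apply: cvgD; [apply: cvgD|]; apply: cvgM; try exact: cvg_cst;
    exact: continuous_peval.
  - by repeat apply: bmeasD; apply: bmeasZ; apply: bmeas_ocell_peval.
  - by repeat apply: bmeasD; apply: bmeasZ; apply: bmeas_ref_open_peval.
have h3 : dot (edge3 K) I = dot (edge3 K) B by exact: step.
have v' := valid_rot_cell vK; have v'' := valid_rot_cell v'.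
have h1 : dot (edge1 K) I = dot (edge1 K) B.
  have := step _ v' (ocell_rot K) (@bd_int_rot K).
  by rewrite [edge3 _]/(edge1 K).
have h2 : dot (edge2 K) I = dot (edge2 K) B.
  have := step _ v'' (etrans (ocell_rot _) (ocell_rot K))
    (fun h bh => etrans (bd_int_rot _ bh) (bd_int_rot K bh)).
  by rewrite [edge3 _]/(edge2 K).
have D0 := cell_det_neq0 vK.
(* The expansion of [I - B] in the basis dual to the edges. *)
have E : cell_det K *: (I - B) = dot (edge1 K) (I - B) *: cross (edge2 K) (edge3 K)
    + dot (edge2 K) (I - B) *: cross (edge3 K) (edge1 K)
    + dot (edge3 K) (I - B) *: cross (edge1 K) (edge2 K).
  by apply: R3P; rewrite /cell_det /dot /cross !coordE; ring.
rewrite !dotBr h1 h2 h3 !subrr !scale0r !addr0 in E.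
apply/eqP; rewrite -subr_eq0; apply/eqP.
by rewrite -[I - B]scale1r -(mulVf D0) -scalerA E scaler0.
Qed.

End Divergence.

(** * Traces of functions that extend continuously *)

Section Traces.
Variable R : realType.
Implicit Types (K : cell R) (x : R3 R).

Lemma nbhs_ocell K x : valid_cell K -> ocell K x -> \forall y \near x, ocell K y.
Proof.
move=> vK Kx.
suff : \forall y \near x, forall F, F \in facets K -> facet_dist K F y < 0.
  by apply: filterS => y; move/(ocellP _ vK).
elim: (facets K) ((ocellP _ vK).1 Kx) => [_|F s IHs H]; first by near=> y.
have Fx := H F (mem_head _ _).
have cF : facet_dist K F @ x --> facet_dist K F x.
  rewrite /facet_dist /dot.
  have cc (c : R3 R -> R) k : continuous c -> k * c (y - forg F) @[y --> x] --> k * c (x - forg F).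
    move=> ccont; apply: cvgM; first exact: cvg_cst.
    apply: (@cvg_comp _ _ _ (fun y => y - forg F) c); last exact: ccont.
    by apply: cvgB; [exact: cvg_id|exact: cvg_cst].
  by apply: cvgD; [apply: cvgD|]; apply: cc;
    [exact: continuous_c1|exact: continuous_c2|exact: continuous_c3].
have nF : \forall y \near x, facet_dist K F y < 0 by exact: (cvgr_lt _ cF).
have ns : \forall y \near x, forall G, G \in s -> facet_dist K G y < 0.
  by apply: IHs => G Gs; apply: H; rewrite inE Gs orbT.
near=> y => G; rewrite inE => /predU1P[->|]; first by near: y.
by move: G; near: y.
Unshelve. all: by end_near.
Qed.

Lemma ccell_closure K x : valid_cell K -> ccell K x -> closure (ocell K) x.
Proof.
move=> vK /(ccellP _ vK) Kx U Ux; pose w := barycenter K - x.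
have near_o : \forall e \near 0^'+, ocell K (x + e *: w).
  apply: near_ocell => // F FK; have := Kx F FK; rewrite le_eqVlt => /predU1P[Fx|]; last by left.
  right; split => //; have := (ocellP _ vK).1 (barycenter_ocell vK) F FK.
  by rewrite (facet_dist_sub K F x) Fx add0r.
have near_U : \forall e \near 0^'+, U (x + e *: w).
  have : (fun e : R => x + e *: w) @ (0 : R) --> x + 0 *: w by exact: continuous_segment.
  by rewrite scale0r addr0 => /cvg_at_right_filter; apply.
have := @filter_ex _ _ _ _ (filterI near_o near_U).
by move=> [e [? ?]]; exists (x + e *: w).
Qed.

(** A continuous extension [h] makes the limit exist, and since a closed cell lies in the closure of
    the open one, the filter is proper and the limit unique. *)
Lemma traceE K (g h : R3 R -> R) x : valid_cell K -> ccell K x ->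
  (forall y, ocell K y -> g y = h y) -> {for x, continuous h} -> trace K g x = h x.
Proof.
move=> vK Kx gh ch; rewrite /Defs.trace.
have pf : ProperFilter (within (ocell K) (nbhs x)).
  by apply: within_nbhs_proper; exact: ccell_closure.
apply: cvg_lim => //.
have : h @ within (ocell K) (nbhs x) --> h x by exact: cvg_within_filter.
apply: cvg_trans; apply: near_eq_cvg.
by apply: filterS (withinT (ocell K) (nbhs_filter x)) => y /gh.
Qed.

End Traces.

(** * Green's formula for the curl and the Maxwell face terms *)

Section Green.
Variable R : realType.
Implicit Types (K : cell R) (p : mpoly.mpoly 3 R).

Definition pfield p1 p2 p3 : field R := fun x => (peval p1 x, peval p2 x, peval p3 x).

Definition is_gradient p q1 q2 q3 := forall x v, is_derive x v (peval p)
  (c1 v * peval q1 x + c2 v * peval q2 x + c3 v * peval q3 x).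

Lemma gradient_exists p : exists q, is_gradient p q.1.1 q.1.2 q.2.
Proof. by have [q1 [q2 [q3 H]]] := is_derive_peval p; exists (q1, q2, q3). Qed.

Lemma derive_gradient p q1 q2 q3 x : is_gradient p q1 q2 q3 ->
  [/\ 'D_(@basis1 R) (peval p) x = peval q1 x,
     'D_(@basis2 R) (peval p) x = peval q2 x &
     'D_(@basis3 R) (peval p) x = peval q3 x].
Proof.
move=> H; have D v : 'D_v (peval p) x
    = c1 v * peval q1 x + c2 v * peval q2 x + c3 v * peval q3 x.
  exact: derive_val.
by rewrite !D /basis1 /basis2 /basis3 !coordE !mul1r !mul0r !addr0 !add0r.
Qed.

Lemma is_gradient_mulB p q r s gp gq gr gs :
  is_gradient p gp.1.1 gp.1.2 gp.2 -> is_gradient q gq.1.1 gq.1.2 gq.2 ->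
  is_gradient r gr.1.1 gr.1.2 gr.2 -> is_gradient s gs.1.1 gs.1.2 gs.2 ->
  is_gradient (p * q - r * s)
    (p * gq.1.1 + q * gp.1.1 - (r * gs.1.1 + s * gr.1.1))
    (p * gq.1.2 + q * gp.1.2 - (r * gs.1.2 + s * gr.1.2))
    (p * gq.2 + q * gp.2 - (r * gs.2 + s * gr.2)).
Proof.
move=> Hp Hq Hr Hs x v.
have -> : peval (p * q - r * s) = peval p * peval q - peval r * peval s.
  by apply/funext => y; rewrite /peval mpoly.mevalB !mpoly.mevalM.
apply: (is_derive_eq (is_deriveB (is_deriveM (Hp x v) (Hq x v))
  (is_deriveM (Hr x v) (Hs x v)))).
by rewrite /peval !(mpoly.mevalB, mpoly.mevalD, mpoly.mevalM) /GRing.scale/=; ring.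
Qed.

(** The divergence theorem for the components of the cross product, with div (U x W) = W . curl U -
    U . curl W. *)
Lemma Rintegral_curl_cross K u1 u2 u3 w1 w2 w3 : valid_cell K ->
  \int[@leb3 R]_(x in ocell K)
    (dot (pfield w1 w2 w3 x) (curl (pfield u1 u2 u3) x)
     - dot (pfield u1 u2 u3 x) (curl (pfield w1 w2 w3) x)) =
  bd_int K setT (fun n x => dot n (cross (pfield u1 u2 u3 x) (pfield w1 w2 w3 x))).
Proof.
move=> vK.
have [g1 G1] := gradient_exists u1; have [g2 G2] := gradient_exists u2.
have [g3 G3] := gradient_exists u3; have [h1 H1] := gradient_exists w1.
have [h2 H2] := gradient_exists w2; have [h3 H3] := gradient_exists w3.
have [D1 _ _] := divergence vK (is_gradient_mulB G2 H3 G3 H2).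
have [_ D2 _] := divergence vK (is_gradient_mulB G3 H1 G1 H3).
have [_ _ D3] := divergence vK (is_gradient_mulB G1 H2 G2 H1).
have bp p k : surf_bmeas (fun x => k * peval p x).
  by apply: surf_bmeasM; [exact: surf_bmeas_cst|exact: surf_bmeas_peval].
have mT : measurable (setT : set3 R) by exact: measurableT.
have mK := measurable_ocell vK; have lK := ocell_lty vK.
have bK q := bmeas_ocell_peval q vK.
transitivity (bd_int K setT (fun n x => c1 n * peval (u2 * w3 - u3 * w2) x)
  + bd_int K setT (fun n x => c2 n * peval (u3 * w1 - u1 * w3) x)
  + bd_int K setT (fun n x => c3 n * peval (u1 * w2 - u2 * w1) x)); last first.
  rewrite -!bd_intD//.
    congr bd_int; apply/funext => n; apply/funext => x.
    rewrite /dot /cross /pfield /peval !coordE.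
    by rewrite !(mpoly.mevalB, mpoly.mevalM).
  by move=> n; apply: surf_bmeasD.
rewrite -D1 -D2 -D3 -!bRintegralD//; last by apply: bmeasD.
apply: eq_RintegralP => x _.
have curlE p1 p2 p3 q1 q2 q3 : is_gradient p1 q1.1.1 q1.1.2 q1.2 ->
    is_gradient p2 q2.1.1 q2.1.2 q2.2 -> is_gradient p3 q3.1.1 q3.1.2 q3.2 ->
    curl (pfield p1 p2 p3) x = (peval q3.1.2 x - peval q2.2 x,
      peval q1.2 x - peval q3.1.1 x, peval q2.1.1 x - peval q1.1.2 x).
  move=> /(derive_gradient x)[_ d12 d13] /(derive_gradient x)[d21 _ d23].
  by move=> /(derive_gradient x)[d31 d32 _]; congr (_ - _, _ - _, _ - _).
rewrite (curlE _ _ _ _ _ _ G1 G2 G3) (curlE _ _ _ _ _ _ H1 H2 H3).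
rewrite /dot /pfield /peval !coordE !(mpoly.mevalB, mpoly.mevalD, mpoly.mevalM).
by ring.
Qed.

Definition sfield (P : field R) :=
  [/\ surf_bmeas (c1 \o P), surf_bmeas (c2 \o P) & surf_bmeas (c3 \o P)].

Lemma surf_bmeasN (f : R3 R -> R) : surf_bmeas f -> surf_bmeas (fun x => - f x).
Proof. by move=> bf sh F; exact: bmeasN (bf sh F). Qed.

Lemma sfield_cst n : sfield (fun=> n).
Proof. by split; exact: surf_bmeas_cst. Qed.

Lemma sfield_pfield p1 p2 p3 : sfield (pfield p1 p2 p3).
Proof. by split; exact: surf_bmeas_peval. Qed.

Lemma sfield_shift P o : sfield P -> sfield (fun x => P (x + o)).
Proof.
by move=> [h1 h2 h3]; split; [exact: surf_bmeas_shift h1|exact: surf_bmeas_shift h2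
  |exact: surf_bmeas_shift h3].
Qed.

Lemma surf_bmeas_dot P Q : sfield P -> sfield Q -> surf_bmeas (fun x => dot (P x) (Q x)).
Proof.
move=> [h1 h2 h3] [k1 k2 k3]; apply: surf_bmeasD; [apply: surf_bmeasD|].
- exact: surf_bmeasM h1 k1.
- exact: surf_bmeasM h2 k2.
- exact: surf_bmeasM h3 k3.
Qed.

Lemma sfield_cross P Q : sfield P -> sfield Q -> sfield (fun x => cross (P x) (Q x)).
Proof.
move=> [h1 h2 h3] [k1 k2 k3]; split.
- exact: surf_bmeasD (surf_bmeasM h2 k3) (surf_bmeasN (surf_bmeasM h3 k2)).
- exact: surf_bmeasD (surf_bmeasM h3 k1) (surf_bmeasN (surf_bmeasM h1 k3)).
- exact: surf_bmeasD (surf_bmeasM h1 k2) (surf_bmeasN (surf_bmeasM h2 k1)).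
Qed.

Lemma sfield_num_trace tr b P Q : sfield P -> sfield Q ->
  sfield (fun x => num_trace tr b (P x) (Q x)).
Proof.
move=> sP sQ; rewrite /num_trace; case: tr => //; try by case: b.
move: sP sQ => [h1 h2 h3] [k1 k2 k3]; rewrite /avg; split.
- exact: surf_bmeasM (surf_bmeas_cst _) (surf_bmeasD h1 k1).
- exact: surf_bmeasM (surf_bmeas_cst _) (surf_bmeasD h2 k2).
- exact: surf_bmeasM (surf_bmeas_cst _) (surf_bmeasD h3 k3).
Qed.

(** The face integrand of the difference of the two curl forms after integration by parts. Primed
    fields are traces from the neighbour; [b] tells whether the element is on the plus side. *)
Definition maxwell_face mf b n (E B E' B' : R3 R) : R :=
  dot n (cross E B) + (dot (cross n (num_trace (rule_B mf) b B B')) E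
  + - dot (cross n (num_trace (rule_E mf) b E E')) B).

(** The expression is minus the product of [n] with a vector that is the same from both sides:
    [E^+ x B^-] or [E^- x B^+] for the alternating fluxes, half their sum for the central ones. *)
Lemma maxwell_face_anti mf b n E B E' B' :
  maxwell_face mf (~~ b) (- n) E' B' E B = - maxwell_face mf b n E B E' B'.
Proof.
by case: mf; case: b; lazy beta iota delta [maxwell_face num_trace rule_B rule_E avg negb];
  rewrite /dot /cross !coordE; field.
Qed.

Lemma curl_pfield p1 p2 p3 : exists q, curl (pfield p1 p2 p3) = pfield q.1.1 q.1.2 q.2.
Proof.
have [g1 G1] := gradient_exists p1; have [g2 G2] := gradient_exists p2.
have [g3 G3] := gradient_exists p3.
exists (g3.1.2 - g2.2, g1.2 - g3.1.1, g2.1.1 - g1.1.2); apply/funext => x.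
have [_ d12 d13] := derive_gradient x G1; have [d21 _ d23] := derive_gradient x G2.
have [d31 d32 _] := derive_gradient x G3.
by rewrite /pfield /peval !mpoly.mevalB; congr (_ - _, _ - _, _ - _).
Qed.

Lemma bmeas_ocell_dot_pfield K p1 p2 p3 q1 q2 q3 : valid_cell K ->
  bmeas (ocell K : set3 R)
    (fun x => dot (pfield p1 p2 p3 x) (pfield q1 q2 q3 x)).
Proof.
move=> vK; have bK q := bmeas_ocell_peval q vK.
exact: bmeasD (bmeasD (bmeasM (bK p1) (bK q1)) (bmeasM (bK p2) (bK q2)))
  (bmeasM (bK p3) (bK q3)).
Qed.

Lemma curl_local K (U P : field R) x : valid_cell K -> ocell K x ->
  (forall y, ocell K y -> U y = P y) -> curl U x = curl P x.
Proof.
move=> vK Kx UP; have nE : \forall y \near x, U y = P y.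
  by apply: filterS (nbhs_ocell vK Kx) => y; exact: UP.
have D (c : R3 R -> R) v : 'D_v (c \o U) x = 'D_v (c \o P) x.
  by apply: near_eq_derive; apply: filterS nE => y /=; move=> ->.
by rewrite /curl !D.
Qed.

End Green.

(** * Adjointness of the discrete curls *)

Section MeshGreen.
Variables (R : realType) (M : dg_mesh R).
Hypothesis vM : valid_mesh M.

Lemma eq_x_faces (K : xidx M) h h' :
  (forall K' s n x, ccell (xcell K) x -> ccell (xcell K') (x - offset M s) ->
     h K' s n x = h' K' s n x) -> x_faces K h = x_faces K h'.
Proof.
move=> hh'; apply: eq_bigr => K' _; apply: eq_bigr => s _.
by apply: eq_bd_int => [|n x K'x Kx]; [exact: valid_xcell|exact: hh'].
Qed.

Lemma x_facesD (K : xidx M) h h' :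
  (forall K' s n, surf_bmeas (h K' s n)) -> (forall K' s n, surf_bmeas (h' K' s n)) ->
  x_faces K (fun K' s n x => h K' s n x + h' K' s n x) = x_faces K h + x_faces K h'.
Proof.
move=> bh bh'; rewrite !x_facesE -big_split; apply: eq_bigr => p _ /=.
by apply: bd_intD => //; exact: measurable_ccell (valid_xshift vM p).
Qed.

Lemma x_facesN (K : xidx M) h : (forall K' s n, surf_bmeas (h K' s n)) ->
  x_faces K (fun K' s n x => - h K' s n x) = - x_faces K h.
Proof.
move=> bh; rewrite !x_facesE -sumrN; apply: eq_bigr => p _ /=.
by apply: bd_intN => //; exact: measurable_ccell (valid_xshift vM p).
Qed.

(** One polynomial field per element, defined on the whole space: it supplies the traces that the
    field itself, arbitrary on element boundaries, does not. *)
Lemma in_U_pfield r (U : field R) : in_U M r U -> exists P : xidx M -> field R,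
  forall K, (exists p, P K = pfield p.1.1 p.1.2 p.2) /\
    forall x, ocell (xcell K) x -> U x = P K x.
Proof.
move=> [[_ H1] [_ H2] [_ H3]].
have H (K : xidx M) : exists P : field R, (exists p, P = pfield p.1.1 p.1.2 p.2) /\
    forall x, ocell (xcell K) x -> U x = P x.
  have [p1 [_ E1]] := H1 K; have [p2 [_ E2]] := H2 K; have [p3 [_ E3]] := H3 K.
  exists (pfield p1 p2 p3); split; first by exists (p1, p2, p3).
  by move=> x Kx; apply: R3P; [exact: E1|exact: E2|exact: E3].
by have [P HP] := choice H; exists P.
Qed.

Lemma vtraceE (K : cell R) (U : field R) p1 p2 p3 x : valid_cell K -> ccell K x ->
  (forall y, ocell K y -> U y = pfield p1 p2 p3 y) -> vtrace K U x = pfield p1 p2 p3 x.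
Proof.
move=> vK Kx UP; congr (_, _, _); apply: traceE => //.
- by move=> y Ky; rewrite /= UP.
- exact: continuous_peval.
- by move=> y Ky; rewrite /= UP.
- exact: continuous_peval.
- by move=> y Ky; rewrite /= UP.
- exact: continuous_peval.
Qed.

(* Integration by parts on each element, then cancellation face by face. *)
Lemma C_form_sum mf r (E B : field R) : in_U M r E -> in_U M r B ->
  \sum_(K : xidx M) C_form (rule_B mf) K B E = \sum_(K : xidx M) C_form (rule_E mf) K E B.
Proof.
move=> /in_U_pfield[PE HE] /in_U_pfield[PB HB]; apply/eqP; rewrite -subr_eq0 -sumrB.
have sE K : sfield (PE K) by have [[p ->] _] := HE K; exact: sfield_pfield.
have sB K : sfield (PB K) by have [[p ->] _] := HB K; exact: sfield_pfield.
have tE (K : xidx M) x : ccell (xcell K) x -> vtrace (xcell K) E x = PE K x.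
  move=> Kx; have [[p pE] EE] := HE K; rewrite pE; apply: vtraceE => //.
    exact: valid_xcell.
  by rewrite -pE.
have tB (K : xidx M) x : ccell (xcell K) x -> vtrace (xcell K) B x = PB K x.
  move=> Kx; have [[p pE] EE] := HB K; rewrite pE; apply: vtraceE => //.
    exact: valid_xcell.
  by rewrite -pE.
pose G (K K' : xidx M) (s : Defs.shift) (n x : R3 R) := maxwell_face mf (xplus K K' s) n
  (PE K x) (PB K x) (PE K' (x - offset M s)) (PB K' (x - offset M s)).
have sG1 K n : surf_bmeas (fun x => dot n (cross (PE K x) (PB K x))).
  by apply: surf_bmeas_dot; [exact: sfield_cst|exact: sfield_cross].
have sGB K K' s n : surf_bmeas (fun x => dot (cross n (num_trace (rule_B mf)
    (xplus K K' s) (PB K x) (PB K' (x - offset M s)))) (PE K x)).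
  apply: surf_bmeas_dot => //; apply: sfield_cross; first exact: sfield_cst.
  by apply: sfield_num_trace => //; exact: sfield_shift.
have sGE K K' s n : surf_bmeas (fun x => dot (cross n (num_trace (rule_E mf)
    (xplus K K' s) (PE K x) (PE K' (x - offset M s)))) (PB K x)).
  apply: surf_bmeas_dot => //; apply: sfield_cross; first exact: sfield_cst.
  by apply: sfield_num_trace => //; exact: sfield_shift.
rewrite (eq_bigr (fun K => x_faces K (G K))); last first.
  move=> K _; have vK := valid_xcell vM K.
  have [[pe peE] eE] := HE K; have [[pb pbE] eB] := HB K.
  rewrite x_facesD//; last by move=> K' s n; apply: surf_bmeasD => //; exact: surf_bmeasN.
  rewrite x_facesD//; last by move=> K' s n; exact: surf_bmeasN.
  rewrite x_facesN// x_faces_cover//.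
  have -> : bd_int (xcell K) setT (fun n x => dot n (cross (PE K x) (PB K x))) =
      x_int K (fun x => dot (B x) (curl E x)) - x_int K (fun x => dot (E x) (curl B x)).
    rewrite peE pbE -Rintegral_curl_cross//.
    have [ce ceE] := curl_pfield pe.1.1 pe.1.2 pe.2.
    have [cb cbE] := curl_pfield pb.1.1 pb.1.2 pb.2.
    rewrite ceE cbE bRintegralB//; first last.
    - exact: bmeas_ocell_dot_pfield.
    - exact: bmeas_ocell_dot_pfield.
    - exact: ocell_lty.
    - exact: measurable_ocell.
    congr (_ - _); apply: eq_RintegralP => x Kx.
      by rewrite -ceE -peE -(curl_local vK Kx eE) -pbE eB.
    by rewrite -cbE -pbE -(curl_local vK Kx eB) -peE eE.
  rewrite /C_form opprD addrACA; congr (_ + _); congr (_ - _).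
    by apply: eq_x_faces => K' s n x Kx K'x; rewrite !tB// tE.
  by apply: eq_x_faces => K' s n x Kx K'x; rewrite !tE// tB.
apply/eqP; apply: (@x_faces_sum0 R M vM G G) => //.
  by move=> K K' s n; apply: surf_bmeasD => //; apply: surf_bmeasD => //; exact: surf_bmeasN.
move=> K K' s n x neq; rewrite /G offset_opp// opprK subrK.
case: vM => _ _ _ /(_ K K' s neq) ->.
exact: maxwell_face_anti.
Qed.

End MeshGreen.

(** * Integrals over partitioned domains *)

Section Partitions.
Variable R : realType.

Lemma bigcup_lty d (T : measurableType d) (mu : {measure set T -> \bar R})
    (I : finType) (A : I -> set T) :
  (forall i, measurable (A i)) -> (forall i, (mu (A i) < +oo)%E) ->
  measurable (\bigcup_i A i) /\ (mu (\bigcup_i A i) < +oo)%E.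
Proof.
move=> mA lA; have -> : \bigcup_i A i = \big[setU/set0]_(i <- enum I) A i.
  rewrite -bigcup_seq; congr bigcup; apply/seteqP.
  by split => // i _ /=; rewrite mem_enum.
elim: (enum I) => [|i s [mS lS]]; first by rewrite big_nil measure0; split; rewrite ?ltry.
rewrite big_cons; split; first exact: measurableU.
by apply: le_lt_trans (measureU2 mu (mA i) mS) _; rewrite lte_add_pinfty ?lA ?lS.
Qed.

Lemma ccell_lty (K : cell R) : valid_cell K -> (@leb3 R (ccell K) < +oo)%E.
Proof.
move=> vK; have mo := measurable_ocell vK; have mc := measurable_ccell vK.
have <- : ocell K `|` (ccell K `\` ocell K) = ccell K.
  by rewrite setDUK//; exact: ocell_ccell.
apply: le_lt_trans (measureU2 _ mo (measurableD mc mo)) _.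
rewrite [X in (_ + X)%E](_ : _ = 0%E) ?adde0; last exact: ccell_null.
exact: ocell_lty.
Qed.

Variables (I : finType) (C : I -> cell R) (D : set3 R).
Hypothesis CD : is_partition C D.

Let vC i : valid_cell (C i). Proof. by case: CD. Qed.

Lemma partition_lty : measurable D /\ (@leb3 R D < +oo)%E.
Proof.
case: CD => _ -> _; apply: bigcup_lty => i; first exact: measurable_ccell.
exact: ccell_lty.
Qed.

Lemma partition_ocell i : ocell (C i) `<=` D.
Proof. by case: CD => _ -> _ x /ocell_ccell Cx; exists i. Qed.

Lemma partition_bmeas_c : [/\ bmeas D c1, bmeas D c2 & bmeas D c3].
Proof.
case: CD => _ -> _; split; apply: bmeas_bigcup => i; try exact: measurable_ccell.
- by case: (bmeas_ccell_c (vC i)).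
- by case: (bmeas_ccell_c (vC i)).
- by case: (bmeas_ccell_c (vC i)).
Qed.

Lemma partition_null : measurable (\bigcup_i ocell (C i) : set3 R) /\
  @leb3 R (D `\` \bigcup_i ocell (C i)) = 0%E.
Proof.
have [mU lU] : measurable (\bigcup_i ocell (C i) : set3 R) /\
    (@leb3 R (\bigcup_i ocell (C i)) < +oo)%E.
  by apply: bigcup_lty => i; [exact: measurable_ocell|exact: ocell_lty].
split => //; have [mD _] := partition_lty.
have [N [mN N0 HN]] : exists N : set3 R, [/\ measurable N,
    @leb3 R N = 0%E & forall x, ~ N x -> forall i, i \in enum I ->
    ccell (C i) x -> ocell (C i) x].
  apply: null_all_seq => i _; exists (ccell (C i) `\` ocell (C i)); split.
  - by apply: measurableD; [exact: measurable_ccell|exact: measurable_ocell].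
  - exact: ccell_null.
  by move=> x nx Cx; apply: contrapT => nox; apply: nx.
apply: (subset_measure0 _ mN _ N0); first exact: measurableD.
move=> x [+ nUx]; case: CD => _ -> _ [i _ Cx].
apply: contrapT => nN; apply: nUx; exists i => //.
by apply: HN Cx => //; rewrite mem_enum.
Qed.

(** The domain minus the open elements is null. Measurability of [g] on all of [D] is asked for
    separately, because boundedness on open elements says nothing about element boundaries. *)
Lemma partition_Rintegral (g : R3 R -> R) : measurable_fun D g ->
  (forall i, bmeas (ocell (C i) : set3 R) g) ->
  \int[@leb3 R]_(x in D) g x = \sum_i \int[@leb3 R]_(x in ocell (C i)) g x.
Proof.
move=> mg bg; have [mD lD] := partition_lty; have [mU U0] := partition_null.
pose U : set3 R := \bigcup_i ocell (C i).
have UD : U `<=` D by move=> x [i _]; exact: partition_ocell.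
rewrite (Rintegral_null_diff mD mU UD U0 mg).
have lU : (@leb3 R U < +oo)%E.
  by apply: le_lt_trans lD; apply: le_measure; rewrite ?inE.
have bU : bmeas U g by apply: bmeas_bigcup => // i; exact: measurable_ocell.
transitivity (\int[@leb3 R]_(x in U `&` setT) g x); first by rewrite setIT.
transitivity (\sum_i \int[@leb3 R]_(x in U `&` ocell (C i)) g x); last first.
  apply: eq_bigr => i _; congr (Rintegral _ _ _); apply/setIidr => x Cx.
  by exists i.
apply: (Rintegral_split (N := set0)) => //.
  by move=> i _; exact: measurable_ocell.
move=> x [i _ Cx] _; rewrite indicE mem_set// (bigD1 i)//= indicE mem_set// big1 ?addr0// => j ji.
rewrite indicE memNset// => Cjx.
case: CD => _ _ /(_ j i ji) dis.
have : (ocell (C j) `&` ocell (C i)) x by [].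
by rewrite dis.
Qed.

End Partitions.

Lemma bmeas_Lfun2 d (T : measurableType d) (R : realType)
    (mu : {measure set T -> \bar R}) (D : set T) (f : T -> R) :
  measurable D -> (mu D < +oo)%E -> bmeas D f -> (f \_ D) \in Lfun mu 2%:E.
Proof.
move=> mD lD bf; have mf : measurable_fun setT (f \_ D).
  by apply/(measurable_restrictT _ mD).1; case: bf.
rewrite inE; apply/andP; split; first by rewrite inE.
rewrite inE /= /finite_norm unlock /Lnorm; apply: poweR_lty.
rewrite (eq_integral (fun x => (((fun x => f x ^+ 2) \_ D) x)%:E)); last first.
  move=> x _; rewrite /= !patchE; case: ifPn => _.
    by rewrite powR_mulrn// real_normK// num_real.
  (* Off [D] the restriction takes the default value [point], which is 0. *)
  by have -> : (point : R) = 0 by []; rewrite normr0 powR0// pnatr_eq0.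
have := bmeas_integrable mD lD (bmeasX 2 bf).
rewrite integrable_mkcond// restrict_EFin => /integrableP[_].
apply: le_lt_trans; apply: le_trans (le_abse_integral _ _ _) => //.
  exact: lee_abs.
apply/measurable_EFinP; apply/(measurable_restrictT _ mD).1.
by case: (bmeasX 2 bf).
Qed.

Section BoundedFields.
Variable R : realType.
Context dT (T : measurableType dT).
Implicit Types (D : set T) (P Q : T -> R3 R).

Definition bfield D P := [/\ bmeas D (c1 \o P), bmeas D (c2 \o P) & bmeas D (c3 \o P)].

Lemma bfield_cst D (x : R3 R) : bfield D (fun=> x).
Proof. by split; exact: bmeas_cst. Qed.

Lemma bfieldD D P Q : bfield D P -> bfield D Q -> bfield D (fun z => P z + Q z).
Proof. by move=> [? ? ?] [? ? ?]; split; exact: bmeasD. Qed.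

Lemma bfield_cross D P Q : bfield D P -> bfield D Q -> bfield D (fun z => cross (P z) (Q z)).
Proof. by move=> [? ? ?] [? ? ?]; split; apply: bmeasB; exact: bmeasM. Qed.

Lemma eq_bfield D P Q : (forall z, D z -> P z = Q z) -> bfield D P -> bfield D Q.
Proof.
move=> PQ [h1 h2 h3]; split.
- by apply: eq_bmeas h1 => z Dz /=; rewrite PQ.
- by apply: eq_bmeas h2 => z Dz /=; rewrite PQ.
- by apply: eq_bmeas h3 => z Dz /=; rewrite PQ.
Qed.

Lemma bmeas_dot D P Q : bfield D P -> bfield D Q -> bmeas D (fun z => dot (P z) (Q z)).
Proof.
move=> [h1 h2 h3] [g1 g2 g3].
exact: bmeasD (bmeasD (bmeasM h1 g1) (bmeasM h2 g2)) (bmeasM h3 g3).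
Qed.

End BoundedFields.

Lemma bfield_comp (R : realType) (e1 e2 : measure_display)
    (T1 : measurableType e1) (T2 : measurableType e2)
    (D : set T1) (E : set T2) (phi : T1 -> T2) (P : T2 -> R3 R) :
  measurable E -> measurable_fun setT phi -> (forall x, D x -> E (phi x)) ->
  bfield E P -> bfield D (P \o phi).
Proof.
move=> mE mphi DE [h1 h2 h3]; split.
- exact: (bmeas_comp mE mphi DE h1).
- exact: (bmeas_comp mE mphi DE h2).
- exact: (bmeas_comp mE mphi DE h3).
Qed.

(** * Densities, their currents and their kinetic energy *)

Section Densities.
Variables (R : realType) (M : dg_mesh R) (k : nat).
Hypothesis vM : valid_mesh M.
Implicit Types (f : density R) (K : xidx M) (L : vidx M) (x v : R3 R).

Lemma x_partition : is_partition (@xcell R M) (omx M : set3 R).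
Proof. by case: vM. Qed.
Lemma v_partition : is_partition (@vcell R M) (omv M : set3 R).
Proof. by case: vM. Qed.

Definition peval6 (p : mpoly.mpoly 6 R) x v : R := mpoly.meval (coord6 x v) p.

Lemma bmeas_peval6 d (T : measurableType d) (D : set T) (phi psi : T -> R3 R) p :
  bfield D phi -> bfield D psi -> bmeas D (fun z => peval6 p (phi z) (psi z)).
Proof.
move=> [h1 h2 h3] [g1 g2 g3].
apply: (@bmeas_meval _ _ _ _ _ (fun z => coord6 (phi z) (psi z))) => i.
by case: i => [[|[|[|[|[|[|//]]]]]] ?].
Qed.

Lemma continuous_peval6_x p v : continuous (fun x => peval6 p x v).
Proof.
have H := @meval_closed R 6 (R3 R) (fun x => coord6 x v) (fun u : R3 R -> R => continuous u).
apply: (H _ _ _ _ p) => {H}.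
- by move=> c; exact: cst_continuous.
- case=> [[|[|[|[|[|[|//]]]]]] ?]; try exact: cst_continuous.
  + exact: continuous_c1.
  + exact: continuous_c2.
  + exact: continuous_c3.
- by move=> f g cf cg x; apply: (cvgD (cf x) (cg x)).
- by move=> f g cf cg x; apply: (cvgM (cf x) (cg x)).
Qed.

Lemma continuous_peval6_v p x : continuous (peval6 p x).
Proof.
have H := @meval_closed R 6 (R3 R) (coord6 x) (fun u : R3 R -> R => continuous u).
apply: (H _ _ _ _ p) => {H}.
- by move=> c; exact: cst_continuous.
- case=> [[|[|[|[|[|[|//]]]]]] ?]; try exact: cst_continuous.
  + exact: continuous_c1.
  + exact: continuous_c2.
  + exact: continuous_c3.
- by move=> f g cf cg v; apply: (cvgD (cf v) (cg v)).
- by move=> f g cf cg v; apply: (cvgM (cf v) (cg v)).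
Qed.

Lemma in_G_peval6 f : in_G M k f -> exists p : xidx M -> vidx M -> mpoly.mpoly 6 R,
  forall K L x v, ocell (xcell K) x -> ocell (vcell L) v -> f x v = peval6 (p K L) x v.
Proof.
move=> [_ H]; have H' (KL : xidx M * vidx M) : exists p, forall x v,
    ocell (xcell KL.1) x -> ocell (vcell KL.2) v -> f x v = peval6 p x v.
  by have [p [_ Hp]] := H KL.1 KL.2; exists p.
have [p Hp] := choice H'; exists (fun K L => p (K, L)) => K L x v Kx Lv.
exact: (Hp (K, L)).
Qed.

Lemma bfield_fst (e : measure_display) (T : measurableType e) (A : set3 R) (B : set T)
  (P : mR3 R -> R3 R) : measurable A -> bfield A P -> bfield (A `*` B) (P \o fst).
Proof. by move=> mA bA; apply: (bfield_comp mA measurable_fst _ bA) => z []. Qed.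

Lemma bfield_snd (e : measure_display) (T : measurableType e) (A : set T) (B : set3 R)
  (P : mR3 R -> R3 R) : measurable B -> bfield B P -> bfield (A `*` B) (P \o snd).
Proof. by move=> mB bB; apply: (bfield_comp mB measurable_snd _ bB) => z []. Qed.

Lemma bmeas_cell_product f K L : in_G M k f ->
  bmeas (ocell (xcell K) `*` ocell (vcell L) : set (mR3 R * mR3 R)) (fun z => f z.1 z.2).
Proof.
move=> /in_G_peval6[p Hp]; have vK := valid_xcell vM K; have vL := valid_vcell vM L.
have b : bmeas (ocell (xcell K) `*` ocell (vcell L) : set (mR3 R * mR3 R))
    (fun z => peval6 (p K L) z.1 z.2).
  apply: bmeas_peval6.
    exact: (bfield_fst (P := id) _ (measurable_ocell vK) (bmeas_ocell_c vK)).
  exact: (bfield_snd (P := id) _ (measurable_ocell vL) (bmeas_ocell_c vL)).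
by apply: eq_bmeas b => -[x v] [Kx Lv] /=; rewrite (Hp K L).
Qed.

Lemma bmeas_cell_v f K L x : in_G M k f -> ocell (xcell K) x ->
  bmeas (ocell (vcell L) : set3 R) (f x).
Proof.
move=> Gf Kx; have b := @bmeas_cell_product f K L Gf.
have mx := measurable_ocell (valid_xcell vM K).
have mv := measurable_ocell (valid_vcell vM L).
apply: (bmeas_comp (measurableX mx mv) (pair1_measurable x) _ b) => v Lv.
by split.
Qed.

(** Holds for every [x] of the box, also on element boundaries where [f] is not polynomial; it
    therefore comes from membership in L^2. *)
Lemma measurable_in_G_section f x : in_G M k f -> omx M x ->
  measurable_fun (omv M : set3 R) (f x).
Proof.
move=> [Lf _] Mx; have [mv _] := partition_lty v_partition.
have mf : measurable_fun setT ((fun z : mR3 R * mR3 R => f z.1 z.2) \_ (omx M `*` omv M)).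
  by move: Lf; rewrite inE => /andP[]; rewrite inE.
have : measurable_fun (omv M : set3 R)
    (fun v => ((fun z : mR3 R * mR3 R => f z.1 z.2) \_ (omx M `*` omv M)) (x, v)).
  exact/measurable_funTS/measurable_fun_pair2.
apply: eq_measurable_fun => v /set_mem Mv.
by rewrite patchE mem_set.
Qed.

Definition vsq : density R := fun=> fun v => dot v v.

Lemma in_G_vsq : (2 <= k)%N -> in_G M k vsq.
Proof.
move=> k2; split.
  have [mx lx] := partition_lty x_partition; have [mv lv] := partition_lty v_partition.
  apply: (@bmeas_Lfun2 _ _ _ (@leb6 R) (omx M `*` omv M) (fun z => vsq z.1 z.2)).
  - exact: measurableX.
  - exact: (product_measure_lty (m1 := @leb3 R) (m2 := @leb3 R)).
  by apply: bmeas_dot; exact: (bfield_snd (P := id) _ mv (partition_bmeas_c v_partition)).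
(* [X i] is the square of a variable, of [msize] 3, which is where [2 <= k] enters; the variables 3,
   4, 5 are the velocities in [coord6]. *)
move=> K L; pose X (i : 'I_6) : mpoly.mpoly 6 R :=
  mpoly.mpolyX R (mpoly.mnm_add (mpoly.mnm1 i) (mpoly.mnm1 i)).
pose i3 : 'I_6 := Ordinal (isT : (3 < 6)%N); pose i4 : 'I_6 := Ordinal (isT : (4 < 6)%N).
pose i5 : 'I_6 := Ordinal (isT : (5 < 6)%N).
have sX i : (mpoly.mmeasure mpoly.mdeg (X i) <= k.+1)%N.
  by rewrite mpoly.msizeX mpoly.mdegD !mpoly.mdeg1.
exists (X i3 + X i4 + X i5); split.
  apply: leq_trans (mpoly.msizeD_le _ _) _; rewrite geq_max sX andbT.
  by apply: leq_trans (mpoly.msizeD_le _ _) _; rewrite geq_max !sX.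
have eX i w : mpoly.meval w (X i) = w i * w i.
  by rewrite /X mpoly.mpolyXD mpoly.mevalM mpoly.mevalXU.
by move=> x v _ _; rewrite !mpoly.mevalD !eX.
Qed.

Lemma Rintegral_omv_sum (g : R3 R -> R) : measurable_fun (omv M : set3 R) g ->
  (forall L, bmeas (ocell (vcell L) : set3 R) g) ->
  \int[@leb3 R]_(v in omv M) g v = \sum_(L : vidx M) v_int L g.
Proof. by move=> mg bg; rewrite (partition_Rintegral v_partition mg bg). Qed.

Lemma Rintegral_omx_sum (g : R3 R -> R) : measurable_fun (omx M : set3 R) g ->
  (forall K, bmeas (ocell (xcell K) : set3 R) g) ->
  \int[@leb3 R]_(x in omx M) g x = \sum_(K : xidx M) x_int K g.
Proof. by move=> mg bg; rewrite (partition_Rintegral x_partition mg bg). Qed.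

Lemma bmeas_v_int K L (g : density R) :
  bmeas (ocell (xcell K) `*` ocell (vcell L) : set (mR3 R * mR3 R)) (fun z => g z.1 z.2) ->
  bmeas (ocell (xcell K) : set3 R) (fun x => v_int L (g x)).
Proof.
move=> bg; have vK := valid_xcell vM K; have vL := valid_vcell vM L.
apply: (bmeas_Rintegral (m1 := @leb3 R) (m2 := @leb3 R) _ _ _ _ bg).
- exact: measurable_ocell.
- exact: measurable_ocell.
- exact: ocell_lty.
- exact: ocell_lty.
Qed.

Lemma bmeas_c_v L (c : R3 R -> R) : c = c1 \/ c = c2 \/ c = c3 ->
  bmeas (ocell (vcell L) : set3 R) c.
Proof.
have [h1 h2 h3] := bmeas_ocell_c (valid_vcell vM L).
by move=> [->|[->|->]].
Qed.

Lemma bmeas_vsq L : bmeas (ocell (vcell L) : set3 R) (fun v => dot v v).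
Proof. by have b := bmeas_ocell_c (valid_vcell vM L); apply: bmeas_dot. Qed.

Lemma bmeas_product_vsq f K L : in_G M k f ->
  bmeas (ocell (xcell K) `*` ocell (vcell L) : set (mR3 R * mR3 R))
    (fun z => f z.1 z.2 * dot z.2 z.2).
Proof.
move=> Gf; apply: bmeasM; first exact: bmeas_cell_product.
have vL := valid_vcell vM L.
by apply: bmeas_dot; exact: (bfield_snd (P := id) _ (measurable_ocell vL) (bmeas_ocell_c vL)).
Qed.

Lemma kinetic_sum f : (2 <= k)%N -> in_G M k f -> kinetic M f =
  \sum_(K : xidx M) \sum_(L : vidx M) x_int K (fun x => v_int L (fun v => f x v * dot v v)).
Proof.
move=> k2 Gf; have [mx lx] := partition_lty x_partition.
have [mv lv] := partition_lty v_partition.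
have GE K x : ocell (xcell K) x -> \int[@leb3 R]_(v in omv M) (f x v * dot v v) =
    \sum_(L : vidx M) v_int L (fun v => f x v * dot v v).
  move=> Kx; apply: Rintegral_omv_sum => [|L].
    apply: measurable_funM; first exact:
      measurable_in_G_section Gf (partition_ocell x_partition Kx).
    have b : bmeas (omv M : set3 R) (fun v => dot v v).
      by apply: bmeas_dot; exact: partition_bmeas_c v_partition.
    by case: b.
  by apply: bmeasM; [exact: bmeas_cell_v Kx|exact: bmeas_vsq].
have bsum K : bmeas (ocell (xcell K) : set3 R)
    (fun x => \sum_(L : vidx M) v_int L (fun v => f x v * dot v v)).
  apply: bmeas_sum => L _; apply: (@bmeas_v_int K L (fun x v => f x v * dot v v)).
  exact: bmeas_product_vsq.
rewrite /kinetic Rintegral_omx_sum.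
- apply: eq_bigr => K _; rewrite -bRintegral_sum.
  + apply: eq_RintegralP => x Kx. exact: (GE K).
  + exact: measurable_ocell (valid_xcell vM K).
  + exact: ocell_lty (valid_xcell vM K).
  + move=> L _; apply: (@bmeas_v_int K L (fun x v => f x v * dot v v)).
    exact: bmeas_product_vsq.
(* The inner integral must be measurable on the whole box. [f] and |v|^2 are both in L^2, so their
   product is integrable and Fubini's theorem applies. *)
- have mD : measurable (omx M `*` omv M : set (mR3 R * mR3 R)) by exact: measurableX.
  have intf : (@leb6 R).-integrable (omx M `*` omv M)
      (EFin \o (fun z : mR3 R * mR3 R => f z.1 z.2 * dot z.2 z.2)).
    apply/(integrable_mkcond _ mD); rewrite restrict_EFin.
    have [Lf _] := Gf; have [Lg _] := in_G_vsq k2.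
    have := Lfun2_mul_Lfun1 Lf Lg => /Lfun1_integrable.
    apply: eq_integrable => // z _ /=; congr EFin; rewrite !patchE.
    by case: ifPn => // _; rewrite mulr0.
  have := @measurable_Rintegral_xsection _ _ _ _ _ (@leb3 R) (@leb3 R) _ _ mD intf.
  move=> /(measurable_funTS (D := omx M)).
  apply: eq_measurable_fun => x /set_mem Mx.
  by rewrite xsection_setX.
by move=> K; apply: eq_bmeas (bsum K) => x Kx; rewrite (GE K x Kx).
Qed.

Lemma current_sum f K x : in_G M k f -> ocell (xcell K) x ->
  current M f x = (\sum_(L : vidx M) v_int L (fun v => f x v * c1 v),
    \sum_(L : vidx M) v_int L (fun v => f x v * c2 v),
    \sum_(L : vidx M) v_int L (fun v => f x v * c3 v)).
Proof.
move=> Gf Kx; have H (c : R3 R -> R) : c = c1 \/ c = c2 \/ c = c3 ->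
    \int[@leb3 R]_(v in omv M) (f x v * c v) = \sum_(L : vidx M) v_int L (fun v => f x v * c v).
  move=> cE; apply: Rintegral_omv_sum => [|L].
    apply: measurable_funM; first exact:
      measurable_in_G_section Gf (partition_ocell x_partition Kx).
    apply: measurable_funTS; case: cE => [->|[->|->]].
    - exact: measurable_c1.
    - exact: measurable_c2.
    - exact: measurable_c3.
  by apply: bmeasM; [exact: bmeas_cell_v Kx|exact: bmeas_c_v].
by rewrite /current !H; tauto.
Qed.

End Densities.

(** * Numerical fluxes and cancellation of the Vlasov face terms *)

Section Fluxes.
Variable R : realType.
Implicit Types (n F v : R3 R) (d a b : R).

(** The common scalar form of the fluxes in [x] and in [v], with the inner trace [a] and the outer
    trace [b]. *)
Definition flux d n F a b : R :=
  (a + b) / 2 * dot F n + d * (`|dot F n| / 2) * ((a - b) * dot n n).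

Lemma x_fluxE d n v a b : x_flux d n v a b = flux d n v a b.
Proof.
by rewrite /x_flux /flux /avg /jump !(dotDl, dotZl) dotNl; field.
Qed.

Lemma v_fluxE d n F a b : v_flux d n F a b = flux d n F a b.
Proof. exact: x_fluxE. Qed.

(** Conservativity of the flux, for central, upwind and downwind alike: [|dot F n|] is even in [n],
    and the average and the jump of the traces have opposite parities. *)
Lemma fluxN d n F a b : flux d (- n) F b a = - flux d n F a b.
Proof. by rewrite /flux !dotNr dotNl normrN; ring. Qed.

Lemma bmeas_flux (e : measure_display) (T : measurableType e) (D : set T) d n
    (P : T -> R3 R) (a b : T -> R) : bfield D P -> bmeas D a -> bmeas D b ->
  bmeas D (fun z => flux d n (P z) (a z) (b z)).
Proof.
move=> bP ba bb; have bPn := bmeas_dot bP (bfield_cst D n).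
apply: bmeasD.
  apply: bmeasM => //; apply: bmeasM; [exact: bmeasD|exact: bmeas_cst].
apply: bmeasM.
  apply: bmeasM; [exact: bmeas_cst|apply: bmeasM; [exact: bmeas_norm|exact: bmeas_cst]].
apply: bmeasM; [exact: bmeasB|exact: bmeas_cst].
Qed.

Lemma bfield_ref_facet sh (F : facet R) o :
  bfield (ref_facet sh : set2 R) (fun t => facet_map F t + o).
Proof.
have [h1 h2 h3] := @surf_bmeas_c R; apply: bfieldD; last exact: bfield_cst.
by split; [exact: h1|exact: h2|exact: h3].
Qed.

(** Face integrals depend on the other variable as a parameter; this permits exchanging the sum over
    elements with the integral in that variable, so that cancellation takes place at a fixed
    parameter. *)
Lemma bmeas_bd_int (A S : set3 R) (K : cell R) (G : R3 R -> R3 R -> R3 R -> R) :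
  measurable A -> (@leb3 R A < +oo)%E -> measurable S ->
  (forall (F : facet R) n, bmeas (A `*` ref_facet (cshape K) : set (mR3 R * mR2 R))
     (fun z => G z.1 n (facet_map F z.2))) ->
  bmeas A (fun z => bd_int K S (G z)).
Proof.
move=> mA lA mS bG; have mr := @measurable_ref_facet R (cshape K).
apply: bmeas_sum => F _; apply: bmeasZ.
have mr' : measurable (ref_facet (cshape K) `&` facet_map F @^-1` S : set2 R).
  by apply: measurableI => //; exact: measurable_facet_preimage.
apply: (bmeas_Rintegral (m1 := @leb3 R) (m2 := @leb2 R)
  (f := fun z t => G z (outward_normal K F) (facet_map F t)) mA mr' lA).
  apply: le_lt_trans (ref_facet_lty R (cshape K)).
  by apply: le_measure; rewrite ?inE//; exact: subIsetl.
apply: bmeasS (bG F (outward_normal K F)); first exact: measurableX.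
by move=> z [? [? _]].
Qed.

Lemma grad_dot_self (v : R3 R) : grad (fun w => dot w w) v = 2 *: v.
Proof.
have D (w : R3 R) : 'D_w (fun w : R3 R => dot w w) v = 2 * dot v w.
  have H := is_deriveD (is_deriveD (is_deriveM (is_derive_c1 v w) (is_derive_c1 v w))
    (is_deriveM (is_derive_c2 v w) (is_derive_c2 v w)))
    (is_deriveM (is_derive_c3 v w) (is_derive_c3 v w)).
  transitivity ('D_w ((@c1 R * @c1 R + @c2 R * @c2 R) + @c3 R * @c3 R) v); first by [].
  by rewrite derive_val /dot /GRing.scale/=; ring.
by rewrite /grad !D; apply: R3P; rewrite !coordE /dot /basis1 /basis2 /basis3 !coordE; ring.
Qed.

Lemma grad_cst (c : R) (x : R3 R) : grad (fun=> c) x = 0.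
Proof. by rewrite /grad !derive_cst. Qed.

End Fluxes.

Section VlasovEnergy.
Variables (R : realType) (M : dg_mesh R) (k : nat).
Hypothesis vM : valid_mesh M.
Implicit Types (f g : density R) (E B : field R) (x v n : R3 R).

Let mK (K : xidx M) := measurable_ocell (valid_xcell vM K).
Let lK (K : xidx M) := ocell_lty (valid_xcell vM K).
Let mL (L : vidx M) := measurable_ocell (valid_vcell vM L).
Let lL (L : vidx M) := ocell_lty (valid_vcell vM L).

Lemma trace_vsq_x (K : xidx M) v x : ccell (xcell K) x ->
  Defs.trace (xcell K) (fun y => vsq y v) x = dot v v.
Proof.
move=> Kx; apply: (@traceE _ _ _ (fun=> dot v v)) => //; first exact: valid_xcell.
exact: cst_continuous.
Qed.

Lemma continuous_dot_self : continuous (fun v : R3 R => dot v v).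
Proof.
move=> v; apply: cvgD; [apply: cvgD|]; apply: cvgM;
  solve [exact: continuous_c1|exact: continuous_c2|exact: continuous_c3].
Qed.

Lemma trace_vsq_v (L : vidx M) x v : ccell (vcell L) v ->
  Defs.trace (vcell L) (vsq x) v = dot v v.
Proof.
move=> Lv; apply: (@traceE _ _ _ (fun w => dot w w)) => //; first exact: valid_vcell.
exact: continuous_dot_self.
Qed.

Lemma bmeas_peval6_facet (A : set3 R) sh (F : facet R) p o : measurable A ->
  bfield A id ->
  bmeas (A `*` ref_facet sh : set (mR3 R * mR2 R))
    (fun z => peval6 p (facet_map F z.2 + o) z.1) /\
  bmeas (A `*` ref_facet sh : set (mR3 R * mR2 R))
    (fun z => peval6 p z.1 (facet_map F z.2 + o)).
Proof.
move=> mA bA; have mr := @measurable_ref_facet R sh.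
have b1 := bfield_fst (P := id) (ref_facet sh : set2 R) mA bA.
have b2 : bfield (A `*` ref_facet sh : set (mR3 R * mR2 R))
    (fun z => facet_map F z.2 + o).
  by apply: (bfield_comp (P := fun t => facet_map F t + o) mr measurable_snd _
    (bfield_ref_facet sh F o)) => z [].
by split; apply: bmeas_peval6.
Qed.

(* Every face is seen from its two sides with opposite fluxes, and |v|^2 does
   not depend on x. *)
Lemma x_transport_sum0 d g (L : vidx M) : in_G M k g ->
  \sum_(K : xidx M) v_int L (fun v => x_faces K (fun K' s n x =>
      x_flux d n v (Defs.trace (xcell K) (fun y => g y v) x)
                   (Defs.trace (xcell K') (fun y => g y v) (x - offset M s))
      * Defs.trace (xcell K) (fun y => vsq y v) x)) = 0.
Proof.
move=> /in_G_peval6[p Hp].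
pose G v (K K' : xidx M) (s : Defs.shift) n x := flux d n v (peval6 (p K L) x v)
  (peval6 (p K' L) (x - offset M s) v) * dot v v.
have trE v (K : xidx M) x : ocell (vcell L) v -> ccell (xcell K) x ->
    Defs.trace (xcell K) (fun y => g y v) x = peval6 (p K L) x v.
  move=> Lv Kx; apply: (@traceE _ _ _ (fun y => peval6 (p K L) y v)) => //.
  - exact: valid_xcell.
  - by move=> y Ky; exact: Hp.
  - exact: continuous_peval6_x.
transitivity (\sum_(K : xidx M) v_int L (fun v => x_faces K (G v K))).
  apply: eq_bigr => K _; apply: eq_RintegralP => v Lv; apply: eq_x_faces => // K' s n x Kx K'x.
  by rewrite x_fluxE !trE// trace_vsq_x.
rewrite /v_int -bRintegral_sum; first last.
- move=> K _; rewrite [X in bmeas _ X](_ : _ = fun v => \sum_(q | q != (K, no_shift))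
    bd_int (xcell K) (ccell (xshift q)) (G v K q.1 q.2)); last first.
    by apply/funext => v; rewrite x_facesE.
  apply: bmeas_sum => -[K' s] _.
  apply: (@bmeas_bd_int R _ _ _ (fun v => G v K K' s)) => //.
    exact: measurable_ccell (valid_xshift vM _).
  move=> F n; have bL := bmeas_ocell_c (valid_vcell vM L).
  have bv := bfield_fst (P := id)
    (ref_facet (cshape (xcell K)) : set2 R) (mL L) bL.
  apply: bmeasM; last exact: bmeas_dot.
  apply: bmeas_flux => //.
    have [b _] := bmeas_peval6_facet (cshape (xcell K)) F (p K L) 0 (mL L) bL.
    by apply: eq_bmeas b => z _ /=; rewrite addr0.
  by have [b _] := bmeas_peval6_facet (cshape (xcell K)) F (p K' L) (- offset M s) (mL L) bL.
- exact: lL.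
- exact: mL.
rewrite -[RHS](Rintegral0 (@leb3 R) (ocell (vcell L))); apply: eq_RintegralP => v Lv.
apply: (@x_faces_sum0 R M vM (G v) (G v)) => //.
  move=> K K' s n sh F;
  apply: bmeasM; last exact: bmeas_cst.
  apply: bmeas_flux; first exact: bfield_cst.
    apply: (@bmeas_peval6 _ _ _ _ (facet_map F) (fun=> v)); last exact: bfield_cst.
    by have := bfield_ref_facet sh F 0; apply: eq_bfield => t _; rewrite addr0.
  apply: (@bmeas_peval6 _ _ _ _ (fun t => facet_map F t - offset M s) (fun=> v)).
    exact: bfield_ref_facet.
  exact: bfield_cst.
move=> K K' s n x neq; rewrite /G offset_opp// opprK subrK fluxN; ring.
Qed.

(** For fixed [x] the Lorentz force is the same function of [v] on both sides of a face, so the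
    fluxes are opposite and |v|^2 has equal traces. Faces on the velocity boundary do not occur in
    [v_faces], hence no boundary term is left. *)
Lemma v_transport_sum0 d g E B (K : xidx M) : in_G M k g ->
  bfield (ocell (xcell K) : set3 R) E -> bfield (ocell (xcell K) : set3 R) B ->
  \sum_(L : vidx M) x_int K (fun x => v_faces L (fun L' n v =>
      v_flux d n (lorentz E B x v) (Defs.trace (vcell L) (g x) v)
                                   (Defs.trace (vcell L') (g x) v)
      * Defs.trace (vcell L) (vsq x) v)) = 0.
Proof.
move=> /in_G_peval6[p Hp] bE bB.
pose G x (L L' : vidx M) n v := flux d n (lorentz E B x v) (peval6 (p K L) x v)
  (peval6 (p K L') x v) * dot v v.
have trE x (L : vidx M) v : ocell (xcell K) x -> ccell (vcell L) v ->
    Defs.trace (vcell L) (g x) v = peval6 (p K L) x v.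
  move=> Kx Lv; apply: (@traceE _ _ _ (peval6 (p K L) x)) => //.
  - exact: valid_vcell.
  - by move=> w Lw; exact: Hp.
  - exact: continuous_peval6_v.
transitivity (\sum_(L : vidx M) x_int K (fun x => v_faces L (G x L))).
  apply: eq_bigr => L _; apply: eq_RintegralP => x Kx; apply: eq_bigr => L' _.
  apply: eq_bd_int => [|n v L'v Lv]; first exact: valid_vcell.
  by rewrite v_fluxE !trE// trace_vsq_v.
rewrite /x_int -bRintegral_sum; first last.
- move=> L _; apply: bmeas_sum => L' _.
  apply: (@bmeas_bd_int R _ _ _ (fun x => G x L L')) => //.
    exact: measurable_ccell (valid_vcell vM _).
  move=> F n; have bK := bmeas_ocell_c (valid_xcell vM K).
  have mr := @measurable_ref_facet R (cshape (vcell L)).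
  have bv : bfield (ocell (xcell K) `*` ref_facet (cshape (vcell L)) : set (mR3 R * mR2 R))
      (fun z => facet_map F z.2).
    apply: (bfield_comp (P := facet_map F) mr measurable_snd) => [z []//|].
    by have := bfield_ref_facet (cshape (vcell L)) F 0; apply: eq_bfield => t _; rewrite addr0.
  have bp q : bmeas (ocell (xcell K) `*` ref_facet (cshape (vcell L)) : set (mR3 R * mR2 R))
      (fun z => peval6 q z.1 (facet_map F z.2)).
    have [_ b] := bmeas_peval6_facet (cshape (vcell L)) F q 0 (mK K) bK.
    by apply: eq_bmeas b => z _ /=; rewrite addr0.
  apply: bmeasM; last exact: bmeas_dot.
  apply: bmeas_flux => //; apply: bfieldD.
    exact: (bfield_fst _ (mK K) bE).
  by apply: bfield_cross => //; exact: (bfield_fst _ (mK K) bB).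
- exact: lK.
- exact: mK.
rewrite -[RHS](Rintegral0 (@leb3 R) (ocell (xcell K))); apply: eq_RintegralP => x Kx.
apply: (@v_faces_sum0 R M vM (G x) (G x)) => //.
  move=> L L' n sh F.
  have bF : bfield (ref_facet sh : set2 R) (facet_map F).
    by have := bfield_ref_facet sh F 0; apply: eq_bfield => t _; rewrite addr0.
  have bp q : bmeas (ref_facet sh : set2 R) (fun t => peval6 q x (facet_map F t)).
    by apply: (@bmeas_peval6 _ _ _ _ (fun=> x) (facet_map F)) => //; exact: bfield_cst.
  apply: bmeasM; last exact: bmeas_dot.
  apply: bmeas_flux => //; apply: bfieldD; first exact: bfield_cst.
  by apply: bfield_cross => //; exact: bfield_cst.
by move=> L L' n v; rewrite /G fluxN; ring.
Qed.

End VlasovEnergy.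

(** * The kinetic energy balance *)

Section VlasovEnergyBalance.
Variables (R : realType) (M : dg_mesh R) (k r : nat).
Hypothesis vM : valid_mesh M.
Implicit Types (f g : density R) (E B : field R) (x v n : R3 R)
  (K : xidx M) (L : vidx M).

Let mK (K : xidx M) := measurable_ocell (valid_xcell vM K).
Let lK (K : xidx M) := ocell_lty (valid_xcell vM K).
Let mL (L : vidx M) := measurable_ocell (valid_vcell vM L).
Let lL (L : vidx M) := ocell_lty (valid_vcell vM L).

Lemma bfield_in_U E (K : xidx M) : in_U M r E -> bfield (ocell (xcell K) : set3 R) E.
Proof.
move=> /in_U_pfield[P HP]; have [[p pE] EP] := HP K.
apply: (@eq_bfield _ _ _ _ (P K)) => [x Kx|]; first by rewrite EP.
by rewrite pE; split; exact: bmeas_ocell_peval (valid_xcell vM K).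
Qed.

Lemma bmeas_moment g K L c : in_G M k g -> c = c1 \/ c = c2 \/ c = c3 ->
  bmeas (ocell (xcell K) : set3 R) (fun x => v_int L (fun v => g x v * c v)).
Proof.
move=> Gg cE; apply: (@bmeas_v_int _ _ vM K L (fun x v => g x v * c v)).
apply: bmeasM; first exact: bmeas_cell_product Gg.
have bc : bmeas (ocell (vcell L) : set3 R) c by exact: bmeas_c_v.
by apply: (bmeas_comp (f := c) (mL L) measurable_snd _ bc) => z [].
Qed.

Lemma bfield_current g K : in_G M k g -> bfield (ocell (xcell K) : set3 R) (current M g).
Proof.
move=> Gg; have b c : c = c1 \/ c = c2 \/ c = c3 ->
    bmeas (ocell (xcell K) : set3 R) (fun x => \sum_(L : vidx M) v_int L (fun v => g x v * c v)).
  by move=> cE; apply: bmeas_sum => L _; exact: bmeas_moment.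
apply: (@eq_bfield _ _ _ _ (fun x => (\sum_(L : vidx M) v_int L (fun v => g x v * c1 v),
    \sum_(L : vidx M) v_int L (fun v => g x v * c2 v),
    \sum_(L : vidx M) v_int L (fun v => g x v * c3 v)))).
  by move=> x Kx; rewrite (current_sum vM Gg Kx).
by split; apply: b; tauto.
Qed.

(** The gradient of |v|^2 is [2 *: v], to which [cross v (B x)] is orthogonal; [E x] does not depend
    on [v] and leaves the velocity integral. *)
Lemma lorentz_work g E B (K : xidx M) : in_G M k g -> in_U M r E ->
  \sum_(L : vidx M) x_int K (fun x => v_int L (fun v =>
      g x v * dot (lorentz E B x v) (grad (vsq x) v)))
  = 2 * x_int K (fun x => dot (E x) (current M g x)).
Proof.
move=> Gg UE; have [e1 e2 e3] := bfield_in_U K UE.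
have bm := bmeas_moment K _ Gg.
pose m L (c : R3 R -> R) x := v_int L (fun v => g x v * c v).
have vE x L : ocell (xcell K) x ->
    v_int L (fun v => g x v * dot (lorentz E B x v) (grad (vsq x) v)) =
    2 * (c1 (E x) * m L c1 x + c2 (E x) * m L c2 x + c3 (E x) * m L c3 x).
  move=> Kx; have bc c : c = c1 \/ c = c2 \/ c = c3 ->
      bmeas (ocell (vcell L) : set3 R) (fun v => g x v * c v).
    by move=> cE; apply: bmeasM; [exact: bmeas_cell_v Gg Kx|exact: bmeas_c_v].
  have bz a c : c = c1 \/ c = c2 \/ c = c3 ->
      bmeas (ocell (vcell L) : set3 R) (fun v => a * (g x v * c v)).
    by move=> cE; exact: bmeasZ (bc c cE).
  have [? ? ?] : [/\ bmeas (ocell (vcell L) : set3 R) (fun v => g x v * c1 v),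
      bmeas (ocell (vcell L) : set3 R) (fun v => g x v * c2 v)
    & bmeas (ocell (vcell L) : set3 R) (fun v => g x v * c3 v)] by split; apply: bc; tauto.
  have [? ? ?] : [/\ bmeas (ocell (vcell L) : set3 R) (fun v => c1 (E x) * (g x v * c1 v)),
      bmeas (ocell (vcell L) : set3 R) (fun v => c2 (E x) * (g x v * c2 v))
    & bmeas (ocell (vcell L) : set3 R) (fun v => c3 (E x) * (g x v * c3 v))].
    by split; apply: bz; tauto.
  transitivity (v_int L (fun v => 2 * (c1 (E x) * (g x v * c1 v) + c2 (E x) * (g x v * c2 v)
      + c3 (E x) * (g x v * c3 v)))).
    apply: eq_RintegralP => v _; rewrite /vsq grad_dot_self /lorentz.
    by rewrite /dot /cross !coordE; ring.
  have mLL := mL L; have lLL := lL L.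
  rewrite /v_int bRintegralZ//; last by apply: bmeasD => //; exact: bmeasD.
  by rewrite !bRintegralD ?bRintegralZ//; exact: bmeasD.
transitivity (\sum_(L : vidx M) x_int K (fun x =>
    2 * (c1 (E x) * m L c1 x + c2 (E x) * m L c2 x + c3 (E x) * m L c3 x))).
  by apply: eq_bigr => L _; apply: eq_RintegralP => x Kx; exact: vE.
have bL L : bmeas (ocell (xcell K) : set3 R)
    (fun x => c1 (E x) * m L c1 x + c2 (E x) * m L c2 x + c3 (E x) * m L c3 x).
  by apply: bmeasD; [apply: bmeasD|]; apply: bmeasM => //; apply: bm; tauto.
rewrite /x_int -bRintegral_sum; first last.
- by move=> L _; exact: bmeasZ (bL L).
- exact: lK.
- exact: mK.
under eq_Rintegral do rewrite -mulr_sumr.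
rewrite bRintegralZ; first last.
- by apply: bmeas_sum => L _; exact: bL.
- exact: lK.
- exact: mK.
congr (2 * _); apply: eq_RintegralP => x Kx.
rewrite (current_sum vM Gg Kx) {1}/dot !coordE !mulr_sumr -!big_split /=.
by apply: eq_bigr => L _.
Qed.

Lemma bmeas_energy_v f (K : xidx M) (L : vidx M) : in_G M k f ->
  bmeas (ocell (xcell K) : set3 R) (fun x => v_int L (fun v => f x v * dot v v)).
Proof.
move=> Gf; apply: (@bmeas_v_int _ _ vM K L (fun x v => f x v * dot v v)).
exact: bmeas_product_vsq Gf.
Qed.

Lemma kinetic_diff f0 f1 (c : R) : (2 <= k)%N -> in_G M k f0 -> in_G M k f1 ->
  \sum_(K : xidx M) \sum_(L : vidx M)
    x_int K (fun x => v_int L (fun v => (f1 x v - f0 x v) / c * vsq x v))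
  = (kinetic M f1 - kinetic M f0) / c.
Proof.
move=> k2 G0 G1; rewrite (kinetic_sum vM k2 G0) (kinetic_sum vM k2 G1).
rewrite -sumrB mulr_suml; apply: eq_bigr => K _.
rewrite -sumrB mulr_suml; apply: eq_bigr => L _.
rewrite /x_int -bRintegralB; try solve [exact: bmeas_energy_v|exact: lK|exact: mK].
rewrite mulrC -bRintegralZ; try solve [exact: lK|exact: mK
  |by apply: bmeasB; exact: bmeas_energy_v].
apply: eq_RintegralP => x Kx.
have b f : in_G M k f -> bmeas (ocell (vcell L) : set3 R) (fun v => f x v * dot v v).
  by move=> Gf; apply: bmeasM; [exact: bmeas_cell_v Gf Kx|exact: bmeas_vsq].
rewrite /v_int -bRintegralB; try solve [exact: b|exact: lL|exact: mL].
rewrite -bRintegralZ; try solve [exact: lL|exact: mL|by apply: bmeasB; exact: b].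
by apply: eq_RintegralP => v _; rewrite /vsq; ring.
Qed.

(* The test function is |v|^2, which is admissible since k >= 2. *)
Lemma vlasov_energy vf (c : R) f0 f1 g E B : (2 <= k)%N -> c != 0 ->
  in_G M k f0 -> in_G M k f1 -> in_G M k g -> in_U M r E -> in_U M r B ->
  vlasov_eq M vf k c f0 f1 g E B ->
  kinetic M f1 - kinetic M f0 =
    2 * c * \sum_(K : xidx M) x_int K (fun x => dot (E x) (current M g x)).
Proof.
move=> k2 c0 G0 G1 Gg UE UB eqn; set d := dissipation vf c in eqn.
(* [i] is the time difference, [a] and [b] are the volume terms in [x] and in [v], [e] and [h] the
   face terms; [a] vanishes because |v|^2 does not depend on [x]. *)
have balance (a b e h i : R) : a = 0 -> i + (- a - b + e + h) = 0 -> i + e = b - h.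
  by move=> -> H; apply/eqP; rewrite -subr_eq0 -H; apply/eqP; ring.
suff H : (kinetic M f1 - kinetic M f0) / c =
    2 * \sum_(K : xidx M) x_int K (fun x => dot (E x) (current M g x)).
  by rewrite -[LHS](divfK c0) H; ring.
rewrite -(kinetic_diff c k2 G0 G1) mulr_sumr.
have eqn' (K : xidx M) (L : vidx M) := eqn K L (@vsq R) (in_G_vsq vM k2).
pose X (K : xidx M) (L : vidx M) := v_int L (fun v => x_faces K (fun K' s n x =>
  x_flux d n v (Defs.trace (xcell K) (fun y => g y v) x)
               (Defs.trace (xcell K') (fun y => g y v) (x - offset M s))
  * Defs.trace (xcell K) (fun y => vsq y v) x)).
have X0 : \sum_(K : xidx M) \sum_(L : vidx M) X K L = 0.
  by rewrite exchange_big big1// => L _; exact: (x_transport_sum0 vM d L Gg).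
rewrite -[LHS]addr0 -[X in _ + X = _]X0 -big_split; apply: eq_bigr => K _ /=.
rewrite -(lorentz_work B K Gg UE).
have V0 := v_transport_sum0 vM d Gg (bfield_in_U K UE) (bfield_in_U K UB).
rewrite -[RHS]subr0 -[X in _ = _ - X]V0 -big_split -sumrB; apply: eq_bigr => L _.
apply: balance (eqn' K L).
rewrite -[RHS](Rintegral0 (@leb3 R) (ocell (xcell K))); apply: eq_RintegralP => x _.
rewrite -[RHS](Rintegral0 (@leb3 R) (ocell (vcell L))); apply: eq_RintegralP => v _.
by rewrite grad_cst /dot !coordE !mulr0 !addr0 mulr0.
Qed.

End VlasovEnergyBalance.

(** * Discrete spaces and the field equations summed over the mesh *)

Section DiscreteSpaces.
Variables (R : realType) (M : dg_mesh R) (k r : nat).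
Hypothesis vM : valid_mesh M.
Implicit Types (f g : density R) (U V W : field R) (a b : R) (K : xidx M) (L : vidx M).

Lemma Lfun2_comb d (T : measurableType d) (mu : {measure set T -> \bar R})
    (D : set T) (u w : T -> R) a b :
  u \_ D \in Lfun mu 2%:E -> w \_ D \in Lfun mu 2%:E ->
  (fun x => a * u x + b * w x) \_ D \in Lfun mu 2%:E.
Proof.
move=> Lu Lw; have p1 : (1 <= (2%:E : \bar R))%E by rewrite lee_fin ler1n.
have [L0 Lc] := Lfun_submod_closed mu p1.
(* Written for two uses of closure under [a *: u + v], starting from 0. *)
have -> : (fun x => a * u x + b * w x) \_ D = a *: (u \_ D) + (b *: (w \_ D) + 0).
  apply/funext => x; rewrite /patch; case: ifPn => Dx.
    by rewrite !fctE /= Dx addr0.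
  by rewrite !fctE /= (negbTE Dx) !scaler0 !addr0.
by apply: (Lc) => //; exact: (Lc).
Qed.

Lemma msize_comb n (p q : mpoly.mpoly n R) a b m :
  (mpoly.mmeasure mpoly.mdeg p <= m)%N -> (mpoly.mmeasure mpoly.mdeg q <= m)%N ->
  (mpoly.mmeasure mpoly.mdeg (a *: p + b *: q) <= m)%N.
Proof.
move=> pm qm; apply: leq_trans (mpoly.msizeD_le _ _) _; rewrite geq_max.
by rewrite !(leq_trans (mpoly.mmeasureZ_le _ _ _)).
Qed.

Lemma in_U_comb U V a b : in_U M r U -> in_U M r V ->
  in_U M r (fun x => a *: U x + b *: V x).
Proof.
have comp u w : in_U_component M r u -> in_U_component M r w ->
    in_U_component M r (fun x => a * u x + b * w x).
  move=> [Lu Hu] [Lw Hw]; split; first exact: (Lfun2_comb a b Lu Lw).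
  move=> K; have [p [sp ep]] := Hu K; have [q [sq eq]] := Hw K.
  exists (a *: p + b *: q); split; first exact: msize_comb.
  by move=> x Kx; rewrite mpoly.mevalD !mpoly.mevalZ ep// eq.
by move=> [u1 u2 u3] [v1 v2 v3]; split; exact: comp.
Qed.

Lemma in_U_midF U V : in_U M r U -> in_U M r V -> in_U M r (midF U V).
Proof.
move=> UU UV; have := in_U_comb 2^-1 2^-1 UU UV.
by under eq_fun do rewrite -scalerDr.
Qed.

Lemma in_G_midf f g : in_G M k f -> in_G M k g -> in_G M k (midf f g).
Proof.
move=> [Lf Hf] [Lg Hg]; rewrite (_ : midf f g = fun x v => 2^-1 * f x v + 2^-1 * g x v).
  split; first exact: (Lfun2_comb 2^-1 2^-1 Lf Lg).
  move=> K L; have [p [sp ep]] := Hf K L; have [q [sq eq]] := Hg K L.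
  exists (2^-1 *: p + 2^-1 *: q); split; first exact: msize_comb.
  by move=> x v Kx Lv; rewrite mpoly.mevalD !mpoly.mevalZ ep// eq.
by apply/funext => x; apply/funext => v; rewrite /midf mulrDr.
Qed.

Lemma measurable_in_U U : in_U M r U ->
  [/\ measurable_fun (omx M : set3 R) (c1 \o U), measurable_fun (omx M : set3 R) (c2 \o U)
    & measurable_fun (omx M : set3 R) (c3 \o U)].
Proof.
have [mx _] := partition_lty (x_partition vM).
have comp u : in_U_component M r u -> measurable_fun (omx M : set3 R) u.
  move=> [Lu _]; apply/(measurable_restrictT _ mx).
  by move: Lu; rewrite inE => /andP[]; rewrite inE.
by move=> [u1 u2 u3]; split; exact: comp.
Qed.

Definition L2prod U V : R := \sum_(K : xidx M) x_int K (fun x => dot (U x) (V x)).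

(** Weaker than membership in the discrete field space, so that it includes the current, whose
    degree is not tied to [r]. *)
Definition cellwise_bounded U := forall K, bfield (ocell (xcell K) : set3 R) U.

Lemma cellwise_bounded_in_U U : in_U M r U -> cellwise_bounded U.
Proof. by move=> UU K; exact: (bfield_in_U vM K UU). Qed.

Lemma cellwise_bounded_current f : in_G M k f -> cellwise_bounded (current M f).
Proof. by move=> Gf K; exact: (bfield_current vM K Gf). Qed.

Lemma L2prodC U V : L2prod U V = L2prod V U.
Proof.
by apply: eq_bigr => K _; apply: eq_RintegralP => x _; rewrite dotC.
Qed.

Lemma L2prod_combl U V W a b : cellwise_bounded U -> cellwise_bounded V ->
  cellwise_bounded W ->
  L2prod (fun x => a *: U x + b *: V x) W = a * L2prod U W + b * L2prod V W.
Proof.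
move=> bU bV bW; rewrite /L2prod !mulr_sumr -big_split; apply: eq_bigr => K _ /=.
have mK := measurable_ocell (valid_xcell vM K); have lK := ocell_lty (valid_xcell vM K).
have bUW := bmeas_dot (bU K) (bW K); have bVW := bmeas_dot (bV K) (bW K).
rewrite /x_int -!bRintegralZ// -bRintegralD//; try exact: bmeasZ.
by apply: eq_RintegralP => x _; rewrite dotDl !dotZl.
Qed.

Lemma L2prod_combr U V W a b : cellwise_bounded U -> cellwise_bounded V ->
  cellwise_bounded W ->
  L2prod W (fun x => a *: U x + b *: V x) = a * L2prod W U + b * L2prod W V.
Proof. by move=> *; rewrite L2prodC L2prod_combl// !(L2prodC W). Qed.

Lemma midFE U V : midF U V = fun x => 2^-1 *: U x + 2^-1 *: V x.
Proof. by apply/funext => x; rewrite /midF scalerDr. Qed.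

Lemma L2prod_midFl U V W : cellwise_bounded U -> cellwise_bounded V ->
  cellwise_bounded W -> L2prod (midF U V) W = (L2prod U W + L2prod V W) / 2.
Proof. by move=> *; rewrite midFE L2prod_combl//; field. Qed.

Lemma L2prod_midFr U V W : cellwise_bounded U -> cellwise_bounded V ->
  cellwise_bounded W -> L2prod W (midF U V) = (L2prod W U + L2prod W V) / 2.
Proof. by move=> *; rewrite midFE L2prod_combr//; field. Qed.

Lemma eq_L2prodr U V W : (forall K x, ocell (xcell K) x -> U x = V x) ->
  L2prod W U = L2prod W V.
Proof.
by move=> UV; apply: eq_bigr => K _; apply: eq_RintegralP => x Kx; rewrite (UV K x Kx).
Qed.

(** Linearity is claimed on open elements, where the densities are polynomial in [v]; products in
    L^2 see nothing else. *)
Lemma current_midf f g K x : in_G M k f -> in_G M k g -> ocell (xcell K) x ->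
  current M (midf f g) x = midF (current M f) (current M g) x.
Proof.
move=> Gf Gg Kx; have Gm := in_G_midf Gf Gg.
rewrite /midF (current_sum vM Gm Kx) (current_sum vM Gf Kx) (current_sum vM Gg Kx).
have H c : c = c1 \/ c = c2 \/ c = c3 ->
    \sum_(L : vidx M) v_int L (fun v => midf f g x v * c v) =
    2^-1 * (\sum_(L : vidx M) v_int L (fun v => f x v * c v) +
      \sum_(L : vidx M) v_int L (fun v => g x v * c v)).
  move=> cE; rewrite -big_split mulr_sumr; apply: eq_bigr => L _ /=.
  have mL := measurable_ocell (valid_vcell vM L); have lL := ocell_lty (valid_vcell vM L).
  have b h : in_G M k h -> bmeas (ocell (vcell L) : set3 R) (fun v => h x v * c v).
    by move=> Gh; apply: bmeasM; [exact: (bmeas_cell_v vM L Gh Kx)|exact: bmeas_c_v].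
  rewrite /v_int -bRintegralD//; try exact: b.
  rewrite -bRintegralZ//; last by apply: bmeasD; exact: b.
  by apply: eq_RintegralP => v _; rewrite /midf; ring.
by rewrite !H; tauto.
Qed.

Lemma field_energy U V U' V' : in_U M r U -> in_U M r V -> in_U M r U' -> in_U M r V' ->
  \int[@leb3 R]_(x in omx M) (dot (U x) (V x) + dot (U' x) (V' x)) =
  L2prod U V + L2prod U' V'.
Proof.
move=> UU UV UU' UV'; have m W W' : in_U M r W -> in_U M r W' ->
    measurable_fun (omx M : set3 R) (fun x => dot (W x) (W' x)).
  move=> /measurable_in_U[? ? ?] /measurable_in_U[? ? ?].
  by apply: measurable_funD; [apply: measurable_funD|]; exact: measurable_funM.
have b W W' K : in_U M r W -> in_U M r W' ->
    bmeas (ocell (xcell K) : set3 R) (fun x => dot (W x) (W' x)).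
  by move=> /cellwise_bounded_in_U bW /cellwise_bounded_in_U bW'; exact: (bmeas_dot (bW K) (bW' K)).
rewrite (Rintegral_omx_sum vM); first last.
- by move=> K; apply: bmeasD; exact: b.
- by apply: measurable_funD; exact: m.
rewrite -big_split; apply: eq_bigr => K _; rewrite /x_int bRintegralD//; try exact: b.
- exact: measurable_ocell (valid_xcell vM K).
- exact: ocell_lty (valid_xcell vM K).
Qed.

Definition C_sum tr U V : R := \sum_(K : xidx M) C_form tr K U V.

Lemma L2prod_step U V W c : c != 0 -> cellwise_bounded U -> cellwise_bounded V ->
  cellwise_bounded W ->
  L2prod (fun x => c^-1 *: (V x - U x)) W = (L2prod V W - L2prod U W) / c.
Proof.
move=> c0 bU bV bW; rewrite mulrBl mulrC (mulrC (L2prod U W)) -mulNr -L2prod_combl//.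
by apply: eq_bigr => K _; apply: eq_RintegralP => x _; rewrite scaleNr -scalerBr.
Qed.

Lemma faraday_L2 mf c B0 B1 E V : c != 0 -> in_U M r B0 -> in_U M r B1 -> in_U M r V ->
  faraday_eq M mf r c B0 B1 E ->
  L2prod B1 V - L2prod B0 V = - c * C_sum (rule_E mf) E V.
Proof.
move=> c0 U0 U1 UV eqn; have := @L2prod_step B0 B1 V c c0.
move=> /(_ (cellwise_bounded_in_U U0) (cellwise_bounded_in_U U1) (cellwise_bounded_in_U UV)) H.
rewrite -[LHS](divfK c0) -H /L2prod (eq_bigr _ (fun K _ => eqn K V UV)) sumrN /C_sum.
by rewrite !mulNr mulrC.
Qed.

Lemma ampere_L2 mf c E0 E1 B J V : c != 0 -> in_U M r E0 -> in_U M r E1 -> in_U M r V ->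
  ampere_eq M mf r c E0 E1 B J ->
  L2prod E1 V - L2prod E0 V = c * (C_sum (rule_B mf) B V - L2prod J V).
Proof.
move=> c0 U0 U1 UV eqn; have := @L2prod_step E0 E1 V c c0.
move=> /(_ (cellwise_bounded_in_U U0) (cellwise_bounded_in_U U1) (cellwise_bounded_in_U UV)) H.
rewrite -[LHS](divfK c0) -H /L2prod (eq_bigr _ (fun K _ => eqn K V UV)) sumrB /C_sum.
by rewrite mulrC.
Qed.

Lemma C_sum_sym mf E B : in_U M r E -> in_U M r B ->
  C_sum (rule_B mf) B E = C_sum (rule_E mf) E B.
Proof. exact: C_form_sum. Qed.

Lemma kinetic_balance vf c f0 f1 g E B : (2 <= k)%N -> c != 0 ->
  in_G M k f0 -> in_G M k f1 -> in_G M k g -> in_U M r E -> in_U M r B ->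
  vlasov_eq M vf k c f0 f1 g E B ->
  kinetic M f1 - kinetic M f0 = 2 * c * L2prod E (current M g).
Proof. exact: vlasov_energy. Qed.

End DiscreteSpaces.

(** * Energy conservation for each time integrator *)

Section Schemes.
Variables (R : realType) (M : dg_mesh R) (vf : vlasov_flux) (mf : maxwell_flux).
Variables (k r : nat).
Hypotheses (vM : valid_mesh M) (k2 : (2 <= k)%N).
Implicit Types (f g : density R) (E B J U V : field R) (c : R) (u w : state R).

Local Notation "'<|' U , V '|>'" := (L2prod M U V) (at level 0).

(** The common core of [scheme2] and [scheme4], which differ in the density [g] carrying the
    current. Tested with the midpoint fields, both field equations give half the differences of
    squared norms; the curl terms cancel by adjointness, and the work of the midpoint electric field
    on the current is what the density gains. *)
Lemma midpoint_energy c f0 f1 g E0 E1 B0 B1 J : c != 0 ->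
  in_G M k f0 -> in_G M k f1 -> in_G M k g ->
  in_U M r E0 -> in_U M r E1 -> in_U M r B0 -> in_U M r B1 ->
  (forall (K : xidx M) x, ocell (xcell K) x -> J x = current M g x) ->
  faraday_eq M mf r c B0 B1 (midF E0 E1) ->
  ampere_eq M mf r c E0 E1 (midF B0 B1) J ->
  vlasov_eq M vf k c f0 f1 g (midF E0 E1) (midF B0 B1) ->
  kinetic M f0 + (<|E0, E0|> + <|B0, B0|>) = kinetic M f1 + (<|E1, E1|> + <|B1, B1|>).
Proof.
move=> c0 G0 G1 Gg UE0 UE1 UB0 UB1 Jg far amp vla.
have UE := in_U_midF UE0 UE1; have UB := in_U_midF UB0 UB1.
have := kinetic_balance vM k2 c0 G0 G1 Gg UE UB vla.
have := faraday_L2 vM c0 UB0 UB1 UB far.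
have := ampere_L2 vM c0 UE0 UE1 UE amp.
rewrite (C_sum_sym vM mf UE UB) (L2prodC M J) (eq_L2prodr _ Jg).
have bd U (UU : in_U M r U) := cellwise_bounded_in_U vM UU.
rewrite !(L2prod_midFr vM (bd _ UE0) (bd _ UE1) (bd _ UE0)).
rewrite !(L2prod_midFr vM (bd _ UE0) (bd _ UE1) (bd _ UE1)).
rewrite !(L2prod_midFr vM (bd _ UB0) (bd _ UB1) (bd _ UB0)).
rewrite !(L2prod_midFr vM (bd _ UB0) (bd _ UB1) (bd _ UB1)).
rewrite (L2prodC M E1 E0) (L2prodC M B1 B0).
set C := C_sum _ _ _ _; set W := <|midF E0 E1, current M g|>.
set kin0 := kinetic M f0; set kin1 := kinetic M f1.
set e00 := <|E0, E0|>; set e01 := <|E0, E1|>; set e11 := <|E1, E1|>.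
set b00 := <|B0, B0|>; set b01 := <|B0, B1|>; set b11 := <|B1, B1|>.
by clearbody C W kin0 kin1 e00 e01 e11 b00 b01 b11; clear; move=> h1 h2 h3; lra.
Qed.

Lemma energyE u : in_U M r (sE u) -> in_U M r (sB u) -> energy M u =
  2^-1 * (kinetic M (sf u) + (<|sE u, sE u|> + <|sB u, sB u|>)).
Proof. by move=> UE UB; rewrite /energy (field_energy vM UE UE UB UB). Qed.

Lemma scheme2_energy c u w : c != 0 -> scheme2 M vf mf k r c u w ->
  energy M u = energy M w.
Proof.
move=> c0 [[[Gu _] UEu UBu] [[Gw _] UEw UBw] [fh [[Gh _] [_ far amp vla]]]].
rewrite (energyE UEu UBu) (energyE UEw UBw).
by rewrite (midpoint_energy c0 Gu Gw Gh UEu UEw UBu UBw _ far amp vla).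
Qed.

Lemma scheme4_energy c u w : c != 0 -> scheme4 M vf mf k r c u w ->
  energy M u = energy M w.
Proof.
move=> c0 [[[Gu _] UEu UBu] [[Gw _] UEw UBw] [far amp vla]].
rewrite (energyE UEu UBu) (energyE UEw UBw).
rewrite (midpoint_energy c0 Gu Gw (in_G_midf Gu Gw) UEu UEw UBu UBw _ far amp vla)//.
by move=> K x Kx; rewrite (current_midf vM Gu Gw Kx).
Qed.

(** [beta1] exceeds 1/2, so [beta2] is negative. Nonzero substeps suffice, since the energy identity
    of [scheme4] holds for steps of either sign. *)
Lemma beta_neq0 : beta1 R != 0 /\ beta2 R != 0.
Proof.
have p1 : 0 < (2 : R) `^ (1 / 3) by rewrite powR_gt0.
have p2 : 0 < (2 : R) `^ (- (1 / 3)) by rewrite powR_gt0.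
have b1 : 1 / 2 < beta1 R by rewrite /beta1; lra.
have b2 : beta2 R < 0 by rewrite /beta2; lra.
by split; [rewrite gt_eqF//; lra|rewrite lt_eqF].
Qed.

Lemma scheme4F_energy c u w : c != 0 -> scheme4F M vf mf k r c u w ->
  energy M u = energy M w.
Proof.
have [b1 b2] := beta_neq0 => c0 [y [z [uy yz zw]]].
rewrite (scheme4_energy _ uy) ?mulf_neq0// (scheme4_energy _ yz) ?mulf_neq0//.
by rewrite (scheme4_energy _ zw) ?mulf_neq0.
Qed.

(* D is the semidiscrete right-hand side of the equation for W, so that the two
   half steps around t_n form a full step from n - 1/2 to n + 1/2. *)
Lemma leapfrog_energy c (W Wh : nat -> field R) (D : nat -> field R -> R) n :
  (forall n, in_U M r (W n)) -> (forall n, in_U M r (Wh n)) ->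
  (forall n V, in_U M r V -> <|Wh n, V|> - <|W n, V|> = c / 2 * D n V) ->
  (forall n V, in_U M r V -> <|W n.+1, V|> - <|Wh n, V|> = c / 2 * D n.+1 V) ->
  in_U M r (prev_half W Wh n) /\
  <|prev_half W Wh n.+1, Wh n.+1|> - <|prev_half W Wh n, Wh n|> =
    c * (D n (Wh n) + D n.+1 (Wh n)).
Proof.
move=> UW UWh half1 half2; have bd U (UU : in_U M r U) := cellwise_bounded_in_U vM UU.
have prevE : prev_half W Wh 0 = fun x => 2 *: W 0%N x + (-1) *: Wh 0%N x.
  by apply/funext => x; rewrite /= scaleN1r.
have Uprev m : in_U M r (prev_half W Wh m).
  by case: m => [|m]; [rewrite prevE; exact: in_U_comb|exact: UWh].
split => //; have full : <|Wh n, Wh n|> - <|prev_half W Wh n, Wh n|> = c * D n (Wh n).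
  (* At [n = 0] the reflection makes the full step twice the first half step; for later [n] it is
     the sum of the half steps before and after t_n. *)
  case: n => [|m].
    rewrite prevE (L2prod_combl vM)//; try exact: bd.
    by have := half1 0%N _ (UWh 0%N); lra.
  by have := half1 m.+1 _ (UWh m.+1); have := half2 m _ (UWh m.+1); rewrite /=; lra.
rewrite [prev_half _ _ n.+1]/= (L2prodC M (Wh n) (Wh n.+1)).
have := half1 n.+1 _ (UWh n); have := half2 n _ (UWh n); lra.
Qed.

(** The equation for [E] is tested with both of its end values, the sum of which gives the
    difference of squared norms; the leapfrog identity tests the two full Faraday steps with the
    intermediate [Bh n]. The curl terms pair up by adjointness, and the two work terms form the work
    of the averaged [E] in the kinetic balance. *)
Lemma scheme1_energy c (u : nat -> state R) (Bh : nat -> field R) : c != 0 ->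
  (forall n, scheme1 M vf mf k r c (u n) (Bh n) (u n.+1)) ->
  forall n, energy1 M u Bh n = energy1 M u Bh n.+1.
Proof.
move=> c0 step n; have c20 : c / 2 != 0 by rewrite mulf_neq0// invr_eq0.
have bd U (UU : in_U M r U) := cellwise_bounded_in_U vM UU.
have Gf m : in_G M k (sf (u m)) by have [[[]]] := step m.
have UE m : in_U M r (sE (u m)) by have [[]] := step m.
have UB m : in_U M r (sB (u m)) by have [[]] := step m.
have UBh m : in_U M r (Bh m) by have [] := step m.
have half1 m V : in_U M r V -> <|Bh m, V|> - <|sB (u m), V|> =
    c / 2 * - C_sum M (rule_E mf) (sE (u m)) V.
  by move=> UV; have [_ _ _ [_ [_ [_ eqn _ _ _]]]] := step m;
    rewrite (faraday_L2 vM c20 (UB m) (UBh m) UV eqn) mulNr mulrN.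
have half2 m V : in_U M r V -> <|sB (u m.+1), V|> - <|Bh m, V|> =
    c / 2 * - C_sum M (rule_E mf) (sE (u m.+1)) V.
  by move=> UV; have [_ _ _ [_ [_ [_ _ _ eqn _]]]] := step m;
    rewrite (faraday_L2 vM c20 (UBh m) (UB m.+1) UV eqn) mulNr mulrN.
have leap m := @leapfrog_energy c (@sB R \o u) Bh
  (fun m => fun V => - C_sum M (rule_E mf) (sE (u m)) V) m UB UBh half1 half2.
have [Up Bdiff] := leap n; have [Up1 _] := leap n.+1.
have [_ _ _ [fh [[Gh _] [_ _ amp _ vla]]]] := step n.
have kin := kinetic_balance vM k2 c0 (Gf n) (Gf n.+1) Gh (in_U_midF (UE n) (UE n.+1)) (UBh n) vla.
have amp0 := ampere_L2 vM c0 (UE n) (UE n.+1) (UE n) amp.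
have amp1 := ampere_L2 vM c0 (UE n) (UE n.+1) (UE n.+1) amp.
move: kin amp0 amp1 Bdiff.
rewrite (C_sum_sym vM mf (UE n) (UBh n)) (C_sum_sym vM mf (UE n.+1) (UBh n)).
rewrite (L2prod_midFl vM (bd _ (UE n)) (bd _ (UE n.+1)) (cellwise_bounded_current vM Gh)).
rewrite !(L2prodC M (current M fh)) (L2prodC M (sE (u n.+1)) (sE (u n))).
rewrite /energy1 (field_energy vM (UE n) (UE n) Up (UBh n)).
rewrite (field_energy vM (UE n.+1) (UE n.+1) Up1 (UBh n.+1)).
set kin0 := kinetic _ _; set kin1 := kinetic _ _.
set C0 := C_sum _ _ (sE (u n)) _; set C1 := C_sum _ _ (sE (u n.+1)) _.
set e00 := <|sE (u n), sE (u n)|>; set e01 := <|sE (u n), sE (u n.+1)|>.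
set e11 := <|sE (u n.+1), sE (u n.+1)|>.
set j0 := <|sE (u n), _|>; set j1 := <|sE (u n.+1), _|>.
set b0 := <|_, Bh n|>; set b1 := <|_, Bh n.+1|>.
by clearbody kin0 kin1 C0 C1 e00 e01 e11 j0 j1 b0 b1; clear; lra.
Qed.

(** The roles of the fields are exchanged: the leapfrog concerns [E], and its right-hand side [D]
    contains the current. The currents at both ends, tested with [Eh n], match the kinetic balance
    because the density is transported at its average. *)
Lemma scheme3_energy c (u : nat -> state R) (Eh : nat -> field R) : c != 0 ->
  (forall n, scheme3 M vf mf k r c (u n) (Eh n) (u n.+1)) ->
  forall n, energy3 M u Eh n = energy3 M u Eh n.+1.
Proof.
move=> c0 step n; have c20 : c / 2 != 0 by rewrite mulf_neq0// invr_eq0.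
have bd U (UU : in_U M r U) := cellwise_bounded_in_U vM UU.
have Gf m : in_G M k (sf (u m)) by have [[[]]] := step m.
have UE m : in_U M r (sE (u m)) by have [[]] := step m.
have UB m : in_U M r (sB (u m)) by have [[]] := step m.
have UEh m : in_U M r (Eh m) by have [] := step m.
pose D m V := C_sum M (rule_B mf) (sB (u m)) V - <|current M (sf (u m)), V|>.
have half1 m V : in_U M r V -> <|Eh m, V|> - <|sE (u m), V|> = c / 2 * D m V.
  by move=> UV; have [_ _ _ [eqn _ _ _]] := step m;
    exact: (ampere_L2 vM c20 (UE m) (UEh m) UV eqn).
have half2 m V : in_U M r V -> <|sE (u m.+1), V|> - <|Eh m, V|> = c / 2 * D m.+1 V.
  by move=> UV; have [_ _ _ [_ _ _ eqn]] := step m;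
    exact: (ampere_L2 vM c20 (UEh m) (UE m.+1) UV eqn).
have leap m := @leapfrog_energy c (@sE R \o u) Eh D m UE UEh half1 half2.
have [Up Ediff] := leap n; have [Up1 _] := leap n.+1.
have [_ _ _ [_ far vla _]] := step n.
have Gm := in_G_midf (Gf n) (Gf n.+1).
have kin := kinetic_balance vM k2 c0 (Gf n) (Gf n.+1) Gm (UEh n) (in_U_midF (UB n) (UB n.+1)) vla.
have far0 := faraday_L2 vM c0 (UB n) (UB n.+1) (UB n) far.
have far1 := faraday_L2 vM c0 (UB n) (UB n.+1) (UB n.+1) far.
move: kin far0 far1 Ediff; rewrite /D.
rewrite (C_sum_sym vM mf (UEh n) (UB n)) (C_sum_sym vM mf (UEh n) (UB n.+1)).
rewrite (eq_L2prodr _ (fun K x => current_midf vM (K := K) (x := x) (Gf n) (Gf n.+1))).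
rewrite (L2prod_midFr vM (cellwise_bounded_current vM (Gf n))
  (cellwise_bounded_current vM (Gf n.+1)) (bd _ (UEh n))).
rewrite !(L2prodC M (current M _)) (L2prodC M (sB (u n.+1)) (sB (u n))).
rewrite /energy3 (field_energy vM (UB n) (UB n) Up (UEh n)).
rewrite (field_energy vM (UB n.+1) (UB n.+1) Up1 (UEh n.+1)).
set kin0 := kinetic _ _; set kin1 := kinetic _ _.
set C0 := C_sum _ _ _ (sB (u n)); set C1 := C_sum _ _ _ (sB (u n.+1)).
set b00 := <|sB (u n), sB (u n)|>; set b01 := <|sB (u n), sB (u n.+1)|>.
set b11 := <|sB (u n.+1), sB (u n.+1)|>.
set j0 := <|_, current M (sf (u n))|>; set j1 := <|_, current M (sf (u n.+1))|>.
set e0 := <|_, Eh n|>; set e1 := <|_, Eh n.+1|>.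
by clearbody kin0 kin1 C0 C1 b00 b01 b11 j0 j1 e0 e1; clear; lra.
Qed.

End Schemes.

Theorem theorem3p2 (R : realType) (M : dg_mesh R) (vf : vlasov_flux)
    (mf : maxwell_flux) (k r : nat) (dt : R)
    (HM : valid_mesh M) (Hk : (2 <= k)%N) (Hdt : 0 < dt) :
  (forall step : state R -> state R -> Prop,
     (step = scheme2 M vf mf k r dt \/ step = scheme4 M vf mf k r dt \/
      step = scheme4F M vf mf k r dt) ->
     forall u : nat -> state R,
       (forall n, step (u n) (u n.+1)) ->
       forall n, energy M (u n) = energy M (u n.+1)) /\
  (forall (u : nat -> state R) (Bh : nat -> field R),
     (forall n, scheme1 M vf mf k r dt (u n) (Bh n) (u n.+1)) ->
     forall n, energy1 M u Bh n = energy1 M u Bh n.+1) /\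
  (forall (u : nat -> state R) (Eh : nat -> field R),
     (forall n, scheme3 M vf mf k r dt (u n) (Eh n) (u n.+1)) ->
     forall n, energy3 M u Eh n = energy3 M u Eh n.+1).
Proof.
have dt0 : dt != 0 by rewrite gt_eqF.
split=> [step stepE u Hu n|]; last first.
  by split=> u h step n; [exact: (scheme1_energy HM Hk dt0 step n)
    |exact: (scheme3_energy HM Hk dt0 step n)].
case: stepE Hu => [->|[->|->]] Hu.
- exact: (scheme2_energy HM Hk dt0 (Hu n)).
- exact: (scheme4_energy HM Hk dt0 (Hu n)).
- exact: (scheme4F_energy HM Hk dt0 (Hu n)).
Qed.
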